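(* Let $n\ge 2$ be a fixed integer, and let $\Omega_n(Q,\mathbb{R})$ be the number of real algebraic integers $\alpha$ of degree $n$ (over $\mathbb{Q}$) and height $H(\alpha)\le Q$. Then, as $Q\to\infty$, \[ \frac{\Omega_n(Q,\mathbb{R})}{(2Q)^n}=2^{-n}\int_{\mathbb{R}}\phi_{n-1}(t)\,dt+1-\frac{4}{3\sqrt{Q}}+r_n(Q,\mathbb{R}), \] where \[ r_n(Q,\mathbb{R})=\begin{cases} O(Q^{-1}), & n\ge 3,\\[2pt] -\dfrac{\ln Q}{Q}+\dfrac{2(1-\gamma)}{Q}+O\!\left(\dfrac{1}{Q\sqrt{Q}}\right), & n=2.\end{cases} \] Here $\gamma=0.5772\dots$ is Euler's constant, and the big-O-constants depend only on $n$ (for $n=2$ the implicit constant is absolute).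
   Context: The height of a polynomial $p(x)=a_nx^n+\dots+a_0$ is $H(p)=\max_{0\le i\le n}|a_i|$. The minimal polynomial of an algebraic number $\alpha\in\mathbb{C}$ is the nonzero polynomial of minimal degree with coprime integer coefficients and positive leading coefficient vanishing at $\alpha$; the degree and height $H(\alpha)$ of $\alpha$ are those of its minimal polynomial. An algebraic integer is an algebraic number whose minimal polynomial is monic. For an integer $m\ge 1$ and $t\in\mathbb{R}$, \[ \phi_m(t)=\int_{G_m(t)}\left|\sum_{k=1}^m k p_k t^{k-1}\right|dp_1\dots dp_m, \] \[ G_m(t)=\left\{(p_1,\dots,p_m)\in\mathbb{R}^m:\ \max_{1\le k\le m}|p_k|\le 1,\ \left|\sum_{k=1}^m p_kt^k\right|\le 1\right\}. \]
   Formalization: For n = 2 the expansion of r_n(Q,R) is stated for integer Q → ∞ only; for real Q it fails (at Q = N + 1/2 the count is that of N, which shifts the ratio by about −2/Q). For n ≥ 3, Q is real. *)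

(* Defs.v *)
From HB Require Import structures.
From mathcomp Require Export all_boot all_order all_algebra finmap.
From mathcomp Require Export all_classical all_reals all_analysis.
Export Order.TTheory GRing.Theory Num.Theory.
Export numFieldNormedType.Exports.

Set Implicit Arguments.
Unset Strict Implicit.
Unset Printing Implicit Defensive.

Local Open Scope classical_set_scope.
Local Open Scope ring_scope.

Definition poly_height (p : {poly int}) : nat := \max_(i < size p) `|(p`_i)%R|%N.

(* [zcontents p] is the gcd of the coefficients of [p], signed by its leading
   coefficient. *)
Definition is_minpoly (R : realType) (p : {poly int}) (a : R) : Prop :=
  [/\ p != 0, root (map_poly intr p) a,
      forall q : {poly int}, q != 0 -> root (map_poly intr q) a ->
        (size p <= size q)%N,
      zcontents p = 1 & 0 < lead_coef p].

Definition algebraic_integers (R : realType) (n : nat) (Q : R) : set R :=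
  [set a | exists2 p : {poly int}, is_minpoly p a &
    [/\ p \is monic, size p = n.+1 & (poly_height p)%:R <= Q]].

(* [fset_set] sends an infinite set to [fset0]; the set here is finite, being
   contained in the roots of finitely many integer polynomials. *)
Definition Omega (R : realType) (n : nat) (Q : R) : nat :=
  #|` fset_set (algebraic_integers n Q)|.

Section lebesgue_tuple_measure.
Context (R : realType).

Definition consp (m : nat) (x : R * m.-tuple R) : m.+1.-tuple R :=
  [tuple of x.1 :: x.2].

Lemma measurable_consp m : measurable_fun setT (@consp m).
Proof. exact: measurable_cons. Qed.

Definition uncons (m : nat) (p : m.+1.-tuple R) : R * m.-tuple R :=
  (thead p, [tuple of behead p]).

Lemma measurable_uncons m : measurable_fun setT (@uncons m).
Proof.
apply: measurable_fun_pair; last exact: measurable_behead.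
exact: (measurable_tnth ord0).
Qed.

Lemma conspK m : @uncons m \o @consp m = id.
Proof.
by apply/funext => -[x p]; congr pair; exact: val_inj.
Qed.

Section step.
Context (m : nat) (mu : {sigma_finite_measure set (m.-tuple R) -> \bar R}).

Definition lebesgue_cons : set (m.+1.-tuple R) -> \bar R :=
  pushforward (@lebesgue_measure R \x mu)%E (@consp m).

Let lebesgue_cons0 : lebesgue_cons set0 = 0%E.
Proof. by rewrite /lebesgue_cons /pushforward preimage_set0 measure0. Qed.

Let lebesgue_cons_ge0 A : (0 <= lebesgue_cons A)%E.
Proof. by rewrite /lebesgue_cons /pushforward measure_ge0. Qed.

Let lebesgue_cons_sigma_additive : semi_sigma_additive lebesgue_cons.
Proof.
move=> F mF tF mUF; rewrite /lebesgue_cons /pushforward preimage_bigcup.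
have mpre A : measurable A -> measurable (@consp m @^-1` A).
  by move=> mA; rewrite -[X in measurable X]setTI; exact: measurable_consp.
apply: measure_semi_sigma_additive.
- by move=> k; exact: mpre.
- apply/trivIsetP => /= i j _ _ ij; rewrite -preimage_setI.
  by move/trivIsetP : tF => /(_ _ _ _ _ ij) ->//; rewrite preimage_set0.
- by rewrite -preimage_bigcup; exact: mpre.
Qed.

HB.instance Definition _ := isMeasure.Build _ _ _ lebesgue_cons
  lebesgue_cons0 lebesgue_cons_ge0 lebesgue_cons_sigma_additive.

Let lebesgue_cons_sigma_finite : sigma_finite setT lebesgue_cons.
Proof.
have /sigma_finiteP[F [FT ndF Foo]] := sigma_finiteT (@lebesgue_measure R).
have /sigma_finiteP[H [HT ndH Hoo]] := sigma_finiteT mu.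
exists (fun k => @uncons m @^-1` (F k `*` H k)).
  apply/esym; rewrite -subTset => p _.
  have [i _ Fi] : (\bigcup_k F k) (thead p) by rewrite -FT.
  have [j _ Hj] : (\bigcup_k H k) [tuple of behead p] by rewrite -HT.
  exists (maxn i j) => //; split => /=.
  - by move: Fi; exact/subsetPset/ndF/leq_maxl.
  - by move: Hj; exact/subsetPset/ndH/leq_maxr.
move=> k; have [mF Fk] := Foo k; have [mH Hk] := Hoo k; split.
  by rewrite -[X in measurable X]setTI; apply: measurable_uncons => //;
    exact: measurableX.
rewrite /lebesgue_cons /pushforward -comp_preimage conspK preimage_id.
by rewrite product_measure1E// lte_mul_pinfty// ge0_fin_numE.
Qed.

HB.instance Definition _ := Measure_isSigmaFinite.Build _ _ _ lebesgue_cons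
  lebesgue_cons_sigma_finite.

End step.

(* Lebesgue measure on R^m, through R^(m+1) = R x R^m. *)
Fixpoint lebesgue_tuple (m : nat) :
    {sigma_finite_measure set (m.-tuple R) -> \bar R} :=
  match m with
  | 0 => dirac [tuple]
  | m'.+1 => lebesgue_cons (lebesgue_tuple m')
  end.

End lebesgue_tuple_measure.

(* Tuples are indexed from 0: the coordinate p_k of (p_1, ..., p_m) is
   [tnth p i] with k = i.+1. *)
Definition G (R : realType) (m : nat) (t : R) : set (m.-tuple R) :=
  [set p | \big[Num.max/0]_(i < m) `|tnth p i| <= 1 /\
           `|\sum_(i < m) tnth p i * t ^+ i.+1| <= 1].

Definition phi (R : realType) (m : nat) (t : R) : R :=
  \int[lebesgue_tuple R m]_(p in @G R m t)
    `|\sum_(i < m) i.+1%:R * tnth p i * t ^+ i|.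

(* [series harmonic k] is 1 + 1/2 + ... + 1/k. *)
Definition euler_gamma (R : realType) : R :=
  lim (series harmonic k - ln k%:R @[k --> \oo]).

(* Main.v *)
(* Idea: the heights are integers, so only K = floor(Q) matters. Irreducible
   monic polynomials are counted through all monic polynomials x^n + a(x) with
   coefficients in [-K, K], each weighted by its number of distinct real roots.

   - Reducible polynomials are negligible for n >= 3: if p = f g with f, g
     monic, peeling off the complex roots of f one at a time bounds
     max(1, |f(0)|) H(g) by a constant times H(p); with deg g >= 2 (possible up
     to swapping f and g) this leaves O(K^(n-1)) pairs (f, g).
   - For fixed higher coefficients, summing the number of roots in (a, b) of
     b_0 + f over the integers |b_0| <= K gives, up to O(1), the integral over
     (a, b) of |f'| on the set |f| <= K. Summing over the other coefficients
     and reading the result as a Riemann sum, the polynomials of degree < n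
     have K^n * int_(a,b) phi_(n-1) + O(K^(n-1)) roots in (a, b). Reversal and
     the sign change x -> -x act on these polynomials, hence the integral of
     phi_(n-1) over R is 2 (int_0^A + int_0^(1/A)) phi_(n-1) for every A > 0.
   - On (0, A) the leading monomial x^n changes the count by O(K^(n-1)) only.
   - Roots beyond A = 4 n^2 are counted in the variable y = 1/x, where the
     polynomial becomes b_0 + 1/y + h(y). The terms beyond the integral of phi
     come from the pole, which only matters for y of order K^(-1/2): there the
     sum over the coefficient b_1 of |b_1 - 1/y^2| exceeds K^2 by
     y^(-4) - (y^(-2) - K)_+^2.

   For n = 2 the sharper error term requires an exact count: the polynomials
   x^2 + b x + c without real root are lattice points above a parabola, and the
   split ones correspond to pairs of integers with product at most K, which
   Dirichlet's hyperbola method counts. *)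

Require Import Defs.
From mathcomp Require Import all_field polyorder polyrcf measurable_realfun.
From mathcomp Require Import ring lra zify.

Set Implicit Arguments.
Unset Strict Implicit.
Unset Printing Implicit Defensive.

Local Open Scope classical_set_scope.
Local Open Scope ring_scope.

(** * Counting the integer translates of a function through its variation *)

Section Integration.
Context (R : realType).
Local Notation mu := (@lebesgue_measure R).
Implicit Types (f g : R -> R) (a b c x M : R).

(** Every error has to be [O(1)] for each choice of the coefficients other than [b_0]. This is
    possible because the number of monotone pieces of a polynomial or of [1/y + h(y)] is bounded by
    the degree alone, and counting the integer levels met on one piece costs at most 1. Near the
    pole, let [s = 1/y^2] and let [r] be the part of [h'(y)] without [b_1]. The shift by [s] changes
    the sum over [b_1] of [|b_1 + r|] by a term linear in [r], of size [r s]. As [r] can be of order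
    [K y], integrating this term would cost an extra factor [ln K]. Negating the remaining
    coefficients turns [r] into [- r], and averaging over both removes it. The cut
    [y_0 = 1 / (n sqrt k)] is placed so that below it the pole dominates the derivative, while above
    it the values stay in [[-K, K]]; all terms that depend on it cancel at the end. The half-integer
    [k = K + 1/2] makes [2 k] the number of integers in [[-K, K]] and puts each of them at the
    middle of a unit cell of [[-k, k]]. *)

Definition Int f a b : R := \int[mu]_(x in `[a, b]) f x.
Definition itg f a b : Prop := mu.-integrable `[a, b] (EFin \o f).

Lemma lebesgue_itv_fin a b : (mu `[a, b] < +oo)%E.
Proof.
by rewrite lebesgue_measure_itv/=; case: ifPn => // _; rewrite -EFinB ltry.
Qed.

Lemma itg_bounded f a b M : measurable_fun `[a, b] f ->
  (forall x, a <= x <= b -> `|f x| <= M) -> itg f a b.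
Proof.
move=> mf bf; apply: measurable_bounded_integrable => //.
  exact: lebesgue_itv_fin.
exists M; split; first exact: num_real.
move=> y My x /=; rewrite in_itv/= => xab.
by rewrite (le_trans (bf _ xab))// ltW.
Qed.

Lemma within_continuous f a b :
  (forall x, a <= x <= b -> {for x, continuous f}) ->
  {within `[a, b], continuous f}.
Proof.
move=> cf; apply: continuous_in_subspaceT => x; rewrite inE/= in_itv/=.
exact: cf.
Qed.

Lemma measurable_cont f a b :
  (forall x, a <= x <= b -> {for x, continuous f}) ->
  measurable_fun `[a, b] f.
Proof.
by move=> cf; apply: subspace_continuous_measurable_fun => //;
  exact: within_continuous.
Qed.

Lemma itg_cont f a b : (forall x, a <= x <= b -> {for x, continuous f}) ->
  itg f a b.
Proof.
move=> cf; apply: continuous_compact_integrable; first exact: segment_compact.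
exact: within_continuous.
Qed.

Lemma itg_cst c a b : itg (fun=> c) a b.
Proof. by apply: itg_cont => x _; exact: cvg_cst. Qed.

Lemma itgB f g a b : itg f a b -> itg g a b -> itg (fun x => f x - g x) a b.
Proof. by move=> ? ?; exact: (@integrableB _ _ _ mu _ _ (EFin \o f) (EFin \o g)). Qed.

Lemma itg_sum (I : finType) (f : I -> R -> R) a b : (forall i, itg (f i) a b) ->
  itg (fun x => \sum_i f i x) a b.
Proof.
move=> itf; rewrite /itg (_ : _ \o _ = (fun x => \sum_i (f i x)%:E)%E).
  by apply: integrable_sum => // i _; exact: itf.
by apply/funext => x /=; rewrite sumEFin.
Qed.

Lemma itgS f a b c d : a <= c -> d <= b -> itg f a b -> itg f c d.
Proof.
move=> ac db; apply: integrableS => //; apply: subset_itv; rewrite bnd_simp//.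
Qed.

Lemma IntB f g a b : itg f a b -> itg g a b ->
  Int (fun x => f x - g x) a b = Int f a b - Int g a b.
Proof. by move=> ? ?; exact: RintegralB. Qed.

Lemma IntZ c f a b : itg f a b -> Int (fun x => c * f x) a b = c * Int f a b.
Proof. by move=> ?; exact: RintegralZl. Qed.

Lemma Int_sum (I : finType) (f : I -> R -> R) a b : (forall i, itg (f i) a b) ->
  Int (fun x => \sum_i f i x) a b = \sum_i Int (f i) a b.
Proof.
move=> itf; rewrite /Int /Rintegral.
under eq_integral do rewrite -sumEFin.
rewrite integral_sum; [|by []|exact: itf].
by rewrite -sum_fine// => i _; apply: integrable_fin_num => //; exact: itf.
Qed.

Lemma Int_cst c a b : a <= b -> Int (fun=> c) a b = c * (b - a).
Proof.
move=> ab; rewrite /Int Rintegral_cst//= lebesgue_measure_itv/= lte_fin.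
by case: ltgtP ab => // ->; rewrite subrr.
Qed.

Lemma Int_le f g a b : itg f a b -> itg g a b ->
  (forall x, a <= x <= b -> f x <= g x) -> Int f a b <= Int g a b.
Proof.
by move=> itf itg fg; apply: le_Rintegral => // x /=; rewrite in_itv/=; exact: fg.
Qed.

Lemma Int_bound f a b M : a <= b -> itg f a b ->
  (forall x, a <= x <= b -> `|f x| <= M) -> `|Int f a b| <= M * (b - a).
Proof.
move=> ab itf bf; apply: (le_trans (le_normr_Rintegral _ _)) => //.
rewrite -(Int_cst M ab); apply: Int_le => //; last exact: itg_cst.
by have /integrable_abse := itf.
Qed.

Lemma Int_split f a b c : a <= c -> c <= b -> itg f a b ->
  Int f a b = Int f a c + Int f c b.
Proof.
move=> ac cb itf.
have itf' : mu.-integrable `]c, b] (EFin \o f).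
  by apply: integrableS itf => //; apply: subset_itv; rewrite bnd_simp.
have := Rintegral_itvB itf; move=> /(_ c).
rewrite !bnd_simp => /(_ ac cb).
by rewrite Rintegral_itv_obnd_cbnd// /Int => <-; rewrite addrC subrK.
Qed.

Lemma Int_eq f g a b : itg f a b -> (forall x, a < x < b -> f x = g x) ->
  Int f a b = Int g a b.
Proof.
move=> itf fg.
have mf : measurable_fun (`]a, b[%classic : set R) (fun x : R => (f x)%:E).
  apply: (@measurable_funS _ _ _ _ `[a, b]) => //.
    by apply: subset_itv; rewrite bnd_simp.
  exact: measurable_int itf.
have fgE x : x \in (`]a, b[%classic : set R) -> (f x)%:E = (g x)%:E.
  by rewrite inE/= in_itv/= => /fg ->.
rewrite /Int /Rintegral (integral_itv_bndoo _ _ mf).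
rewrite (integral_itv_bndoo _ _ (eq_measurable_fun _ fgE mf)).
by congr fine; exact: eq_integral.
Qed.

Lemma Int_nil f a b : b <= a -> Int f a b = 0.
Proof.
rewrite le_eqVlt => /predU1P[->|ba]; first by rewrite /Int set_itv1 Rintegral_set1.
by rewrite /Int set_itv_ge ?Rintegral_set0// bnd_simp -ltNge.
Qed.

Lemma Int_FTC f g a b : a <= b ->
  (forall x, a <= x <= b -> is_derive x 1 f (g x)) ->
  (forall x, a <= x <= b -> {for x, continuous g}) ->
  Int g a b = f b - f a.
Proof.
rewrite le_eqVlt => /predU1P[->|ab] df cg; first by rewrite Int_nil// subrr.
rewrite /Int /Rintegral (@continuous_FTC2 _ g f)//=.
- exact: within_continuous.
- have cf x : a <= x <= b -> f @ x --> f x.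
    move=> /df dfx.
    by apply: differentiable_continuous; apply/derivable1_diffP; case: dfx.
  split.
  + by move=> x; rewrite in_itv/= => /andP[/ltW ? /ltW ?]; case: (df x) => //; apply/andP.
  + by apply: cvg_at_right_filter; apply: cf; rewrite lexx ltW.
  + by apply: cvg_at_left_filter; apply: cf; rewrite lexx ltW.
- move=> x; rewrite in_itv/= => /andP[/ltW ? /ltW ?].
  have xab : a <= x <= b by apply/andP.
  by have [_ <-] := df _ xab; rewrite derive1E.
Qed.

End Integration.

(** * Clamped variation on monotone pieces and counting of integer levels *)

Section ClampedVariation.
Context (R : realType).
Implicit Types (f g : R -> R) (a b c u v x K : R).

(* the integrand of the total variation of [f] clamped to [-K, K] *)
Definition vden f g K x : R := `|g x| * (`|f x| <= K)%R%:R.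
Definition clamp K x : R := Num.min (Num.max x (- K)) K.

Lemma itg_vden f g K a b :
  (forall x, a <= x <= b -> {for x, continuous f}) ->
  (forall x, a <= x <= b -> {for x, continuous g}) ->
  itg (vden f g K) a b.
Proof.
move=> cf cg.
have ing : itg (fun x => `|g x|) a b.
  by apply: itg_cont => x xab; apply: continuous_comp;
   [exact: cg | exact: norm_continuous].
apply: (le_integrable _ _ _ ing) => //.
  apply/measurable_EFinP; apply: measurable_funM.
    by apply/measurable_EFinP; exact: measurable_int ing.
  have mb : measurable_fun setT (fun b : bool => b%:R : R) by [].
  apply: (measurableT_comp mb).
  apply: measurable_fun_ler => //; apply: measurableT_comp => //.
  exact: measurable_cont.
move=> x _ /=; rewrite lee_fin /vden normrM normr_id.
by rewrite ler_piMr// normr_nat; case: (_ <= K).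
Qed.

(** The integrand vanishes where [f] is outside [[-K, K]] and equals [g] where it is inside. By
    monotonicity the inside part is a single interval, whose ends come from the intermediate value
    theorem; the fundamental theorem of calculus does the rest. *)
Lemma Int_vden_incr f g K u v : u <= v -> 0 <= K ->
  (forall x, u <= x <= v -> is_derive x 1 f (g x)) ->
  (forall x, u <= x <= v -> {for x, continuous g}) ->
  (forall x, u < x < v -> 0 <= g x) ->
  {in `[u, v] &, {homo f : x y / x < y}} ->
  Int (vden f g K) u v = clamp K (f v) - clamp K (f u).
Proof.
move=> uv K0 df cg g0 fincr.
have cf x : u <= x <= v -> {for x, continuous f}.
  move=> /df dfx.
  by apply: differentiable_continuous; apply/derivable1_diffP; case: dfx.
have ivd := itg_vden K cf cg.
have finc x y : u <= x -> x < y -> y <= v -> f x < f y.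
  by move=> ux xy yv; apply: fincr => //; rewrite in_itv/=; apply/andP; split=> //; lra.
have fle x y : u <= x -> x <= y -> y <= v -> f x <= f y.
  by move=> ux; rewrite le_eqVlt => /predU1P[->//|xy] yv; apply/ltW/finc.
have zero x y : u <= x -> y <= v -> (forall z, x < z < y -> K < `|f z|) ->
    Int (vden f g K) x y = 0.
  move=> ux yv fK; have [yx|/ltW xy] := leP y x; first exact: Int_nil.
  rewrite (@Int_eq _ _ (fun=> 0)); first by rewrite Int_cst// mul0r.
    exact: itgS ivd.
  by move=> z /fK; rewrite ltNge /vden => /negbTE ->; rewrite mulr0.
have fuv := fle _ _ (lexx u) uv (lexx v).
(* First the two cases where the whole piece lies outside the band: the clamped values at both ends
   then agree. *)
have [fv|fv] := ltP (f v) (- K).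
  rewrite zero// /clamp; last first.
    move=> z /andP[uz zv]; have := finc _ _ (ltW uz) zv (lexx v).
    by move=> ?; rewrite ltr0_norm; lra.
  by rewrite !max_r; lra.
have [fu|fu] := ltP K (f u).
  rewrite zero// /clamp; last first.
    move=> z /andP[uz zv]; have := finc _ _ (lexx u) uz (ltW zv).
    by move=> ?; rewrite gtr0_norm; lra.
  by rewrite !max_l ?min_r; lra.
(* [u'] and [v'] are the points where [f] enters and leaves the band, or the ends of the piece when
   [f] starts or stops inside it. *)
have [u' u'uv fu'] : exists2 c, c \in `[u, v] & f c = Num.max (f u) (- K).
  apply: IVT => //; first exact: within_continuous.
  by rewrite min_l// (max_r fuv) le_max lexx/= ge_max fuv.
have [v' v'uv fv'] : exists2 c, c \in `[u, v] & f c = Num.min (f v) K.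
  apply: IVT => //; first exact: within_continuous.
  by rewrite (min_l fuv) (max_r fuv) le_min ge_min fuv fu lexx.
move: u'uv v'uv; rewrite !in_itv/= => /andP[uu' u'v] /andP[uv' v'v].
have u'v' : u' <= v'.
  rewrite leNgt; apply/negP => /(finc _ _ uv') /(_ u'v); rewrite fu' fv'.
  by case: (leP (f u)); case: (leP (f v)); lra.
rewrite (Int_split uu' u'v ivd) zero//; last first.
  move=> z /andP[uz zu']; have := finc _ _ (ltW uz) zu' u'v; rewrite fu'.
  have := finc _ _ (lexx u) uz (le_trans (ltW zu') u'v).
  by case: (leP (f u)) => ? ? ?; [rewrite ltr0_norm; lra|lra].
rewrite add0r (Int_split u'v' v'v (itgS uu' (lexx _) ivd)).
rewrite [X in _ + X]zero ?addr0//; last first.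
  move=> z /andP[uz zu']; have := finc _ _ uv' uz (ltW zu'); rewrite fv'.
  have := finc _ _ (le_trans uv' (ltW uz)) zu' (lexx v).
  by case: (leP (f v) K) => ? ? ?; [lra|rewrite (lt_le_trans _ (ler_norm _))].
rewrite (@Int_eq _ _ g).
- have dg x : u' <= x <= v' -> is_derive x 1 f (g x) by move=> ?; apply: df; lra.
  rewrite (Int_FTC u'v' dg); last by move=> x ?; apply: cg; lra.
  rewrite fu' fv' /clamp (max_l fv).
  by rewrite [Num.min (Num.max _ _) _]min_l// ge_max fu/=; lra.
- by apply: itgS ivd.
- move=> z /andP[u'z zv']; rewrite /vden ger0_norm ?g0//; last lra.
  have := finc _ _ uu' u'z (le_trans (ltW zv') v'v).
  have := finc _ _ (le_trans uu' (ltW u'z)) zv' v'v.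
  rewrite fu' fv' lt_min gt_max => /andP[_ ?] /andP[_ ?].
  by rewrite ler_norml [_ <= _]ltW//= [_ <= _]ltW//= mulr1.
Qed.

Lemma clampN K x : 0 <= K -> clamp K (- x) = - clamp K x.
Proof.
rewrite /clamp => K0; case: (leP (- x)); case: (leP x) => ? ?; rewrite !minElt;
  do ?case: ltP => ?; lra.
Qed.

Lemma clamp_le K x y : x <= y -> clamp K x <= clamp K y.
Proof.
move=> xy; rewrite /clamp le_min !ge_min lexx orbT andbT.
by rewrite ge_max !le_max xy lexx orbT.
Qed.

Lemma derive_cont f a b g :
  (forall x, a <= x <= b -> is_derive x 1 f (g x)) ->
  forall x, a <= x <= b -> {for x, continuous f}.
Proof.
move=> df x /df dfx.
by apply: differentiable_continuous; apply/derivable1_diffP; case: dfx.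
Qed.

(** A continuous [g] without zeros keeps the sign it has at the midpoint, by the intermediate value
    theorem. The sign is stored as [(-1) ^+ e], so that increasing and decreasing pieces are handled
    together. *)
Lemma derive_neq0_mono f g u v : u < v ->
  (forall x, u <= x <= v -> is_derive x 1 f (g x)) ->
  (forall x, u <= x <= v -> {for x, continuous g}) ->
  (forall x, u < x < v -> g x != 0) ->
  exists e : bool,
    (forall x, u < x < v -> 0 < (-1) ^+ e * g x) /\
    {in `[u, v] &, {homo (fun x => (-1) ^+ e * f x) : x y / x < y}}.
Proof.
move=> uv df cg g0.
pose m := (u + v) / 2; have muv : u < m < v by rewrite /m; lra.
pose e := g m < 0; exists e.
have gm : 0 < (-1) ^+ e * g m.
  have := g0 _ muv; rewrite /e; case: (ltgtP (g m) 0) => //= gm _.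
    by rewrite expr1 mulN1r oppr_gt0.
  by rewrite expr0 mul1r.
have pos x : u < x < v -> 0 < (-1) ^+ e * g x.
  move=> xuv; rewrite ltNge; apply/negP => gx.
  have [c cin gc] : exists2 c, c \in `[Num.min x m, Num.max x m] &
      (-1) ^+ e * g c = 0.
    apply: (@IVT _ (fun x => (-1) ^+ e * g x)).
    - by rewrite le_max ge_min lexx.
    - apply: within_continuous => y; rewrite ge_min le_max => yin.
      apply: continuousM; first exact: cvg_cst.
      by apply: cg; case/andP: yin => /orP[] ? /orP[] ?; lra.
    - have [xm|mx] := leP x m.
        by rewrite ge_min le_max gx (ltW gm) orbT.
      by rewrite ge_min le_max gx (ltW gm) !orbT.
  move/eqP: gc; rewrite mulf_eq0 signr_eq0/=; apply/negP/g0.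
  by move: cin; rewrite in_itv/= ge_min le_max => /andP[/orP[] ? /orP[] ?]; lra.
split=> //.
have dsf x : x \in `]u, v[ -> is_derive x 1 (fun x => (-1) ^+ e * f x) ((-1) ^+ e * g x).
  rewrite in_itv/= => xuv.
  have xuv' : u <= x <= v by lra.
  have := df _ xuv' => ?.
  by apply: is_deriveZ.
apply: gtr0_derive1_lt_cc.
- by move=> x xuv; case: (dsf _ xuv).
- move=> x xuv; rewrite derive1E; have [_ ->] := dsf _ xuv.
  by apply: pos; move: xuv; rewrite in_itv.
- apply: within_continuous => x xuv; apply: continuousM; first exact: cvg_cst.
  exact: derive_cont df _ xuv.
Qed.

Lemma vdenN f g K : vden (fun x => - f x) (fun x => - g x) K = vden f g K.
Proof. by apply/funext => x; rewrite /vden !normrN. Qed.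

Lemma Int_vden_mono f g K u v : u <= v -> 0 <= K ->
  (forall x, u <= x <= v -> is_derive x 1 f (g x)) ->
  (forall x, u <= x <= v -> {for x, continuous g}) ->
  (forall x, u < x < v -> g x != 0) ->
  Int (vden f g K) u v = `|clamp K (f v) - clamp K (f u)|.
Proof.
rewrite le_eqVlt => /predU1P[<-{v}|uv] K0 df cg g0.
  by rewrite Int_nil// subrr normr0.
have [[] [gpos finc]] := derive_neq0_mono uv df cg g0.
  have dN x : u <= x <= v -> is_derive x 1 (fun x => - f x) (- g x).
    by move=> /df ?; apply: is_deriveN.
  rewrite -vdenN (Int_vden_incr (ltW uv) K0 dN).
  - have fvu : f v <= f u.
      have := finc u v; rewrite !expr1 !mulN1r ltrN2 => fuv.
      by apply/ltW/fuv => //; rewrite in_itv/= lexx ltW.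
    have := clamp_le K fvu => ?.
    by rewrite !clampN// ler0_norm; lra.
  - by move=> x /cg ?; apply: continuousN.
  - by move=> x /gpos; rewrite expr1 mulN1r => /ltW.
  - by move=> x y xuv yuv /(finc _ _ xuv yuv); rewrite expr1 !mulN1r.
rewrite (Int_vden_incr (ltW uv) K0 df)//.
- rewrite ger0_norm// subr_ge0; apply: clamp_le; rewrite ltW//.
  by have := finc u v; rewrite !expr0 !mul1r; apply=> //; rewrite in_itv/= lexx ltW.
- by move=> x /gpos; rewrite expr0 mul1r => /ltW.
- by move=> x y xuv yuv /(finc _ _ xuv yuv); rewrite expr0 !mul1r.
Qed.

(* [P] stands for [<] or [<=]. *)
Lemma count_below (P : R -> R -> bool) (M : nat) (x : R) :
  (forall y z, y < z -> P y z) -> (forall y z, P y z -> y <= z) ->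
  `|\sum_(i < M.+1) (P i%:R x)%:R - (Num.min (Num.max x 0) M%:R + 2^-1)| <= 2^-1 :> R.
Proof.
move=> ltP Ple.
have full m : m%:R < x -> \sum_(i < m.+1) (P i%:R x)%:R = m.+1%:R :> R.
  move=> mx; rewrite -[in RHS](card_ord m.+1) -sumr_const.
  apply: eq_bigr => i _; rewrite ltP//.
  by apply: le_lt_trans mx; rewrite ler_nat -ltnS.
elim: M => [|M IH].
  rewrite big_ord1 min_r ?le_max ?lexx ?orbT// add0r.
  by rewrite ler_norml; case: (P _ _) => /=; lra.
rewrite big_ord_recr/=; have [xM|Mx] := leP x M%:R.
  have M0 : 0 <= M%:R :> R by [].
  have M1 : M.+1%:R = M%:R + 1 :> R by rewrite -natr1.
  rewrite min_l ?ge_max ?xM// in IH.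
  have -> : P M.+1%:R x = false by apply/negP => /Ple; lra.
  by rewrite addr0 min_l// ge_max; lra.
rewrite (full _ Mx) max_l; last by rewrite ltW// (le_lt_trans _ Mx).
have M1 : M.+1%:R = M%:R + 1 :> R by rewrite -natr1.
have [xM1|Mx1] := leP x M.+1%:R.
  by rewrite ler_norml; case: (boolP (P _ x)) => [/Ple|_] /=; lra.
by rewrite (ltP _ _ Mx1) ler_norml /=; lra.
Qed.

(** The count is a strict count from below minus a non-strict one. Each is known up to 1/2, and the
    additive constants 1/2 cancel, so the error 1 is independent of [K], [x] and [y]. *)
Lemma count_between (K : nat) (x y : R) : x < y ->
  `|\sum_(i < K.*2.+1) (x < i%:R - K%:R < y)%R%:R - (clamp K%:R y - clamp K%:R x)|
    <= 1 :> R.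
Proof.
move=> xy.
have cl z : Num.min (Num.max (z + K%:R) 0) K.*2%:R = clamp K%:R z + K%:R.
  have K2 : K.*2%:R = K%:R + K%:R :> R by rewrite -addnn natrD.
  have K0 : 0 <= K%:R :> R by [].
  by rewrite /clamp; case: (leP z); case: (leP (z + _)) => ? ?; rewrite ?minElt;
     do ?case: ltP => ?; lra.
have := @count_below (fun a b => a < b) K.*2 (y + K%:R).
move=> /(_ (fun _ _ => id) (fun _ _ => @ltW _ _ _ _)).
have := @count_below (fun a b => a <= b) K.*2 (x + K%:R).
move=> /(_ (fun _ _ => @ltW _ _ _ _) (fun _ _ => id)).
have -> : \sum_(i < K.*2.+1) (x < i%:R - K%:R < y)%R%:R =
    \sum_(i < K.*2.+1) (i%:R < y + K%:R)%R%:R -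
    \sum_(i < K.*2.+1) (i%:R <= x + K%:R)%R%:R :> R.
  rewrite -sumrB; apply: eq_bigr => i _.
  rewrite ltrBDr ltrBlDr ltNge.
  have [h|h] /= := leP i%:R (x + K%:R); last by rewrite subr0.
  by rewrite (le_lt_trans h) ?subrr// ltrD2r.
by rewrite !cl; move: (\sum_i _) (\sum_i _) => A B; rewrite !ler_norml; lra.
Qed.

End ClampedVariation.

(** * Roots of all integer translates of a function: a discrete coarea formula *)

Section Coarea.
Context (R : realType).
Implicit Types (f g : R -> R) (a b c u v x : R) (p : {poly R}).

(** Distinct roots in the open interval. The zero polynomial has none by convention, so the sums
    over all polynomials can keep it. *)
Definition nroots p a b : nat := size (roots p a b).

Lemma nroots_split p a x b : p != 0 -> a < x -> x < b ->
  nroots p a b = (nroots p a x + root p x + nroots p x b)%N.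
Proof.
move=> p0 ax xb.
rewrite /nroots (@perm_size _ _ (roots p a x ++ nseq (root p x) x ++ roots p x b)).
  by rewrite !size_cat size_nseq addnA.
apply: uniq_perm; first exact: uniq_roots.
  rewrite !cat_uniq !uniq_roots/= andbT; apply/and3P; split.
  - apply/hasPn => y; rewrite mem_cat !in_roots !in_itv/=.
    case/orP => [|/and3P[_ /andP[xy _] _]].
      by rewrite mem_nseq => /andP[_ /eqP ->]; rewrite ltxx andbF !andbF.
    by rewrite [y < x]ltNge (ltW xy)/= !andbF.
  - by case: (root p x).
  - apply/hasPn => y; rewrite in_roots in_itv/= mem_nseq => /and3P[_ /andP[xy _] _].
    by rewrite negb_and (gt_eqF xy) orbT.
move=> y; rewrite !mem_cat mem_nseq !in_roots !in_itv/= p0 !andbT.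
have [yx|xy|->] := ltgtP y x.
- by rewrite (lt_trans yx xb)/= !andbT !andbF !orbF.
- by rewrite (lt_trans ax xy)/= !andbF.
- by rewrite ax xb/= !andbF !andbT orbF/=; case: (root p x).
Qed.

Lemma nroots_sum_rev (K : nat) (F : R -> R) :
  \sum_(i < K.*2.+1) F (K%:R - i%:R) = \sum_(i < K.*2.+1) F (i%:R - K%:R).
Proof.
rewrite (reindex_inj rev_ord_inj)/=; apply: eq_bigr => i _; congr F.
rewrite subSS natrB; last by rewrite -ltnS.
have -> : K.*2%:R = K%:R + K%:R :> R by rewrite -addnn natrD.
ring.
Qed.

Section Fibres.
Variables (f g : R -> R) (K : nat) (q : 'I_K.*2.+1 -> {poly R}).
Hypothesis q0 : forall i, q i != 0.

(** On a monotone piece [q i] has at most one root, and it has one exactly when the level [K - i]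
    lies strictly between the values of [f] at the two ends. The levels are then counted by
    [count_between]. *)
Lemma piece_count u v : u < v ->
  (forall x, u <= x <= v -> is_derive x 1 f (g x)) ->
  (forall x, u <= x <= v -> {for x, continuous g}) ->
  (forall x, u < x < v -> g x != 0) ->
  (forall i x, u < x < v -> root (q i) x = (f x == K%:R - i%:R)) ->
  `|\sum_i (nroots (q i) u v)%:R - `|clamp K%:R (f v) - clamp K%:R (f u)| |
    <= 1 :> R.
Proof.
move=> uv df cg g0 qf.
have [e [gpos finc]] := derive_neq0_mono uv df cg g0.
pose F x := (-1) ^+ e * f x.
have Finc x y : u <= x -> x < y -> y <= v -> F x < F y.
  by move=> ux xy yv; apply: finc => //; rewrite in_itv/=; apply/andP; split=> //; lra.
have size1 i : nroots (q i) u v =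
    (F u < (-1) ^+ e * (K%:R - i%:R) < F v)%R :> nat.
  have cF : {within `[u, v], continuous F}.
    apply: within_continuous => x xuv; apply: continuousM; first exact: cvg_cst.
    exact: derive_cont df _ xuv.
  have eqF x : (F x == (-1) ^+ e * (K%:R - i%:R)) = (f x == K%:R - i%:R).
    by rewrite /F (inj_eq (mulrI _))// unitrX// unitrN1.
  case: (boolP (_ < _ < _)) => [/andP[cu cv]|cN].
    have [x xin /eqP Fx] : exists2 x, x \in `[u, v] &
        F x = (-1) ^+ e * (K%:R - i%:R).
      apply: IVT => //; first exact: ltW.
      by have Fuv := Finc _ _ (lexx u) uv (lexx v);
        rewrite (min_l (ltW Fuv)) (max_r (ltW Fuv)) !ltW.
    have xuv : u < x < v.
      move: xin Fx; rewrite in_itv/= !le_eqVlt => /andP[/predU1P[<-|ux]].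
        by move=> _ /eqP Fx; move: cu; rewrite -Fx ltxx.
      move=> /predU1P[->|xv]; last by rewrite ux.
      by move=> /eqP Fx; move: cv; rewrite -Fx ltxx.
    rewrite /nroots (_ : roots _ _ _ = [:: x])//.
    apply/esym/roots_uniq => //; move=> y; rewrite in_itv inE /=.
    apply/andP/eqP => [[yuv]|->]; last by rewrite xuv qf// -eqF.
    rewrite qf// -eqF => /eqP Fy; move/eqP: Fx; rewrite -Fy => Fxy.
    case/andP: yuv xuv => uy yv /andP[ux xv].
    have [yx|xy|//] := ltgtP y x.
      by have := Finc _ _ (ltW uy) yx (ltW xv); rewrite Fxy ltxx.
    by have := Finc _ _ (ltW ux) xy (ltW yv); rewrite Fxy ltxx.
  rewrite /nroots no_root_roots// => x; rewrite in_itv/= => /andP[ux xv].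
  rewrite qf ?ux// -eqF; apply: contra cN => /eqP <-.
  by rewrite !Finc// ltW.
under eq_bigr do rewrite size1.
have Fuv : F u < F v by rewrite Finc.
have -> : \sum_(i < K.*2.+1) (F u < (-1) ^+ e * (K%:R - i%:R) < F v)%R%:R =
   \sum_(i < K.*2.+1) (F u < i%:R - K%:R < F v)%R%:R :> R.
  case: (e); last first.
    under eq_bigr do rewrite expr0 mul1r.
    exact: (nroots_sum_rev K (fun z => (F u < z < F v)%R%:R)).
  by under eq_bigr do rewrite expr1 mulN1r opprB.
have -> : `|clamp K%:R (f v) - clamp K%:R (f u)| =
    clamp K%:R (F v) - clamp K%:R (F u).
  have := clamp_le K%:R (ltW Fuv); rewrite /F; case: (e); rewrite ?expr1 ?expr0.
    by rewrite !mulN1r !clampN// => ?; rewrite ler0_norm; lra.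
  by rewrite !mul1r => ?; rewrite ger0_norm; lra.
exact: count_between.
Qed.

(** The list [s] cuts the interval at all zeros of [g], hence into monotone pieces. Each piece costs
    1, and so does each cut [x], because the value [f x] is the level of at most one [q i]. *)
Lemma coarea_count a b (s : seq R) : a < b -> path <%R a s -> last a s < b ->
  (forall x, a <= x <= b -> is_derive x 1 f (g x)) ->
  (forall x, a <= x <= b -> {for x, continuous g}) ->
  (forall x, a < x < b -> x \notin s -> g x != 0) ->
  (forall i x, a < x < b -> root (q i) x = (f x == K%:R - i%:R)) ->
  `|\sum_i (nroots (q i) a b)%:R - Int (vden f g K%:R) a b|
    <= 2 * (size s)%:R + 1 :> R.
Proof.
elim: s a => [|x s IH] a ab.
  move=> _ _ df cg g0 qf; rewrite mulr0 add0r.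
  have g0' x : a < x < b -> g x != 0 by move=> /g0; apply.
  by rewrite (Int_vden_mono (ltW ab) _ df)//; exact: piece_count.
move=> /= /andP[ax xs] lb df cg g0 qf.
have xb : x < b.
  apply: le_lt_trans lb; elim: (s) (x) xs => [//|y t IHt] z /= /andP[zy yt].
  exact: le_trans (ltW zy) (IHt _ yt).
have g0' y : a < y < x -> g y != 0.
  move=> /andP[ay yx]; apply: g0; first by rewrite ay (lt_trans yx).
  rewrite inE negb_or lt_eqF//=; apply/negP => ys.
  have : all (fun z => x < z) s by apply: order_path_min xs; exact: lt_trans.
  by move/allP => /(_ _ ys); rewrite ltNge ltW.
have dfx y : a <= y <= x -> is_derive y 1 f (g y) by move=> ?; apply: df; lra.
have cgx y : a <= y <= x -> {for y, continuous g} by move=> ?; apply: cg; lra.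
have qfx i y : a < y < x -> root (q i) y = (f y == K%:R - i%:R).
  by move=> ?; apply: qf; lra.
have H1 := piece_count ax dfx cgx g0' qfx.
have H2 : `|\sum_i (nroots (q i) x b)%:R - Int (vden f g K%:R) x b|
    <= 2 * (size s)%:R + 1 :> R.
  apply: IH => //.
  - by move=> y ?; apply: df; lra.
  - by move=> y ?; apply: cg; lra.
  - move=> y /andP[xy yb] ys; apply: g0; first by rewrite (lt_trans ax).
    by rewrite inE negb_or gt_eqF.
  - by move=> i y ?; apply: qf; lra.
have H3 : 0 <= (\sum_i (root (q i) x)%:R : R) <= 1.
  under eq_bigr do rewrite qf ?ax//.
  rewrite sumr_ge0//=.
  case: (pickP (fun i : 'I_K.*2.+1 => f x == K%:R - i%:R)) => [i0 /eqP fi0|fN].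
    rewrite (bigD1 i0)//= fi0 eqxx big1 ?addr0// => i ii0.
    rewrite (_ : _ == _ = false)//; apply/negbTE.
    by rewrite (inj_eq (addrI _)) eqr_opp eqr_nat eq_sym.
  by rewrite big1// => i _; rewrite fN.
have -> : \sum_i (nroots (q i) a b)%:R = \sum_i (nroots (q i) a x)%:R +
    \sum_i (root (q i) x)%:R + \sum_i (nroots (q i) x b)%:R :> R.
  rewrite -!big_split/=; apply: eq_bigr => i _.
  by rewrite (nroots_split (q0 i) ax xb) !natrD.
have iv : itg (vden f g K%:R) a b.
  by apply: itg_vden => // y yab; exact: derive_cont df _ yab.
rewrite (Int_split (ltW ax) (ltW xb) iv) (Int_vden_mono (ltW ax) _ dfx)//.
move: H1 H2 H3; rewrite -natr1 !ler_norml; lra.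
Qed.

End Fibres.

(* A polynomial [d] carrying the critical points of [f] bounds the number of
   monotone pieces. *)
Lemma coarea_poly f g (K : nat) (q : 'I_K.*2.+1 -> {poly R}) (d : {poly R}) a b :
  a < b -> d != 0 -> (forall i, q i != 0) ->
  (forall x, a <= x <= b -> is_derive x 1 f (g x)) ->
  (forall x, a <= x <= b -> {for x, continuous g}) ->
  (forall x, a < x < b -> g x = 0 -> root d x) ->
  (forall i x, a < x < b -> root (q i) x = (f x == K%:R - i%:R)) ->
  `|\sum_i (nroots (q i) a b)%:R - Int (vden f g K%:R) a b|
    <= 2 * (size d)%:R + 1 :> R.
Proof.
move=> ab d0 q0 df cg gd qf.
apply: le_trans (@coarea_count f g K q q0 a b (roots d a b) ab _ _ df cg _ qf) _.
- exact: path_roots.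
- exact: last_roots_le.
- move=> x xab; apply: contra => /eqP gx; rewrite in_roots d0 andbT.
  by rewrite in_itv/= xab andbT; apply: gd.
- rewrite lerD2r ler_pM2l// ler_nat ltnW//.
  apply: max_poly_roots => //; last exact: uniq_roots.
  by apply/allP => x; exact: root_roots.
Qed.

End Coarea.

(** * phi as a limit of Riemann sums *)

Section BoundedVariation.
Context (R : realType).
Implicit Types (f g : R -> R) (M N x y : R).

(** A Jordan decomposition on [[-1, 1]] with both parts in [[0, M]]. Nonnegativity keeps products of
    the parts monotone, and the bound gives an explicit constant for Riemann sums. *)
Definition bdv M f := exists f1 f2 : R -> R,
  [/\ forall x y, -1 <= x -> x <= y -> y <= 1 -> f1 x <= f1 y,
      forall x y, -1 <= x -> x <= y -> y <= 1 -> f2 x <= f2 y &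
      forall x, -1 <= x <= 1 ->
        [/\ 0 <= f1 x <= M, 0 <= f2 x <= M & f x = f1 x - f2 x]].

Lemma bdv_nondecreasing M f :
  (forall x y, -1 <= x -> x <= y -> y <= 1 -> f x <= f y) ->
  (forall x, -1 <= x <= 1 -> 0 <= f x <= M) -> bdv M f.
Proof.
move=> fi fM; exists f, (fun=> 0); split=> // x /fM fx; split=> //.
  by rewrite lexx; lra.
by rewrite subr0.
Qed.

Lemma bdv_nonincreasing M f :
  (forall x y, -1 <= x -> x <= y -> y <= 1 -> f y <= f x) ->
  (forall x, -1 <= x <= 1 -> 0 <= f x <= M) -> bdv M f.
Proof.
move=> fi fM; exists (fun=> M), (fun x => M - f x); split=> //.
  by move=> x y x1 xy y1; rewrite lerD2l lerN2; exact: fi.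
move=> x /fM fx; split; [lra|lra|ring].
Qed.

Lemma bdvD M N f g : bdv M f -> bdv N g -> bdv (M + N) (fun x => f x + g x).
Proof.
move=> [f1 [f2 [f1i f2i fM]]] [g1 [g2 [g1i g2i gM]]].
exists (fun x => f1 x + g1 x), (fun x => f2 x + g2 x); split.
- by move=> x y x1 xy y1; rewrite lerD ?f1i ?g1i.
- by move=> x y x1 xy y1; rewrite lerD ?f2i ?g2i.
- move=> x x1; have [? ? ->] := fM _ x1; have [? ? ->] := gM _ x1.
  by split; lra.
Qed.

(** Expanding [(f1 - f2) * (g1 - g2)] and grouping the four products by sign gives the two monotone
    parts, each a sum of two products of size at most [M * N]. *)
Lemma bdvM M N f g : bdv M f -> bdv N g ->
  bdv (2 * (M * N)) (fun x => f x * g x).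
Proof.
move=> [f1 [f2 [f1i f2i fM]]] [g1 [g2 [g1i g2i gM]]].
have mon x y u v : -1 <= x -> x <= y -> y <= 1 ->
    [\/ u = f1 | u = f2] -> [\/ v = g1 | v = g2] -> u x * v x <= u y * v y.
  move=> x1 xy y1 uf vg.
  have [] := fM x; first by rewrite x1 (le_trans xy).
  have [] := gM x; first by rewrite x1 (le_trans xy).
  move=> /andP[? _] /andP[? _] _ /andP[? _] /andP[? _] _.
  by case: uf => ->; case: vg => ->; rewrite ler_pM ?f1i ?g1i ?f2i ?g2i.
exists (fun x => f1 x * g1 x + f2 x * g2 x), (fun x => f1 x * g2 x + f2 x * g1 x).
split.
- by move=> x y x1 xy y1; rewrite lerD// mon//; by [left|right].
- by move=> x y x1 xy y1; rewrite lerD// mon//; by [left|right].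
- move=> x x1; have [/andP[a0 aM] /andP[b0 bM] ->] := fM _ x1.
  have [/andP[c0 cN] /andP[d0 dN] ->] := gM _ x1.
  have pr u v : 0 <= u -> 0 <= v -> u <= M -> v <= N -> 0 <= u * v <= M * N.
    by move=> *; rewrite mulr_ge0//= ler_pM.
  have := pr _ _ a0 c0 aM cN; have := pr _ _ a0 d0 aM dN.
  have := pr _ _ b0 c0 bM cN; have := pr _ _ b0 d0 bM dN.
  by split; [lra|lra|ring].
Qed.

Lemma bdv_ext M f g : f =1 g -> bdv M f -> bdv M g.
Proof. by move=> /funext ->. Qed.

Lemma bdv_normr_affine M a b :
  (forall x, -1 <= x <= 1 -> `|b + a * x| <= M) -> bdv (M + M) (fun x => `|b + a * x|).
Proof.
move=> bM.
pose p x := Num.max (b + a * x) 0; pose n x := Num.max (- (b + a * x)) 0.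
apply: (@bdv_ext _ (fun x => p x + n x)).
  move=> x; rewrite /p /n; case: (ger0P (b + a * x)) => h.
    by rewrite max_r ?oppr_le0// addr0.
  by rewrite max_l ?oppr_ge0 ?ltW// add0r.
have pM x : -1 <= x <= 1 -> 0 <= p x <= M.
  move=> /bM h; rewrite le_max lexx orbT/= ge_max.
  by rewrite (le_trans (ler_norm _) h) (le_trans _ h).
have nM x : -1 <= x <= 1 -> 0 <= n x <= M.
  move=> /bM; rewrite /n; set u := b + a * x => h.
  rewrite le_max lexx orbT/= ge_max.
  by have := ler_norm (- u); have := normr_ge0 u; rewrite normrN; lra.
have max_mono (u v : R) : u <= v -> Num.max u 0 <= Num.max v 0.
  by move=> uv; rewrite ge_max !le_max uv lexx orbT.
have [a0|/ltW a0] := leP 0 a.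
  apply: bdvD; [apply: bdv_nondecreasing pM|apply: bdv_nonincreasing nM];
  move=> x y _ xy _; apply: max_mono.
    by rewrite lerD2l ler_wpM2l.
  by rewrite lerN2 lerD2l ler_wpM2l.
apply: bdvD; [apply: bdv_nonincreasing pM|apply: bdv_nondecreasing nM];
  move=> x y _ xy _; apply: max_mono.
  by rewrite lerD2l ler_wnM2l.
by rewrite lerN2 lerD2l ler_wnM2l.
Qed.

(** The condition is the conjunction of two half-line conditions, each of which has a monotone
    indicator. *)
Lemma bdv_indic_affine a b : bdv 2 (fun x => (`|b + a * x| <= 1)%R%:R).
Proof.
apply: (@bdv_ext _ (fun x => (-1 <= b + a * x)%R%:R * (b + a * x <= 1)%R%:R)).
  by move=> x; rewrite ler_norml -natrM mulnb.
have ind (c : bool) : 0 <= (c%:R : R) <= 1 by case: c; rewrite ?lexx ?ler01.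
have le_ind (c d : bool) : (c -> d) -> c%:R <= d%:R :> R.
  by case: c; case: d => // /(_ isT).
have -> : 2 = 2 * (1 * 1) :> R by ring.
have [a0|/ltW a0] := leP 0 a.
  apply: bdvM; [apply: bdv_nondecreasing|apply: bdv_nonincreasing] => // x y _ xy _;
  apply: le_ind => h; have := ler_wpM2l a0 xy; lra.
apply: bdvM; [apply: bdv_nonincreasing|apply: bdv_nondecreasing] => // x y _ xy _;
  apply: le_ind => h; have := ler_wnM2l a0 xy; lra.
Qed.

(** On one cell the error is at most [1/K] times the increments of the two monotone parts, and these
    telescope to [2 M / K]. There are [2 K + 1] nodes for [2 K] cells; the spare node at 1 costs the
    third [M / K]. *)
Lemma riemann_bdv M f (K : nat) : (0 < K)%N -> bdv M f ->
  measurable_fun setT f ->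
  `|K%:R^-1 * \sum_(i < K.*2.+1) f ((i%:R - K%:R) / K%:R) - Int f (-1) 1|
    <= 3 * M / K%:R.
Proof.
move=> K0 [f1 [f2 [f1i f2i fM]]] mf.
have Kp : 0 < K%:R :> R by rewrite ltr0n.
pose x (i : nat) : R := (i%:R - K%:R) / K%:R.
have x0 : x 0 = -1 by rewrite /x sub0r mulNr divff// gt_eqF.
have xK : x K.*2 = 1 by rewrite /x -addnn natrD addrK divff// gt_eqF.
have xS i : x i.+1 = x i + K%:R^-1 by rewrite /x -natr1; ring.
have Kinv : 0 < K%:R^-1 :> R by rewrite invr_gt0.
have xm i : x i <= x i.+1 by rewrite xS; lra.
have xmm i j : (i <= j)%N -> x i <= x j.
  by move=> ij; rewrite /x ler_pM2r// lerD2r ler_nat.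
have xin i : (i <= K.*2)%N -> -1 <= x i <= 1.
  by move=> iK; rewrite -x0 -xK !xmm.
have M0 : 0 <= M by have [/andP[? ?] _ _] := fM _ (xin 0%N isT); lra.
have fb y : -1 <= y <= 1 -> `|f y| <= M.
  by move=> /fM[? ? ->]; rewrite ler_norml; lra.
have itf : itg f (-1) 1 by apply: itg_bounded fb; exact: measurable_funTS.
have split_sum j : (j <= K.*2)%N -> Int f (-1) (x j) = \sum_(i < j) Int f (x i) (x i.+1).
  elim: j => [_|j IH jK]; first by rewrite big_ord0 x0 Int_nil.
  rewrite big_ord_recr/= -IH ?(ltnW jK)//; apply: Int_split => //.
    by have /andP[] := xin _ (ltnW jK).
  by apply: itgS itf => //; have /andP[] := xin _ jK.
have cell i : (i < K.*2)%N -> `|K%:R^-1 * f (x i) - Int f (x i) (x i.+1)| <=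
    (f1 (x i.+1) - f1 (x i) + (f2 (x i.+1) - f2 (x i))) * K%:R^-1.
  move=> iK.
  have /andP[i1 _] := xin _ (ltnW iK); have /andP[_ i2] := xin _ iK.
  have iti : itg f (x i) (x i.+1) by exact: itgS itf.
  have -> : K%:R^-1 * f (x i) = Int (fun=> f (x i)) (x i) (x i.+1).
    by rewrite Int_cst// xS addrC addKr mulrC.
  rewrite -IntB//; last exact: itg_cst.
  have -> : K%:R^-1 = x i.+1 - x i :> R by rewrite xS addrC addKr.
  apply: Int_bound => //; first by apply: itgB => //; exact: itg_cst.
  move=> y /andP[xy yx].
  have y1 : -1 <= y <= 1 by lra.
  have [_ _ ->] := fM _ (xin _ (ltnW iK)); have [_ _ ->] := fM _ y1.
  have := f1i _ _ i1 xy (le_trans yx i2); have := f2i _ _ i1 xy (le_trans yx i2).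
  have := f1i _ _ (le_trans i1 xy) yx i2; have := f2i _ _ (le_trans i1 xy) yx i2.
  by rewrite ler_norml; lra.
have intE : Int f (-1) 1 = \sum_(i < K.*2) Int f (x i) (x i.+1).
  by have := split_sum _ (leqnn _); rewrite xK.
rewrite big_ord_recr/= -/(x K.*2) xK mulrDr intE.
rewrite mulr_sumr addrAC -sumrB.
apply: (le_trans (ler_normD _ _)).
have tele : \sum_(i < K.*2) `|K%:R^-1 * f (x i) - Int f (x i) (x i.+1)| <= 2 * M / K%:R.
  apply: (@le_trans _ _ (\sum_(i < K.*2) (f1 (x i.+1) - f1 (x i) + (f2 (x i.+1) - f2 (x i))) * K%:R^-1)).
    by apply: ler_sum => i _; exact: cell.
  rewrite -mulr_suml big_split/= -!(big_mkord xpredT (fun i => _ (x i.+1) - _ (x i))).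
  rewrite !telescope_sumr// x0 xK ler_pM2r//.
  have [? ? _] := fM 1 ltac:(lra); have [? ? _] := fM (-1) ltac:(lra).
  by lra.
have last1 : `|K%:R^-1 * f 1| <= M / K%:R.
  by rewrite normrM gtr0_norm// mulrC ler_pM2r// fb//; lra.
have -> : 3 * M / K%:R = 2 * M / K%:R + M / K%:R by ring.
exact: lerD (le_trans (ler_norm_sum _ _ _) tele) last1.
Qed.

End BoundedVariation.

(** * Integrals over the cube and Riemann sums uniform in the linear forms *)

Section TupleIntegral.
Context (R : realType).
Local Notation leb := (@lebesgue_measure R).
Local Notation lt := (@lebesgue_tuple R).
Implicit Types (M b e t : R) (al ga : nat -> R).

Lemma integral_tuple_cons m (f : m.+1.-tuple R -> \bar R) :
  measurable_fun setT f -> (forall p, 0 <= f p)%E ->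
  (\int[lt m.+1]_p f p = \int[lt m]_p \int[leb]_x f (consp (x, p)))%E.
Proof.
move=> mf f0.
pose X := (measurableTypeR R * m.-tuple R)%type.
have mc : measurable_fun [set: X] (@consp R m : X -> _).
  exact: measurable_consp.
pose P : {measure set X -> \bar R} := (leb \x lt m)%E.
have H := @ge0_integral_pushforward _ _ X _ R (@consp R m) mc P setT f
  measurableT mf (fun p _ => f0 p).
apply: etrans H _; rewrite preimage_setT fubini_tonelli2//.
  exact: measurableT_comp.
by move=> x /=; exact: f0.
Qed.

Lemma measurable_integral_tuple_cons m (f : m.+1.-tuple R -> \bar R) :
  measurable_fun setT f -> (forall p, 0 <= f p)%E ->
  measurable_fun setT (fun p => \int[leb]_x f (consp (x, p)))%E.
Proof.
move=> mf f0.
apply: (@measurable_fun_fubini_tonelli_G _ _ _ _ _ leb (fun z => f (consp z))).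
- by apply: measurableT_comp => //; exact: measurable_consp.
- by move=> ?; exact: f0.
Qed.

Definition cubei m (p : m.-tuple R) : R := \prod_(i < m) (`|tnth p i| <= 1)%R%:R.

(** The integrand of [phi] with general linear forms. The offsets [b] and [e] absorb the coordinates
    already fixed, so the family is stable under removal of the first coordinate. *)
Definition slab m (al ga : nat -> R) (b e : R) (p : m.-tuple R) : R :=
  `|b + \sum_(i < m) al i * tnth p i| *
  (`|e + \sum_(i < m) ga i * tnth p i| <= 1)%R%:R.

Lemma measurable_le1 d (T : measurableType d) (f : T -> R) :
  measurable_fun setT f -> measurable_fun setT (fun x => (`|f x| <= 1)%R%:R : R).
Proof.
move=> mf.
have mb : measurable_fun setT (fun b : bool => b%:R : R) by [].
apply: (measurableT_comp mb); apply: measurable_fun_ler => //.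
exact: measurableT_comp.
Qed.

Lemma measurable_cubei m : measurable_fun setT (@cubei m).
Proof.
apply: measurable_prod => i _; apply: measurable_le1; exact: measurable_tnth.
Qed.

Lemma measurable_affine m (al : nat -> R) b :
  measurable_fun setT (fun p : m.-tuple R => b + \sum_(i < m) al i * tnth p i).
Proof.
apply: measurable_funD => //; apply: measurable_sum => i.
by apply: measurable_funM => //; exact: measurable_tnth.
Qed.

Lemma measurable_slab m al ga b e : measurable_fun setT (@slab m al ga b e).
Proof.
apply: measurable_funM.
  by apply: measurableT_comp => //; exact: measurable_affine.
by apply: measurable_le1; exact: measurable_affine.
Qed.

Lemma cubei_cons m x (p : m.-tuple R) :
  cubei (consp (x, p)) = (`|x| <= 1)%R%:R * cubei p.
Proof.
rewrite /cubei big_ord_recl (tnth_nth 0)/=; congr (_ * _).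
by apply: eq_bigr => i _; rewrite !(tnth_nth 0).
Qed.

Lemma slab_cons m al ga b e x (p : m.-tuple R) :
  slab al ga b e (consp (x, p)) =
  slab (al \o succn) (ga \o succn) (b + al 0%N * x) (e + ga 0%N * x) p.
Proof.
rewrite /slab !big_ord_recl !(tnth_nth 0)/= !addrA.
have E (c : nat -> R) : \sum_(i < m) c (bump 0 i) * tnth (consp (x, p)) (lift ord0 i)
    = \sum_(i < m) (c \o succn) i * tnth p i.
  by apply: eq_bigr => i _; rewrite !(tnth_nth 0).
by rewrite !E.
Qed.

Lemma cubei01 m (p : m.-tuple R) : 0 <= cubei p <= 1.
Proof.
rewrite /cubei prodr_ge0//=.
by apply: prodr_ile1 => i _; rewrite ler0n lern1 leq_b1.
Qed.

Lemma integral_interval_indic (f : R -> R) : measurable_fun setT f ->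
  (forall x, 0 <= f x) ->
  (\int[leb]_x (f x * (`|x| <= 1)%R%:R)%:E = \int[leb]_(x in `[(-1)%R, 1%R]) (f x)%:E)%E.
Proof.
move=> mf f0; rewrite [RHS]integral_mkcond; apply: eq_integral => x _.
rewrite /patch mem_setE in_itv/= ler_norml; case: ifP; rewrite ?mulr1 ?mulr0//.
Qed.

Lemma integral_cube m : (\int[lt m]_p (cubei p)%:E = (2 ^+ m)%:E)%E.
Proof.
have lt11 : (-1 < 1 :> R)%R by lra.
elim: m => [|m IH].
  rewrite /= integral_dirac//=; last first.
    by apply/measurable_EFinP; exact: measurable_cubei.
  by rewrite diracT mul1e /cubei big_ord0.
rewrite integral_tuple_cons.
- under eq_integral => p _.
    under eq_integral do rewrite cubei_cons mulrC.
    rewrite integral_interval_indic//; last first.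
      by move=> _; case/andP: (cubei01 p).
    rewrite integral_cst//= lebesgue_measure_itv/= lte_fin.
    rewrite lt11 -EFinD -EFinM (_ : _ * _ = 2 * cubei p)%R; last ring.
    over.
  under eq_integral do rewrite EFinM.
  rewrite ge0_integralZl//=.
  + by rewrite IH -EFinM exprS.
  + by apply/measurable_EFinP; exact: measurable_cubei.
  + by move=> p _; rewrite lee_fin; case/andP: (cubei01 p).
- by apply/measurable_EFinP; exact: measurable_cubei.
- by move=> p; rewrite lee_fin; case/andP: (cubei01 p).
Qed.

Lemma measurable_indic_cube_slab m al ga b e :
  measurable_fun setT (fun p : m.-tuple R => cubei p * slab al ga b e p).
Proof.
by apply: measurable_funM; [exact: measurable_cubei|exact: measurable_slab].
Qed.

Lemma slab_ge0 m al ga b e (p : m.-tuple R) : 0 <= slab al ga b e p.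
Proof. by rewrite mulr_ge0. Qed.

Lemma cubei_slab_le m (al ga : nat -> R) b e M (p : m.-tuple R) :
  `|b| + \sum_(i < m) `|al i| <= M -> cubei p * slab al ga b e p <= M * cubei p.
Proof.
move=> bM.
have M0 : 0 <= M by apply: le_trans bM; rewrite addr_ge0// sumr_ge0.
have [cp|/eqP cp] := eqVneq (cubei p) 0; first by rewrite cp mul0r mulr0.
have pi i : `|tnth p i| <= 1.
  by apply: contra_notT cp => pi; rewrite /cubei (bigD1 i)//= (negbTE pi) mul0r.
rewrite mulrC ler_wpM2r//; first by case/andP: (cubei01 p).
rewrite /slab; apply: (@le_trans _ _ (`|b + \sum_(i < m) al i * tnth p i|)).
  by rewrite ler_piMr// lern1 leq_b1.
apply: le_trans bM; apply: (le_trans (ler_normD _ _)); rewrite lerD2l.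
apply: (le_trans (ler_norm_sum _ _ _)); apply: ler_sum => i _.
by rewrite normrM ler_piMr.
Qed.

Definition Islab m al ga b e : R :=
  \int[lt m]_p (cubei p * slab al ga b e p).

Lemma integrable_cube m M : (lt m).-integrable setT (fun p => (M * cubei p)%:E).
Proof.
suff H : (lt m).-integrable setT (fun p => (cubei p)%:E).
  rewrite (_ : (fun p => _) = (fun p => M%:E * (cubei p)%:E)%E).
    exact: integrableZl.
  by apply/funext => p; rewrite EFinM.
apply/integrableP; split; first by apply/measurable_EFinP; exact: measurable_cubei.
under eq_integral => p _.
  rewrite gee0_abs; last by rewrite lee_fin; case/andP: (cubei01 p).
  over.
by rewrite integral_cube ltry.
Qed.

Lemma integrable_le_cube m M (f : m.-tuple R -> R) : measurable_fun setT f ->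
  (forall p, `|f p| <= M * cubei p) -> (lt m).-integrable setT (fun p => (f p)%:E).
Proof.
move=> mf fM; apply: (le_integrable _ _ _ (integrable_cube m M)) => //.
  exact/measurable_EFinP.
by move=> p _ /=; rewrite lee_fin (le_trans (fM p))// ler_norm.
Qed.

Lemma Rintegral_le_cube m M (f : m.-tuple R -> R) : measurable_fun setT f ->
  (forall p, `|f p| <= M * cubei p) -> `|\int[lt m]_p f p| <= M * 2 ^+ m.
Proof.
move=> mf fM; have itf := integrable_le_cube mf fM.
apply: (le_trans (le_normr_Rintegral _ _)) => //.
apply: (@le_trans _ _ (\int[lt m]_p (M * cubei p))).
  apply: le_Rintegral => //; last exact: integrable_cube.
  by have /integrable_abse := itf.
have itc : (lt m).-integrable setT (fun p => (cubei p)%:E).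
  by apply: (@integrable_le_cube m 1); [exact: measurable_cubei|
    move=> p; rewrite mul1r ger0_norm//; case/andP: (cubei01 p)].
by rewrite RintegralZl// /Rintegral integral_cube.
Qed.

Lemma sum_tuple_cons (V : nmodType) (T : finType) m (F : m.+1.-tuple T -> V) :
  \sum_t F t = \sum_x \sum_(t : m.-tuple T) F (cons_tuple x t).
Proof.
rewrite pair_big/= (reindex (fun z : T * m.-tuple T => cons_tuple z.1 z.2))//=.
exists (fun s : m.+1.-tuple T => (thead s, [tuple of behead s])) => [[x s] _|s _] /=.
  by congr pair; exact: val_inj.
by rewrite [RHS]tuple_eta; exact: val_inj.
Qed.

Definition grid K (i : 'I_K.*2.+1) : R := (i%:R - K%:R) / K%:R.

Lemma grid_bound K (i : 'I_K.*2.+1) : -1 <= grid i <= 1.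
Proof.
case: K i => [|K] i; first by rewrite /grid invr0 mulr0; lra.
have Kp : 0 < K.+1%:R :> R by rewrite ltr0n.
have iK : i%:R <= K.+1%:R + K.+1%:R :> R.
  by rewrite -natrD addnn ler_nat -ltnS.
have i0 : 0 <= i%:R :> R by [].
by rewrite /grid ler_pdivlMr// ler_pdivrMr// mulN1r mul1r; lra.
Qed.

Lemma map_grid_cons K m (i : 'I_K.*2.+1) (t : m.-tuple 'I_K.*2.+1) :
  map_tuple (@grid K) (cons_tuple i t) = consp (grid i, map_tuple (@grid K) t).
Proof. exact: val_inj. Qed.

(** Only the first coordinate is discretised. With the others fixed in the cube, the integrand is
    the absolute value of an affine function times an indicator, hence of bounded variation in that
    coordinate. The factor [2 ^+ m] is the volume of the cube of the other coordinates. *)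
Lemma slab_step m (al ga : nat -> R) b e M (K : nat) : (0 < K)%N ->
  `|b| + \sum_(i < m.+1) `|al i| <= M ->
  `|K%:R^-1 * \sum_(i < K.*2.+1) Islab m (al \o succn) (ga \o succn)
       (b + al 0%N * grid i) (e + ga 0%N * grid i)
    - Islab m.+1 al ga b e| <= 24 * M * 2 ^+ m / K%:R.
Proof.
move=> K0 bM.
pose g (p : m.-tuple R) x := slab (al \o succn) (ga \o succn)
  (b + al 0%N * x) (e + ga 0%N * x) p.
have M0 : 0 <= M by apply: le_trans bM; rewrite addr_ge0// sumr_ge0.
have bx x : -1 <= x <= 1 ->
    `|b + al 0%N * x| + \sum_(i < m) `|(al \o succn) i| <= M.
  move=> x1; apply: le_trans bM; rewrite big_ord_recl/= addrA lerD2r.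
  rewrite (le_trans (ler_normD _ _))// lerD2l normrM ler_piMr// ler_norml; lra.
have mg2 : measurable_fun setT (fun p : m.+1.-tuple R => cubei p * slab al ga b e p).
  exact: measurable_indic_cube_slab.
have mg p : measurable_fun setT (g p).
  rewrite /g /slab; apply: measurable_funM.
    apply: measurableT_comp => //; apply: measurable_funD => //.
    by apply: measurable_funD => //; exact: measurable_funM.
  apply: measurable_le1; apply: measurable_funD => //.
  by apply: measurable_funD => //; exact: measurable_funM.
have g0 p x : 0 <= g p x by exact: slab_ge0.
have cube_in (p : m.-tuple R) : cubei p != 0 -> forall i, `|tnth p i| <= 1.
  by move=> cp i; apply: contra_neqT cp => pi; rewrite /cubei (bigD1 i)//= (negbTE pi) mul0r.
have gM p x : cubei p != 0 -> -1 <= x <= 1 -> g p x <= M.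
  move=> cp x1; have := @cubei_slab_le m (al \o succn) (ga \o succn) _ (e + ga 0%N * x) _ p (bx x x1).
  by rewrite mulrC ler_pM2r// lt_neqAle eq_sym cp; case/andP: (cubei01 p).
have itg_g p : cubei p != 0 -> itg (g p) (-1) 1.
  move=> cp; apply: (@itg_bounded _ _ _ _ M); first exact: measurable_funTS.
  by move=> x x1; rewrite ger0_norm// gM.
have inner p : (\int[leb]_x (cubei (consp (x, p)) * slab al ga b e (consp (x, p)))%:E
   = (cubei p * Int (g p) (-1) 1)%:E)%E.
  under eq_integral => x _.
    rewrite cubei_cons slab_cons -/(g p x) -mulrA mulrC.
    over.
  rewrite (integral_interval_indic (f := fun x => cubei p * g p x)); last 2 first.
  - exact: measurable_funM.
  - by move=> x; rewrite mulr_ge0//; case/andP: (cubei01 p).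
  have [cp|cp] := eqVneq (cubei p) 0.
    by rewrite cp mul0r; under eq_integral do rewrite mul0r; rewrite integral0.
  under eq_integral do rewrite EFinM.
  rewrite [RHS]EFinM /Int /Rintegral fineK; last exact: integrable_fin_num (itg_g _ cp).
  by rewrite -integralZl//; exact: itg_g.
have Ig p : `|cubei p * Int (g p) (-1) 1| <= M * 2 * cubei p.
  have [cp|cp] := eqVneq (cubei p) 0; first by rewrite cp mul0r mulr0 normr0.
  have /andP[c0 _] := cubei01 p.
  rewrite normrM (ger0_norm c0) mulrC ler_wpM2r//.
  have -> : 2 = 1 - -1 :> R by ring.
  apply: Int_bound; [lra|exact: itg_g|].
  by move=> x x1; rewrite ger0_norm// gM.
have mI : measurable_fun setT (fun p => cubei p * Int (g p) (-1) 1).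
  apply/measurable_EFinP.
  rewrite (_ : _ \o _ = (fun p => \int[leb]_x (cubei (consp (x, p)) * slab al ga b e (consp (x, p)))%:E)%E).
    apply: (@measurable_integral_tuple_cons _ (fun p => (cubei p * slab al ga b e p)%:E)).
      exact/measurable_EFinP.
    by move=> p; rewrite lee_fin mulr_ge0 ?slab_ge0//; case/andP: (cubei01 p).
  by apply/funext => p /=; rewrite inner.
have Istep : Islab m.+1 al ga b e = \int[lt m]_p (cubei p * Int (g p) (-1) 1).
  rewrite /Islab /Rintegral integral_tuple_cons.
  - by congr fine; apply: eq_integral => p _; rewrite inner.
  - exact/measurable_EFinP.
  - by move=> p; rewrite lee_fin mulr_ge0 ?slab_ge0//; case/andP: (cubei01 p).
have its i : (lt m).-integrable setT (fun p => (cubei p * g p (grid i))%:E).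
  apply: (@integrable_le_cube m M); first exact: measurable_indic_cube_slab.
  move=> p; rewrite ger0_norm; last by rewrite mulr_ge0//; case/andP: (cubei01 p).
  by apply: cubei_slab_le; apply: bx; exact: grid_bound.
have itS : (lt m).-integrable setT
    (fun p => (\sum_(i < K.*2.+1) cubei p * g p (grid i))%:E).
  rewrite (_ : (fun _ => _) = (fun p => \sum_(i < K.*2.+1) (cubei p * g p (grid i))%:E)%E).
    by apply: integrable_sum => // i _; exact: its.
  by apply/funext => p; rewrite sumEFin.
have sumE : K%:R^-1 * \sum_(i < K.*2.+1) Islab m (al \o succn) (ga \o succn)
       (b + al 0%N * grid i) (e + ga 0%N * grid i)
    = \int[lt m]_p (K%:R^-1 * \sum_(i < K.*2.+1) cubei p * g p (grid i)).
  rewrite RintegralZl//; congr (_ * _).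
  rewrite /Rintegral; under [in RHS]eq_integral do rewrite -sumEFin.
  rewrite integral_sum; [|by []|by move=> i; exact: its].
  by rewrite -sum_fine// => i _; apply: integrable_fin_num => //; exact: its.
have itS' : (lt m).-integrable setT
    (fun p => (K%:R^-1 * \sum_(i < K.*2.+1) cubei p * g p (grid i))%:E).
  rewrite (_ : (fun _ => _) = (fun p => K%:R^-1%:E * (\sum_(i < K.*2.+1) cubei p * g p (grid i))%:E)%E).
    exact: integrableZl.
  by apply/funext => p; rewrite EFinM.
rewrite sumE Istep -RintegralB//; last exact: integrable_le_cube mI Ig.
rewrite mulrAC; apply: Rintegral_le_cube.
  apply: measurable_funB => //; apply/measurable_EFinP; exact: measurable_int itS'.
move=> p; have /andP[c0 _] := cubei01 p.
rewrite -mulr_sumr mulrCA -mulrBr normrM (ger0_norm c0) mulrC.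
have [->|cp] := eqVneq (cubei p) 0; first by rewrite !mulr0.
rewrite ler_wpM2r//.
(* The factors are 3 from [riemann_bdv], 2 from [bdvM], [M + M] for the absolute value and 2 for the
   indicator. *)
have -> : 24 * M / K%:R = 3 * (2 * ((M + M) * 2)) / K%:R by ring.
apply: riemann_bdv => //.
pose b' := b + \sum_(i < m) (al \o succn) i * tnth p i.
pose e' := e + \sum_(i < m) (ga \o succn) i * tnth p i.
apply: (@bdv_ext _ _ (fun x => `|b' + al 0%N * x| * (`|e' + ga 0%N * x| <= 1)%R%:R)).
  by move=> x; rewrite /g /slab /b' /e' -!(addrAC _ (_ * x)).
apply: bdvM; last exact: bdv_indic_affine.
apply: bdv_normr_affine => x x1.
apply: le_trans (bx x x1); rewrite /b' addrAC (le_trans (ler_normD _ _))// lerD2l.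
apply: (le_trans (ler_norm_sum _ _ _)); apply: ler_sum => i _.
by rewrite normrM ler_piMr// cube_in.
Qed.

(** The constant depends only on [m] and on the bound [M]. This uniformity is needed by the
    induction, which applies the estimate at every shifted offset, and later when the estimate is
    integrated over an interval of values of [t]. *)
Lemma Islab_riemann m M : exists2 C : R, 0 <= C &
  forall (K : nat) (al ga : nat -> R) b e, (0 < K)%N ->
    `|b| + \sum_(i < m) `|al i| <= M ->
  `|K%:R ^- m * \sum_(t : m.-tuple 'I_K.*2.+1) slab al ga b e (map_tuple (@grid K) t)
    - Islab m al ga b e| <= C / K%:R.
Proof.
elim: m => [|m [C C0 IH]].
  exists 0 => [//|K al ga b e K0 _].
  rewrite expr0 invr1 mul1r mul0r (big_pred1 [tuple]); last first.
    by move=> t; apply/esym/eqP/val_inj; exact: size0nil (size_tuple t).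
  rewrite /Islab /Rintegral /= integral_dirac//=; last first.
    by apply/measurable_EFinP; exact: measurable_indic_cube_slab.
  by rewrite indicE in_setT mul1r /cubei big_ord0 mul1r (tuple0 (map_tuple _ _)) subrr normr0.
have [M0|MN] := leP 0 M; last first.
  exists 0 => [//|K al ga b e _ bM]; exfalso; move: bM; apply/negP; rewrite -ltNge.
  by apply: lt_le_trans MN _; rewrite addr_ge0// sumr_ge0.
(* The first term is the error of the new coordinate. The second collects the earlier errors over
   [2 K + 1] grid points with weight [1/K], at most 3 in total. *)
exists (24 * M * 2 ^+ m + 3 * C).
  by rewrite addr_ge0// mulr_ge0// ?mulr_ge0// exprn_ge0.
move=> K al ga b e K0 bM.
have Kp : 0 < K%:R :> R by rewrite ltr0n.
have H := @slab_step m al ga b e M K K0 bM.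
rewrite mulrDl -[X in `|X|](subrKA (K%:R^-1 * \sum_(i < K.*2.+1) Islab m (al \o succn) (ga \o succn)
       (b + al 0%N * grid i) (e + ga 0%N * grid i))).
rewrite (le_trans (ler_normD _ _))// addrC lerD//.
have -> : K%:R ^- m.+1 * (\sum_(t : m.+1.-tuple 'I_K.*2.+1) slab al ga b e (map_tuple (@grid K) t))
  = K%:R^-1 * \sum_(i < K.*2.+1) (K%:R ^- m * \sum_(t : m.-tuple 'I_K.*2.+1) slab
     (al \o succn) (ga \o succn) (b + al 0%N * grid i) (e + ga 0%N * grid i) (map_tuple (@grid K) t)).
  rewrite sum_tuple_cons -mulr_sumr mulrA -invfM -exprS; congr (_ * _).
  by apply: eq_bigr => i _; apply: eq_bigr => t _; rewrite map_grid_cons slab_cons.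
rewrite -mulrBr -sumrB normrM gtr0_norm ?invr_gt0// mulrC ler_pdivrMr//.
apply: (le_trans (ler_norm_sum _ _ _)).
apply: (@le_trans _ _ (\sum_(i < K.*2.+1) C / K%:R)).
  apply: ler_sum => i _; apply: IH => //.
  apply: le_trans bM; rewrite big_ord_recl/= addrA lerD2r.
  rewrite (le_trans (ler_normD _ _))// lerD2l normrM ler_piMr// ler_norml.
  exact: grid_bound.
rewrite sumr_const card_ord -[C / _ *+ _]mulr_natr -[3 * C / _]mulrA.
have -> : K.*2.+1%:R = K%:R + K%:R + 1 :> R by rewrite -natr1 -addnn natrD.
have K1 : 1 <= K%:R :> R by rewrite ler1n.
have CK : 0 <= C / K%:R by rewrite divr_ge0// ltW.
move: (C / K%:R) CK => u u0; nra.
Qed.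

Lemma cubei_bigmax m (p : m.-tuple R) :
  cubei p = (\big[Num.max/0]_(i < m) `|tnth p i| <= 1)%R%:R.
Proof.
rewrite /cubei; have [h|h] := boolP (_ <= 1).
  rewrite big1// => i _; rewrite (le_trans _ h)//.
  exact: (@le_bigmax _ _ _ _ (fun i => `|tnth p i|)).
have [i pi] : exists i, ~~ (`|tnth p i| <= 1).
  apply/existsP; rewrite -negb_forall; apply: contra h => /forallP h.
  by apply/bigmax_leP; split.
by rewrite (bigD1 i)//= (negbTE pi) mul0r.
Qed.

Lemma phiE m (t : R) : phi m t =
  Islab m (fun i => i.+1%:R * t ^+ i) (fun i => t ^+ i.+1) 0 0.
Proof.
rewrite /phi Rintegral_mkcond; apply: eq_Rintegral => p _.
rewrite /patch cubei_bigmax /slab !add0r.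
have -> : \sum_(i < m) i.+1%:R * t ^+ i * tnth p i =
  \sum_(i < m) i.+1%:R * tnth p i * t ^+ i :> R.
  by apply: eq_bigr => i _; rewrite mulrAC.
have -> : \sum_(i < m) t ^+ i.+1 * tnth p i = \sum_(i < m) tnth p i * t ^+ i.+1 :> R.
  by apply: eq_bigr => i _; rewrite mulrC.
case: ifPn => [|/negP]; rewrite inE /G /=.
  by move=> [-> ->]; rewrite mul1r mulr1.
move=> h; case: (boolP (_ <= 1)) => h1; last by rewrite mul0r.
case: (boolP (_ <= 1)) => h2; last by rewrite !mulr0.
by case: h.
Qed.

Lemma phi_ge0 m (t : R) : 0 <= phi m t.
Proof. by apply: Rintegral_ge0 => p _. Qed.

Lemma measurable_phi m : measurable_fun setT (@phi R m).
Proof.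
have -> : @phi R m = fun t : R => fine (\int[lt m]_p
    (cubei p * slab (fun i => i.+1%:R * t ^+ i) (fun i => t ^+ i.+1) 0 0 p)%:E)%E.
  by apply/funext => t; rewrite phiE.
pose F (z : measurableTypeR R * m.-tuple R) := (cubei z.2 *
  slab (fun i => i.+1%:R * z.1 ^+ i) (fun i => z.1 ^+ i.+1) 0 0 z.2)%:E.
have mF : measurable_fun setT F.
  apply/measurable_EFinP; apply: measurable_funM.
    by apply: measurableT_comp => //; exact: measurable_cubei.
  have mtn (i : 'I_m) : measurable_fun setT
      (fun z : measurableTypeR R * m.-tuple R => tnth z.2 i).
    by apply: (measurableT_comp (measurable_tnth i)).
  have mpow k : measurable_fun setT (fun z : measurableTypeR R * m.-tuple R => z.1 ^+ k : R).
    by apply: (measurableT_comp (exprn_measurable k)).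
  apply: measurable_funM.
    apply: measurableT_comp => //; apply: measurable_funD => //.
    apply: measurable_sum => i; apply: measurable_funM => //.
    exact: measurable_funM.
  apply: measurable_le1; apply: measurable_funD => //.
  by apply: measurable_sum => i; apply: measurable_funM.
apply/measurable_EFinP.
rewrite (_ : _ \o _ = fun t : R => \int[lt m]_p F (t, p))%E; last first.
  apply/funext => t /=; rewrite fineK//; apply: integrable_fin_num => //.
  pose Mt : R := `|0 : R| + \sum_(i < m) `|i.+1%:R * t ^+ i : R|.
  apply: (@integrable_le_cube m Mt); first exact: measurable_indic_cube_slab.
  move=> p; rewrite ger0_norm; first by apply: cubei_slab_le; exact: lexx.
  by rewrite mulr_ge0 ?slab_ge0//; case/andP: (cubei01 p).
apply: (@measurable_fun_fubini_tonelli_F _ _ _ _ _ (lt m) F) => //.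
by move=> z; rewrite /F lee_fin mulr_ge0 ?slab_ge0//; case/andP: (cubei01 z.2).
Qed.

End TupleIntegral.

(** * Roots of integer polynomials in a bounded interval *)

Section LatticeCount.
Context (R : realType).
Implicit Types (a b c u v x y M C : R) (p h : {poly R}).

(* 'I_K.*2.+1 stands for the integers of [-K, K] *)
Definition lc K (i : 'I_K.*2.+1) : R := i%:R - K%:R.

Lemma lc_bound K (i : 'I_K.*2.+1) : `|lc i| <= K%:R.
Proof.
have iK : i%:R <= K%:R + K%:R :> R by rewrite -natrD addnn ler_nat -ltnS.
have i0 : 0 <= i%:R :> R by [].
by rewrite /lc ler_norml; lra.
Qed.

Lemma lc_rev K (i : 'I_K.*2.+1) : lc (rev_ord i) = - lc i.
Proof.
rewrite /lc /= subSS natrB; last by rewrite -ltnS.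
have -> : K.*2%:R = K%:R + K%:R :> R by rewrite -addnn natrD.
ring.
Qed.

Lemma gridE K (i : 'I_K.*2.+1) : grid R i = lc i / K%:R. Proof. by []. Qed.

Definition lpoly K n (t : n.-tuple 'I_K.*2.+1) : {poly R} :=
  \sum_(i < n) lc (tnth t i) *: 'X^i.

Definition hpoly K m (t : m.-tuple 'I_K.*2.+1) : {poly R} :=
  \sum_(i < m) lc (tnth t i) *: 'X^(i.+1).

Lemma lpoly_cons K m i (t : m.-tuple 'I_K.*2.+1) :
  lpoly (cons_tuple i t) = (lc i)%:P + hpoly t.
Proof.
rewrite /lpoly big_ord_recl/= alg_polyC (tnth_nth ord0)/=; congr (_ + _).
by apply: eq_bigr => j _; rewrite !(tnth_nth ord0).
Qed.

Lemma horner_lpoly K n (t : n.-tuple 'I_K.*2.+1) x :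
  (lpoly t).[x] = \sum_(i < n) lc (tnth t i) * x ^+ i.
Proof. by rewrite horner_sum; apply: eq_bigr => i _; rewrite hornerZ hornerXn. Qed.

Lemma horner_hpoly K m (t : m.-tuple 'I_K.*2.+1) x :
  (hpoly t).[x] = \sum_(i < m) lc (tnth t i) * x ^+ i.+1.
Proof. by rewrite horner_sum; apply: eq_bigr => i _; rewrite hornerZ hornerXn. Qed.

Lemma horner_deriv_hpoly K m (t : m.-tuple 'I_K.*2.+1) x :
  (hpoly t)^`().[x] = \sum_(i < m) lc (tnth t i) * (i.+1%:R * x ^+ i).
Proof.
rewrite raddf_sum/= horner_sum; apply: eq_bigr => i _.
by rewrite derivZ derivXn hornerZ hornerMn hornerXn/= -mulr_natl.
Qed.

Lemma hpoly0 K m (t : m.-tuple 'I_K.*2.+1) : (hpoly t).[0] = 0.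
Proof. by rewrite horner_hpoly big1// => i _; rewrite expr0n mulr0. Qed.

Lemma size_hpoly K m (t : m.-tuple 'I_K.*2.+1) : (size (hpoly t) <= m.+1)%N.
Proof.
apply: (leq_trans (size_sum _ _ _)); apply/bigmax_leqP => i _.
by rewrite (leq_trans (size_scale_leq _ _))// size_polyXn ltnS.
Qed.

Lemma is_derive_horner p x : is_derive x 1 (horner p) p^`().[x].
Proof.
apply: DeriveDef; first exact: derivable_horner.
by rewrite derivE derive1E.
Qed.

Lemma coarea_polynomial K h D a b : a < b -> h.[0] = 0 -> (size h <= D)%N ->
  `|\sum_(i < K.*2.+1) (nroots ((lc i)%:P + h) a b)%:R
    - Int (vden (horner h) (horner h^`()) K%:R) a b| <= 2 * D%:R + 1.
Proof.
move=> ab h00 hD.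
have D0 : 0 <= D%:R :> R by [].
(* A constant [h] is set apart because its derivative vanishes everywhere. It is then 0, and
   constants contribute no root, the zero polynomial by the convention for [roots]. *)
have [/size1_polyC hc|h1] := leqP (size h) 1.
  have -> : h = 0 by move: h00; rewrite hc hornerC => ->.
  rewrite big1 ?sub0r ?normrN; last first.
    by move=> i _; rewrite addr0 /nroots rootsC.
  have -> : vden (horner 0) (horner 0^`()) K%:R = (fun=> 0 : R).
    by apply/funext => x; rewrite /vden deriv0 horner0 normr0 mul0r.
  by rewrite Int_cst ?ltW// mul0r normr0; lra.
have dh : is_true (h^`() != 0).
  by rewrite -size_poly_eq0 size_deriv -lt0n -subn1 subn_gt0.
have qh (i : 'I_K.*2.+1) : (lc i)%:P + h != 0 :> {poly R}.
  apply/eqP => E; move: h1; rewrite ltnNge => /negP; apply.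
  by move/eqP: E; rewrite addrC addr_eq0 -polyCN => /eqP ->; exact: size_polyC_leq1.
have := @coarea_poly R (horner h) (horner h^`()) K (fun i => (lc i)%:P + h) _ a b ab dh qh.
move=> /(_ (fun x _ => is_derive_horner h x) (fun x _ => @continuous_horner _ _ x)).
move=> /(_ (fun x _ gx => introT eqP gx)) H.
apply: le_trans (H _) _.
  move=> i x _; rewrite rootE hornerD hornerC /lc.
  by rewrite -opprB addrC subr_eq0.
rewrite lerD2r ler_pM2l// ler_nat size_deriv.
by rewrite (leq_trans (leq_pred _)).
Qed.

Definition Tcount K n a b : R := \sum_(t : n.-tuple 'I_K.*2.+1) (nroots (lpoly t) a b)%:R.

Lemma sum_cst_ord K c : \sum_(i < K.*2.+1) c = c * K.*2.+1%:R.
Proof. by rewrite sumr_const card_ord -[c *+ _]mulr_natr. Qed.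

Lemma double_half K : K.*2.+1%:R = 2 * (K%:R + 2^-1) :> R.
Proof. by rewrite -natr1 -addnn natrD; field. Qed.

Lemma sum_cst_tuple K m c :
  \sum_(t : m.-tuple 'I_K.*2.+1) c = c * K.*2.+1%:R ^+ m.
Proof. by rewrite sumr_const card_tuple card_ord -[c *+ _]mulr_natr natrX. Qed.

Lemma Tcount_coarea K m a b : a < b ->
  `|Tcount K m.+1 a b
    - \sum_(t : m.-tuple 'I_K.*2.+1)
        Int (vden (horner (hpoly t)) (horner (hpoly t)^`()) K%:R) a b|
  <= (2 * m.+1%:R + 1) * K.*2.+1%:R ^+ m.
Proof.
move=> ab; rewrite /Tcount sum_tuple_cons exchange_big/= -sumrB -sum_cst_tuple.
apply: (le_trans (ler_norm_sum _ _ _)); apply: ler_sum => t _.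
under eq_bigr do rewrite lpoly_cons.
by apply: coarea_polynomial => //; [exact: hpoly0|exact: size_hpoly].
Qed.

(** Dividing the coefficients by [K] moves them to the grid in [[-1, 1]]: the band condition becomes
    that of [phi], and the derivative gains the factor [K]. *)
Lemma vden_slab K m (t : m.-tuple 'I_K.*2.+1) x : (0 < K)%N ->
  vden (horner (hpoly t)) (horner (hpoly t)^`()) K%:R x =
  K%:R * slab (fun i => i.+1%:R * x ^+ i) (fun i => x ^+ i.+1) 0 0
    (map_tuple (@grid R K) t).
Proof.
move=> K0; have Kp : 0 < K%:R :> R by rewrite ltr0n.
rewrite /vden /slab !add0r horner_hpoly horner_deriv_hpoly.
have E (F : nat -> R) : \sum_(i < m) F i * tnth (map_tuple (@grid R K) t) i =
    (\sum_(i < m) lc (tnth t i) * F i) / K%:R.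
  by rewrite mulr_suml; apply: eq_bigr => i _; rewrite tnth_map gridE mulrCA mulrA.
rewrite (E (fun i => i.+1%:R * x ^+ i)) (E (fun i => x ^+ i.+1)) !normrM.
rewrite !(gtr0_norm (_ : 0 < K%:R^-1)) ?invr_gt0// mulrA mulrCA divff ?gt_eqF// mulr1.
by rewrite ler_pdivrMr// mul1r.
Qed.

Definition dbound m a b : R := \sum_(i < m) i.+1%:R * (`|a| + `|b|) ^+ i.

Lemma dbound_le m a b x : a <= x <= b ->
  `|0 : R| + \sum_(i < m) `|i.+1%:R * x ^+ i| <= dbound m a b.
Proof.
move=> xab; rewrite normr0 add0r; apply: ler_sum => i _.
rewrite normrM normr_nat ler_wpM2l// normrX lerXn2r// ?nnegrE ?addr_ge0//.
have := ler_norm b; have := ler_norm (- a); rewrite normrN.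
by have := normr_ge0 a; have := normr_ge0 b; case: (ger0P x); lra.
Qed.

Lemma phi_bound m a b x : a <= x <= b -> `|phi m x| <= dbound m a b * 2 ^+ m.
Proof.
move=> xab; rewrite phiE; apply: Rintegral_le_cube.
  exact: measurable_indic_cube_slab.
move=> p; rewrite ger0_norm.
  by apply: cubei_slab_le; exact: dbound_le xab.
by rewrite mulr_ge0 ?slab_ge0//; case/andP: (cubei01 p).
Qed.

Lemma itg_phi m a b : itg (@phi R m) a b.
Proof.
apply: (@itg_bounded _ _ _ _ (dbound m a b * 2 ^+ m)).
  by apply: measurable_funTS; exact: measurable_phi.
by move=> x; exact: phi_bound.
Qed.

Lemma itg_vden_poly p q c a b : itg (vden (horner p) (horner q) c) a b.
Proof. by apply: itg_vden => x _; exact: continuous_horner. Qed.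

Lemma IntN_scale c f a b : itg f a b -> itg (fun x => c * f x) a b.
Proof.
move=> itf; rewrite /itg (_ : _ \o _ = (fun x => c%:E * (f x)%:E)%E).
  exact: integrableZl.
by apply/funext => x /=; rewrite EFinM.
Qed.

Lemma odd_pow K m : (0 < K)%N -> K.*2.+1%:R ^+ m <= 3 ^+ m * K%:R ^+ m :> R.
Proof.
by move=> K0; rewrite -exprMn -natrM lerXn2r ?nnegrE// ler_nat; lia.
Qed.

(** The constant coefficient is summed by the coarea estimate, the other [m] coefficients by the
    Riemann sums, whose error is uniform in [x] and can therefore be integrated over [[a, b]]. *)
Lemma Tcount_phi m a b : a < b -> exists C, forall K, (0 < K)%N ->
  `|Tcount K m.+1 a b / K%:R ^+ m.+1 - Int (@phi R m) a b| <= C / K%:R.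
Proof.
move=> ab; have [C0 C00 HC] := Islab_riemann m (dbound m a b).
exists ((2 * m.+1%:R + 1) * 3 ^+ m + C0 * (b - a)) => K K0.
have Kp : 0 < K%:R :> R by rewrite ltr0n.
have Kn : K%:R != 0 :> R by rewrite gt_eqF.
pose S := \sum_(t : m.-tuple 'I_K.*2.+1)
  Int (vden (horner (hpoly t)) (horner (hpoly t)^`()) K%:R) a b.
rewrite -[X in `|X|](subrKA (S / K%:R ^+ m.+1)) mulrDl.
rewrite (le_trans (ler_normD _ _))// lerD//.
  rewrite -mulrBl normrM normfV (ger0_norm (exprn_ge0 _ (ltW Kp))).
  rewrite ler_pdivrMr ?exprn_gt0//; apply: le_trans (Tcount_coarea K m ab) _.
  rewrite exprS mulrA divfK// -[leRHS]mulrA ler_wpM2l ?odd_pow//.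
pose F x := K%:R ^- m * \sum_(t : m.-tuple 'I_K.*2.+1)
  slab (fun i => i.+1%:R * x ^+ i) (fun i => x ^+ i.+1) 0 0 (map_tuple (@grid R K) t).
have FE x : F x = K%:R ^- m.+1 * \sum_(t : m.-tuple 'I_K.*2.+1)
    vden (horner (hpoly t)) (horner (hpoly t)^`()) K%:R x.
  under eq_bigr do rewrite vden_slab//.
  rewrite /F -mulr_sumr mulrA; congr (_ * _).
  by rewrite exprS invfM mulrAC mulVf ?mul1r.
have itF0 : itg (fun x => \sum_(t : m.-tuple 'I_K.*2.+1)
    vden (horner (hpoly t)) (horner (hpoly t)^`()) K%:R x) a b.
  by apply: itg_sum => t; exact: itg_vden_poly.
have itF : itg F a b by rewrite (funext FE); exact: IntN_scale.
have -> : S / K%:R ^+ m.+1 = Int F a b.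
  rewrite (funext FE) IntZ// mulrC; congr (_ * _).
  by rewrite Int_sum// => t; exact: itg_vden_poly.
rewrite -IntB//; last exact: itg_phi.
rewrite mulrAC; apply: Int_bound; first exact: ltW.
  by apply: itgB => //; exact: itg_phi.
by move=> x xab; rewrite phiE; apply: HC => //; exact: dbound_le.
Qed.

Lemma nroots_bij (f : R -> R) p q a b c v : involutive f ->
  p != 0 -> q != 0 ->
  (forall x, a < x < b -> c < f x < v) -> (forall x, c < x < v -> a < f x < b) ->
  (forall x, a < x < b -> root p x = root q (f x)) ->
  nroots p a b = nroots q c v.
Proof.
move=> fK p0 q0 fab fcv pq; rewrite /nroots -(size_map f).
apply: perm_size; apply: uniq_perm.
- by rewrite map_inj_uniq ?uniq_roots//; exact: inv_inj.
- exact: uniq_roots.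
move=> y; rewrite -[y in LHS]fK (mem_map (inv_inj fK)) !in_roots !in_itv/= p0 q0 !andbT.
have [yab|yab] := boolP (a < f y < b).
  by have := fab _ yab; rewrite pq// fK => ->; rewrite !andbT.
rewrite andbF; symmetry; apply/negbTE; rewrite negb_and; apply/orP; right.
by apply: contra yab; exact: fcv.
Qed.

(** Reversing the coefficients permutes the tuples and inverts the nonzero roots. The zero
    polynomial, which has no root list to invert, is treated apart. *)
Lemma Tcount_rev K n a b : 0 < a -> 0 < b ->
  Tcount K n b^-1 a^-1 = Tcount K n a b.
Proof.
move=> a0 b0.
have revI : involutive (@rev_tuple n 'I_K.*2.+1) by move=> t; apply: val_inj; exact: revK.
rewrite /Tcount (reindex_inj (inv_inj revI))/=.
apply: eq_bigr => t _; congr (_%:R).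
case: n {revI} t => [|n] t.
  by rewrite /lpoly !big_ord0 /nroots !roots0.
have rv x : x != 0 -> (lpoly (rev_tuple t)).[x^-1] = x ^- n * (lpoly t).[x].
  move=> x0; rewrite !horner_lpoly (reindex_inj rev_ord_inj)/= mulr_sumr.
  apply: eq_bigr => i _.
  have -> : tnth (rev_tuple t) (rev_ord i) = tnth t i.
    rewrite !(tnth_nth ord0)/= nth_rev ?size_tuple ?subSS ?ltnS ?leq_subr//.
    by rewrite subnBA ?addKn// -ltnS.
  rewrite mulrCA; congr (_ * _); rewrite subSS exprVn.
  have key k : (k <= n)%N -> x ^- (n - k) = x ^- n * x ^+ k.
    by move=> kn; rewrite -{2}(subnK kn) exprD invfM -mulrA mulVf ?mulr1// expf_neq0.
  by rewrite key// -ltnS.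
have z : (lpoly (rev_tuple t) == 0) = (lpoly t == 0).
  have e0 (u : n.+1.-tuple 'I_K.*2.+1) : (lpoly u == 0) = [forall i, lc (tnth u i) == 0].
    apply/eqP/forallP => [u0 i|u0].
      have : (lpoly u)`_i = 0 by rewrite u0 coef0.
      rewrite coef_sum (bigD1 i)//= coefZ coefXn eqxx mulr1 big1 ?addr0 => [->//|j ji].
      rewrite coefZ coefXn; case: eqP => [/val_inj ij|_]; last by rewrite mulr0.
      by rewrite ij eqxx in ji.
    by rewrite /lpoly big1// => i _; rewrite (eqP (u0 i)) scale0r.
  rewrite !e0; apply/forallP/forallP => h i; have := h (rev_ord i);
  rewrite !(tnth_nth ord0)/= nth_rev ?size_tuple ?subSS ?ltnS ?leq_subr//.
    by rewrite subnBA ?addKn// -ltnS.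
  by rewrite -ltnS.
have [t0|t0] := eqVneq (lpoly t) 0.
  by move: (z); rewrite t0 eqxx => /eqP ->; rewrite /nroots !roots0.
apply/esym/(nroots_bij (@invrK R)) => //.
- by rewrite z.
- move=> x /andP[ax xb]; have x0 : 0 < x by apply: lt_trans ax.
  by rewrite !ltf_pV2 ?posrE// xb ax.
- move=> x /andP[ax xb]; have x0 : 0 < x by apply: lt_trans ax; rewrite invr_gt0.
  by rewrite -[a]invrK -[b]invrK !ltf_pV2 ?posrE ?invr_gt0// xb ax.
- move=> x /andP[ax _]; have x0 : x != 0 by rewrite gt_eqF// (lt_trans a0).
  by rewrite !rootE rv// mulf_eq0 invr_eq0 expf_eq0 (negbTE x0) andbF.
Qed.

Definition flip_odd K n (t : n.-tuple 'I_K.*2.+1) : n.-tuple 'I_K.*2.+1 :=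
  [tuple if odd i then rev_ord (tnth t i) else tnth t i | i < n].

Lemma flip_oddK K n : involutive (@flip_odd K n).
Proof.
move=> t; apply: eq_from_tnth => i; rewrite !tnth_mktuple.
by case: (odd i) => //; rewrite rev_ordK.
Qed.

Lemma horner_flip_odd K n (t : n.-tuple 'I_K.*2.+1) x :
  (lpoly (flip_odd t)).[- x] = (lpoly t).[x].
Proof.
rewrite !horner_lpoly; apply: eq_bigr => i _; rewrite tnth_mktuple exprNn.
rewrite -signr_odd; case: (odd i); last by rewrite expr0 mul1r.
by rewrite expr1 mulN1r lc_rev mulrNN.
Qed.

Lemma lpoly_flip_odd K n (t : n.-tuple 'I_K.*2.+1) :
  lpoly (flip_odd t) = lpoly t \Po - 'X.
Proof.
rewrite /lpoly rmorph_sum/=; apply: eq_bigr => i _; rewrite tnth_mktuple.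
rewrite linearZ/= rmorphXn/= comp_polyX exprNn -signr_odd.
case: (odd i); last by rewrite expr0 mul1r.
by rewrite expr1 mulN1r lc_rev scalerN scaleNr.
Qed.

Lemma Tcount_opp K n a b : Tcount K n (- b) (- a) = Tcount K n a b.
Proof.
rewrite /Tcount (reindex_inj (inv_inj (@flip_oddK K n)))/=.
apply: eq_bigr => t _; congr (_%:R).
have [t0|t0] := eqVneq (lpoly t) 0.
  by rewrite lpoly_flip_odd t0 comp_poly0 /nroots !roots0.
apply/esym/(nroots_bij (@opprK R)) => //.
- apply: contra t0; rewrite lpoly_flip_odd => /eqP h.
  have : (lpoly t \Po - 'X) \Po - 'X = 0 by rewrite h comp_poly0.
  by rewrite -comp_polyA rmorphN/= comp_polyX opprK comp_polyXr => ->.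
- by move=> x; rewrite !ltrN2 andbC.
- by move=> x; rewrite ltrNl ltrNr andbC.
- by move=> x _; rewrite !rootE horner_flip_odd.
Qed.

Lemma eq_of_dist (u v C : R) :
  (forall K : nat, (0 < K)%N -> `|u - v| <= C / K%:R) -> u = v.
Proof.
move=> H; apply/eqP; rewrite -subr_eq0 -normr_le0 leNgt; apply/negP => e0.
have := archi_boundP (divr_ge0 (normr_ge0 C) (ltW e0)).
set N := Num.bound _; rewrite ltr_pdivrMr// => HN.
have N0 : (0 < N)%N.
  by rewrite lt0n; apply/negP => /eqP N0; move: HN; rewrite N0 mul0r normr_lt0.
have := H _ N0; rewrite ler_pdivlMr ?ltr0n// leNgt => /negP; apply.
by rewrite mulrC (le_lt_trans (ler_norm C)).
Qed.

(** Symmetries of the integral of [phi] are inherited from exact symmetries of the counts as [K]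
    grows, which avoids a change of variables in the multiple integral. *)
Lemma Int_phi_Tcount m a b c v : a < b -> c < v ->
  (forall K, Tcount K m.+1 a b = Tcount K m.+1 c v) ->
  Int (@phi R m) a b = Int (@phi R m) c v.
Proof.
move=> ab cv T; have [C1 H1] := Tcount_phi m ab; have [C2 H2] := Tcount_phi m cv.
apply: (@eq_of_dist _ _ (C1 + C2)) => K K0; rewrite mulrDl.
apply: le_trans (ler_distD (Tcount K m.+1 a b / K%:R ^+ m.+1) _ _) _.
by rewrite lerD// ?(distrC (Int _ _ _)) ?H1// T H2.
Qed.

Lemma Int_phi_inv m a b : 0 < a -> a < b ->
  Int (@phi R m) b^-1 a^-1 = Int (@phi R m) a b.
Proof.
move=> a0 ab; have b0 := lt_trans a0 ab; apply: Int_phi_Tcount => //.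
  by rewrite ltf_pV2.
by move=> K; exact: Tcount_rev.
Qed.

Lemma Int_phi_opp m a b : a < b -> Int (@phi R m) (- b) (- a) = Int (@phi R m) a b.
Proof.
move=> ab; apply: Int_phi_Tcount => //; first by rewrite ltrN2.
by move=> K; exact: Tcount_opp.
Qed.

(** The integral over [[-i, i]] is twice the one over [[0, i]], and inversion carries [[A, i]] to
    [[1/i, 1/A]]. What is missing is the integral over [[0, 1/i]], where [phi] is bounded, so it
    tends to 0. *)
Lemma phi_total m A : 0 < A ->
  \int[lebesgue_measure]_(t in [set: R]) phi m t
  = 2 * (Int (@phi R m) 0 A + Int (@phi R m) 0 A^-1).
Proof.
move=> A0; set L := RHS.
pose M0 := dbound m 0 1 * 2 ^+ m.
pose F (i : nat) : set R := `[- i%:R, i%:R]%classic.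
have near_zero i : A < i%:R -> 1 <= i%:R :> R ->
    `|Int (@phi R m) (- i%:R) i%:R - L| <= 2 * M0 / i%:R.
  move=> Ai i1; have i0 : 0 < i%:R :> R by lra.
  have iV : 0 < i%:R^-1 :> R by rewrite invr_gt0.
  rewrite (@Int_split _ _ _ _ 0 _ _ (itg_phi _ _ _)) ?oppr_le0//.
  rewrite -[X in Int _ _ X]oppr0 Int_phi_opp// -mulr2n -[_ *+ 2]mulr_natl.
  rewrite (@Int_split _ _ 0 i%:R A (ltW A0) (ltW Ai) (itg_phi _ _ _)).
  rewrite -[Int _ A _](Int_phi_inv _ A0 Ai).
  have iA : i%:R^-1 <= A^-1 :> R by rewrite lef_pV2 ?posrE// ltW.
  have HS := @Int_split _ (@phi R m) 0 A^-1 i%:R^-1 (ltW iV) iA (itg_phi m _ _).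
  have HB : `|Int (@phi R m) 0 i%:R^-1| <= M0 * (i%:R^-1 - 0).
    apply: Int_bound; [lra|exact: itg_phi|move=> x x1; apply: phi_bound].
    have : i%:R^-1 <= 1 :> R by rewrite invf_le1.
    lra.
  rewrite /L HS.
  set u := Int _ 0 A; set w := Int _ _ A^-1; set z := Int _ 0 i%:R^-1 in HB *.
  have -> : 2 * (u + w) - 2 * (u + (z + w)) = - (2 * z) by ring.
  by rewrite normrN normrM normr_nat -mulrA ler_wpM2l// -[i%:R^-1]subr0.
have cvgL : (Int (@phi R m) (- i%:R) i%:R) @[i --> \oo] --> L.
  apply/cvgrPdist_le => e e0; near=> i.
  have i1 : 1 <= i%:R :> R by near: i; exact: nbhs_infty_ger.
  have Ai : A < i%:R :> R by near: i; exact: nbhs_infty_gtr.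
  have Mi : 2 * M0 / e <= i%:R by near: i; exact: nbhs_infty_ger.
  rewrite distrC (le_trans (near_zero _ Ai i1))//.
  have i0 : 0 < i%:R :> R by apply: lt_le_trans i1.
  by rewrite ler_pdivrMr// -ler_pdivrMl// mulrC.
have bigF : \bigcup_i F i = setT.
  rewrite -subTset => x _; have xB := archi_boundP (normr_ge0 x).
  exists (Num.bound `|x|) => //; rewrite /F /= in_itv/=.
  by rewrite -ler_norml ltW.
have ndF : nondecreasing_seq F.
  move=> i j ij; apply/subsetPset/subset_itv; rewrite bnd_simp ?lerN2 ler_nat//.
have := @ge0_nondecreasing_set_cvg_integral _ (measurableTypeR R) R F (fun t => (phi m t)%:E)
  (@lebesgue_measure R) ndF.
have mphi i : measurable_fun (F i) (fun t => (phi m t)%:E).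
  by apply/measurable_EFinP/measurable_funTS; exact: measurable_phi.
move=> /(_ (fun i => measurable_itv _) mphi); rewrite bigF.
move=> /(_ (fun i x _ => phi_ge0 m x)) => cvgI.
have cvgE : (\int[lebesgue_measure]_(x in F i) (phi m x)%:E)%E @[i --> \oo] --> L%:E.
  rewrite (_ : (fun i => _) = EFin \o (fun i : nat => Int (@phi R m) (- i%:R) i%:R)).
    by apply: cvg_EFin; [exact: nearW|exact: cvgL].
  apply/funext => i /=; rewrite /Int /Rintegral fineK//.
  exact: integrable_fin_num (itg_phi m _ _).
by rewrite /Rintegral (cvg_unique _ cvgI cvgE).
Unshelve. all: by end_near.
Qed.

End LatticeCount.

(** * Roots in a bounded interval: the leading monomial is negligible *)

Section MonicSmallRoots.
Context (R : realType).
Implicit Types (a b c u v x y r e M C A : R) (p h : {poly R}).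

Lemma hpoly_cons K m i (t : m.-tuple 'I_K.*2.+1) :
  hpoly R (cons_tuple i t) = lc R i *: 'X + 'X * hpoly R t.
Proof.
rewrite /hpoly big_ord_recl (tnth_nth ord0)/= expr1; congr (_ + _).
rewrite mulr_sumr; apply: eq_bigr => j _; rewrite !(tnth_nth ord0)/=.
by rewrite -scalerAr -exprS.
Qed.

Lemma horner_hpoly_cons K m i (t : m.-tuple 'I_K.*2.+1) x :
  (hpoly R (cons_tuple i t)).[x] = lc R i * x + x * (hpoly R t).[x].
Proof. by rewrite hpoly_cons hornerD hornerZ hornerM hornerX. Qed.

(** What remains of the derivative once the coefficient of ['X], the next one to be summed, has been
    split off. *)
Definition drest K m (t : m.-tuple 'I_K.*2.+1) x : R :=
  (hpoly R t).[x] + x * (hpoly R t)^`().[x].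

Lemma horner_dhpoly_cons K m i (t : m.-tuple 'I_K.*2.+1) x :
  (hpoly R (cons_tuple i t))^`().[x] = lc R i + drest t x.
Proof.
rewrite hpoly_cons derivD derivZ derivX derivM derivX !(hornerD, hornerZ, hornerM, hornerX).
by rewrite !hornerC mulr1 mul1r.
Qed.

Lemma count_closed K u v : u <= v ->
  \sum_(i < K.*2.+1) (u <= lc R i <= v)%R%:R <= (v - u) + 3.
Proof.
move=> uv; have uv1 : u - 1 < v + 1 by lra.
have := count_between K uv1; rewrite ler_norml => /andP[_ H].
apply: (@le_trans _ _ (\sum_(i < K.*2.+1) (u - 1 < i%:R - K%:R < v + 1)%R%:R)).
  apply: ler_sum => i _; case: (boolP (u <= _ <= v)) => // /andP[h1 h2].
  by rewrite /lc in h1 h2; rewrite (_ : _ < _ < _)//; lra.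
have clamp_lip : clamp K%:R (v + 1) - clamp K%:R (u - 1) <= v - u + 2.
  have K0 : 0 <= K%:R :> R by [].
  rewrite /clamp; case: (leP (v + 1)); case: (leP (u - 1)) => ? ?;
  rewrite !minElt; do ?case: ltP => ?; lra.
lra.
Qed.

(** The two indicators differ only if [lc i * x] falls into one of two intervals of length [e] next
    to the ends of the band. For [lc i] this means an interval of length [e / x], which holds at
    most [e / x + 3] integers. *)
Lemma indic_shift K x r e : 0 < x -> 0 <= e ->
  \sum_(i < K.*2.+1) `|(`|lc R i * x + r + e| <= K%:R)%R%:R -
     (`|lc R i * x + r| <= K%:R)%R%:R : R| <= 2 * (e / x + 3).
Proof.
move=> x0 e0; have ex : 0 <= e / x by rewrite divr_ge0// ltW.
pose u1 := (K%:R - e - r) / x; pose v1 := (K%:R - r) / x.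
pose u2 := (- K%:R - e - r) / x; pose v2 := (- K%:R - r) / x.
have E1 : v1 - u1 = e / x by rewrite /v1 /u1 -mulrBl; congr (_ / _); ring.
have E2 : v2 - u2 = e / x by rewrite /v2 /u2 -mulrBl; congr (_ / _); ring.
have H1 : u1 <= v1 by rewrite -subr_ge0 E1.
have H2 : u2 <= v2 by rewrite -subr_ge0 E2.
have -> : 2 * (e / x + 3) = (v1 - u1) + 3 + ((v2 - u2) + 3) by rewrite E1 E2; ring.
apply: le_trans (lerD (count_closed K H1) (count_closed K H2)).
rewrite -big_split/=; apply: ler_sum => i _.
rewrite /u1 /v1 /u2 /v2 !ler_pdivrMr// !ler_pdivlMr//.
set z := lc R i * x; rewrite (ler_norml (z + r + e)) (ler_norml (z + r)).
case: (boolP (- K%:R <= z + r + e <= K%:R)) => h1;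
case: (boolP (- K%:R <= z + r <= K%:R)) => h2.
- by rewrite subrr normr0 addr_ge0.
- rewrite subr0 normr1; case: (boolP (_ <= z <= - K%:R - r)) => h3.
    by rewrite lerDr.
  by move: h1 h2 h3; rewrite !negb_and -!ltNge; lra.
- rewrite sub0r normrN normr1; case: (boolP (_ <= z <= K%:R - r)) => h3.
    by rewrite lerDl.
  by move: h1 h2 h3; rewrite !negb_and -!ltNge; lra.
- by rewrite subrr normr0 addr_ge0.
Qed.

Lemma dhpoly_bound K m (t : m.-tuple 'I_K.*2.+1) x A : 0 <= x <= A ->
  `|(hpoly R t)^`().[x]| <= K%:R * dbound m 0 A.
Proof.
move=> xA; rewrite horner_deriv_hpoly /dbound mulr_sumr.
apply: (le_trans (ler_norm_sum _ _ _)); apply: ler_sum => i _.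
rewrite normrM ler_pM ?normr_ge0 ?lc_bound//.
rewrite normrM normr_nat ler_wpM2l// normrX lerXn2r// ?nnegrE ?addr_ge0//.
by rewrite normr0 add0r !ger0_norm; lra.
Qed.

Definition Mcount K n a b : R :=
  \sum_(t : n.-tuple 'I_K.*2.+1) (nroots ('X^n + lpoly R t) a b)%:R.

(** The leading monomial changes the derivative by a bounded amount, and changes the band condition
    for boundedly many values of the coefficient of ['X], each at cost [O(K)]. The number stays
    bounded as [x] tends to 0 because the shift [x ^+ m.+2] is divided by [x] only once. *)
Lemma vden_monic_diff m A : 0 <= A -> exists C, forall K x, (0 < K)%N -> 0 <= x <= A ->
  `|\sum_(t : m.+1.-tuple 'I_K.*2.+1)
     (vden (horner (hpoly R t + 'X^(m.+2))) (horner (hpoly R t + 'X^(m.+2))^`()) K%:R x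
      - vden (horner (hpoly R t)) (horner (hpoly R t)^`()) K%:R x)|
  <= C * K%:R ^+ m.+1.
Proof.
move=> A0.
pose E1 : R := m.+2%:R * A ^+ m.+1; pose D := dbound m.+1 0 A.
have D0 : 0 <= D.
  by apply: sumr_ge0 => i _; rewrite mulr_ge0// exprn_ge0// addr_ge0.
have E10 : 0 <= E1 by rewrite mulr_ge0// exprn_ge0.
pose C1 := 3 * E1 + D * (2 * (A ^+ m.+1 + 3)).
have C10 : 0 <= C1.
  by rewrite /C1 addr_ge0// mulr_ge0// mulr_ge0// addr_ge0// exprn_ge0.
exists (C1 * 3 ^+ m) => K x K0 xA; have Kp : 1 <= K%:R :> R by rewrite ler1n.
have [x0 Ax] : 0 <= x /\ x <= A by apply/andP.
have xA1 : x ^+ m.+1 <= A ^+ m.+1 by rewrite lerXn2r// nnegrE.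
rewrite sum_tuple_cons exchange_big/=.
apply: (le_trans (ler_norm_sum _ _ _)).
apply: (@le_trans _ _ (\sum_(t : m.-tuple 'I_K.*2.+1) (C1 * K%:R))); last first.
  rewrite sum_cst_tuple exprS [K%:R * _]mulrC -mulrA [K%:R * _]mulrC !mulrA.
  rewrite ler_wpM2r// -!mulrA ler_wpM2l// odd_pow//.
apply: ler_sum => t _; apply: (le_trans (ler_norm_sum _ _ _)).
pose I1 := fun i : 'I_K.*2.+1 => (`|lc R i * x + x * (hpoly R t).[x] + x ^+ m.+2| <= K%:R)%R%:R : R.
pose I2 := fun i : 'I_K.*2.+1 => (`|lc R i * x + x * (hpoly R t).[x]| <= K%:R)%R%:R : R.
apply: (@le_trans _ _ (\sum_(i < K.*2.+1) (E1 + K%:R * D * `|I1 i - I2 i|))).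
  apply: ler_sum => i _.
  rewrite /vden hornerD hornerXn derivD derivXn hornerD hornerMn hornerXn horner_hpoly_cons.
  rewrite -/(I1 i) -/(I2 i) /=; set g := (hpoly R _)^`().[x].
  set e := x ^+ _ *+ _.
  have -> : `|g + e| * I1 i - `|g| * I2 i = (`|g + e| - `|g|) * I1 i + `|g| * (I1 i - I2 i) by ring.
  apply: (le_trans (ler_normD _ _)); rewrite lerD// normrM.
    have -> : `|I1 i| = I1 i by rewrite ger0_norm.
    apply: (@le_trans _ _ `|e|).
      apply: (@le_trans _ _ `| `|g + e| - `|g| |).
        by rewrite ler_piMr// /I1 lern1 leq_b1.
      by apply: le_trans (ler_dist_dist _ _) _; rewrite addrAC subrr add0r.
    rewrite /e -[_ *+ _]mulr_natl normrM normr_nat ler_wpM2l//.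
    by rewrite ger0_norm// exprn_ge0.
  by rewrite normr_id ler_wpM2r// /g; apply: dhpoly_bound.
rewrite big_split/= sum_cst_ord -[X in _ + X]mulr_sumr.
have S2 : \sum_(i < K.*2.+1) `|I1 i - I2 i| <= 2 * (A ^+ m.+1 + 3).
  (* At [x = 0] there is nothing to divide by, but the two indicators coincide. *)
  move: x0; rewrite le_eqVlt => /predU1P[x00|x0].
    rewrite big1 ?mulr_ge0 ?addr_ge0 ?exprn_ge0// => i _.
    by rewrite /I1 /I2 -x00 expr0n/= !addr0 subrr normr0.
  apply: (le_trans (@indic_shift K x _ _ x0 (exprn_ge0 _ (ltW x0)))).
  by rewrite exprSr mulfK ?gt_eqF// ler_wpM2l// lerD2r.
have K2 : K.*2.+1%:R <= 3 * K%:R :> R by rewrite -natrM ler_nat; lia.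
apply: (@le_trans _ _ (E1 * (3 * K%:R) + K%:R * D * (2 * (A ^+ m.+1 + 3)))).
  by rewrite lerD ?ler_wpM2l// mulr_ge0.
by rewrite le_eqVlt (_ : _ == _)//; apply/eqP; rewrite /C1; ring.
Qed.

Lemma Mcount_small m A : 0 < A -> exists C, forall K, (0 < K)%N ->
  `|Mcount K m.+2 0 A - Tcount K m.+2 0 A| <= C * K%:R ^+ m.+1.
Proof.
move=> A0; have [C HC] := vden_monic_diff m (ltW A0).
exists (((2 * m.+3%:R + 1) + (2 * m.+2%:R + 1)) * 3 ^+ m.+1 + C * A) => K K0.
have := Tcount_coarea K m.+1 A0.
set S := \sum_t _ => HT.
pose S1 : R := \sum_(t : m.+1.-tuple 'I_K.*2.+1)
  Int (vden (horner (hpoly R t + 'X^(m.+2))) (horner (hpoly R t + 'X^(m.+2))^`()) K%:R) 0 A.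
have HM : `|Mcount K m.+2 0 A - S1| <= (2 * m.+3%:R + 1) * K.*2.+1%:R ^+ m.+1.
  rewrite /Mcount sum_tuple_cons exchange_big/= -sumrB -sum_cst_tuple.
  apply: (le_trans (ler_norm_sum _ _ _)); apply: ler_sum => t _.
  under eq_bigr do rewrite lpoly_cons addrCA [_ + hpoly _ _]addrC.
  apply: coarea_polynomial => //.
    by rewrite hornerD hpoly0 hornerXn expr0n addr0.
  rewrite (leq_trans (size_polyD _ _))// geq_max size_polyXn leqnn andbT.
  by rewrite (leq_trans (size_hpoly _ _)).
have HD : `|S1 - S| <= C * K%:R ^+ m.+1 * (A - 0).
  rewrite /S1 /S -!Int_sum => [|t|t]; do ?exact: itg_vden_poly.
  rewrite -IntB; do ?by apply: itg_sum => t; exact: itg_vden_poly.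
  apply: Int_bound; first exact: ltW.
    by apply: itgB; apply: itg_sum => t; exact: itg_vden_poly.
  by move=> x xA; rewrite -sumrB; exact: HC.
have K3 := odd_pow R m.+1 K0.
apply: le_trans (ler_distD S1 _ _) _; rewrite distrC in HT.
apply: le_trans (lerD HM (ler_distD S _ _)) _.
apply: le_trans (lerD (lexx _) (lerD HD HT)) _.
rewrite subr0 [leRHS]mulrDl [C * A * _]mulrAC addrCA addrC lerD2r -mulrDl -mulrA.
by rewrite ler_wpM2l// !addr_ge0// mulr_ge0.
Qed.

End MonicSmallRoots.

(** * Large roots of monic polynomials *)

Section AbsoluteSums.
Context (R : realType).
Implicit Types (a b u w x y z r s k : R).

Definition ppos2 w : R := Num.max w 0 ^+ 2.
(* an antiderivative of the absolute value *)
Definition habs u : R := u * `|u| / 2.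

Lemma ppos2_le0 w : w <= 0 -> ppos2 w = 0.
Proof. by move=> w0; rewrite /ppos2 max_r// expr0n. Qed.

Lemma ppos2_ge0 w : 0 <= w -> ppos2 w = w ^+ 2.
Proof. by move=> w0; rewrite /ppos2 max_l. Qed.

Lemma habsE u : habs u = u ^+ 2 / 2 - ppos2 (- u).
Proof.
rewrite /habs; have [u0|u0] := leP 0 u.
  by rewrite ger0_norm// ppos2_le0 ?oppr_le0// subr0 expr2.
rewrite ltr0_norm// ppos2_ge0 ?oppr_ge0 ?ltW//; by field.
Qed.

(** The midpoint rule for the absolute value: exact on a unit cell that does not contain the kink in
    its interior, and otherwise with error [(|u| - 1/2)^2]. *)
Lemma habs_step u : `|habs (u + 2^-1) - habs (u - 2^-1) - `|u| | <= 4^-1.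
Proof.
have pos v : 0 <= v -> habs v = v ^+ 2 / 2.
  by move=> v0; rewrite habsE ppos2_le0 ?oppr_le0// subr0.
have neg v : v <= 0 -> habs v = - (v ^+ 2 / 2).
  by move=> v0; rewrite habsE ppos2_ge0 ?oppr_ge0//; by field.
have [h|h] := leP 2^-1 u.
  rewrite !pos; [|lra|lra]; rewrite (@ger0_norm _ u); last lra.
  have -> : (u + 2^-1) ^+ 2 / 2 - (u - 2^-1) ^+ 2 / 2 - u = 0 by field.
  by rewrite normr0; lra.
have [h'|h'] := leP u (- 2^-1).
  rewrite !neg; [|lra|lra]; rewrite (@ler0_norm _ u); last lra.
  have -> : - ((u + 2^-1) ^+ 2 / 2) - - ((u - 2^-1) ^+ 2 / 2) - - u = 0 by field.
  by rewrite normr0; lra.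
rewrite pos ?neg; [|lra|lra].
have -> : (u + 2^-1) ^+ 2 / 2 - - ((u - 2^-1) ^+ 2 / 2) - `|u| = (`|u| - 2^-1) ^+ 2.
  rewrite [in RHS]sqrrB real_normK ?num_real//; by field.
have uh : `|u| <= 2^-1 by rewrite ler_norml; lra.
have u0 := normr_ge0 u.
by rewrite ger0_norm ?sqr_ge0//; nra.
Qed.

Definition abssum K z : R := \sum_(i < K.*2.+1) `|lc R i + z|.

(** The unit cells around the integers of [[-K, K]] fill [[-k, k]], so the sum approximates the
    integral of the absolute value from [z - k] to [z + k], at cost 1/4 per integer. The [ppos2]
    terms are nonzero only when 0 lies outside that interval. *)
Lemma abssum_approx K z k : k = K%:R + 2^-1 ->
  `|abssum K z - (k ^+ 2 + z ^+ 2 - (ppos2 (z - k) + ppos2 (- z - k)))|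
    <= k / 2.
Proof.
move=> hk; pose w (i : nat) : R := i%:R - K%:R + z - 2^-1.
have -> : k ^+ 2 + z ^+ 2 - (ppos2 (z - k) + ppos2 (- z - k)) =
    \sum_(i < K.*2.+1) (habs (w i.+1) - habs (w i)).
  rewrite -(big_mkord xpredT (fun i => habs (w i.+1) - habs (w i))) telescope_sumr//.
  have -> : w K.*2.+1 = k + z by rewrite /w hk -natr1 -addnn natrD; by field.
  have -> : w 0 = - (k - z) by rewrite /w hk; by field.
  have -> : habs (- (k - z)) = - habs (k - z) by rewrite /habs normrN; ring.
  rewrite !habsE opprK; have -> : - (k + z) = - z - k by ring.
  have -> : - (k - z) = z - k by ring.
  by field.
rewrite /abssum -sumrB; apply: (le_trans (ler_norm_sum _ _ _)).
apply: (@le_trans _ _ (\sum_(i < K.*2.+1) 4^-1)).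
  apply: ler_sum => i _; rewrite distrC.
  have -> : w i.+1 = lc R i + z + 2^-1 by rewrite /w /lc -natr1; by field.
  have -> : w i = lc R i + z - 2^-1 by rewrite /w /lc; ring.
  exact: habs_step.
rewrite sum_cst_ord double_half hk; lra.
Qed.

Lemma ppos2_diff a r : `|ppos2 (a + r) + ppos2 (a - r) - 2 * ppos2 a| <= 2 * r ^+ 2.
Proof.
have r2 := sqr_ge0 r.
have p w : ppos2 w = if 0 <= w then w ^+ 2 else 0.
  by have [h|h] := leP 0 w; [rewrite ppos2_ge0|rewrite ppos2_le0 ?ltW].
rewrite !p ler_norml; apply/andP.
case: (leP 0 (a + r)) => h1; case: (leP 0 (a - r)) => h2; case: (leP 0 a) => h3;
split; nra.
Qed.

(* the increment of [abssum] caused by the shift [- s], averaged over [r] and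
   [- r], when [r] is O(sqrt k) or all terms are below [k] *)
Lemma abssum_pair K k r s B : k = K%:R + 2^-1 ->
  0 <= s -> `|r| <= k -> (s + `|r| <= k \/ r ^+ 2 <= B) -> 0 <= B ->
  `|(abssum K (r - s) - abssum K r) + (abssum K (- r - s) - abssum K (- r))
    - 2 * (s ^+ 2 - ppos2 (s - k))| <= 2 * k + 2 * B.
Proof.
move=> hk s0 rk rs B0.
have /andP[rk1 rk2] : - k <= r <= k by rewrite -ler_norml.
have := abssum_approx (r - s) hk; have := abssum_approx r hk.
have := abssum_approx (- r - s) hk; have := abssum_approx (- r) hk.
rewrite opprK.
have -> : ppos2 (r - k) = 0 by apply: ppos2_le0; lra.
have -> : ppos2 (- r - k) = 0 by apply: ppos2_le0; lra.
have -> : ppos2 (r - s - k) = 0 by apply: ppos2_le0; lra.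
have -> : ppos2 (- r - s - k) = 0 by apply: ppos2_le0; lra.
have -> : - (r - s) - k = (s - k) - r by ring.
have -> : - (- r - s) - k = (s - k) + r by ring.
have D : `|ppos2 (s - k + r) + ppos2 (s - k - r) - 2 * ppos2 (s - k)| <= 2 * B.
  case: rs => [rs|rs].
    have := ler_norm r; have := ler_norm (- r); rewrite normrN => ? ?.
    by rewrite !ppos2_le0; [rewrite mulr0 !addr0 subr0 normr0; lra|lra..].
  by apply: (le_trans (ppos2_diff _ _)); lra.
move: D; set p1 := ppos2 _; set p2 := ppos2 _; set p0 := ppos2 _.
rewrite !ler_norml => D H1 H2 H3 H4.
have E1 : (r - s) ^+ 2 + (- r - s) ^+ 2 = 2 * r ^+ 2 + 2 * s ^+ 2 by ring.
have E2 : (- r) ^+ 2 = r ^+ 2 by ring.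
rewrite E2 in H1.
move: D H1 H2 H3 H4 E1.
move: (abssum _ _) (abssum _ _) (abssum _ _) (abssum _ _) ((r - s) ^+ 2)
  ((- r - s) ^+ 2) (r ^+ 2) (s ^+ 2) (k ^+ 2) => *.
lra.
Qed.

End AbsoluteSums.

(** * Sums over all coefficients of the derivative at a fixed point [y] *)

Section LargeRootDensity.
Context (R : realType).
Implicit Types (a b u w x y z r s k : R).

Lemma drestE K m (t : m.-tuple 'I_K.*2.+1) y :
  drest t y = \sum_(j < m) lc R (tnth t j) * (j.+2%:R * y ^+ j.+1).
Proof.
rewrite /drest horner_hpoly horner_deriv_hpoly mulr_sumr -big_split/=.
by apply: eq_bigr => j _; rewrite exprS -natr1; ring.
Qed.

Lemma exp_le_base y j : 0 <= y <= 1 -> y ^+ j.+1 <= y.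
Proof.
by move=> /andP[y0 y1]; rewrite exprS ler_piMr// exprn_ile1.
Qed.

Lemma drest_bound K m (t : m.-tuple 'I_K.*2.+1) y : 0 <= y <= 1 ->
  `|drest t y| <= m.+2%:R ^+ 2 * K%:R * y.
Proof.
move=> y01; have /andP[y0 y1] := y01.
rewrite drestE; apply: (le_trans (ler_norm_sum _ _ _)).
apply: (@le_trans _ _ (\sum_(j < m) K%:R * (m.+2%:R * y))).
  apply: ler_sum => j _; rewrite normrM ler_pM ?lc_bound//.
  rewrite normrM normr_nat ger0_norm ?exprn_ge0// ler_pM ?exprn_ge0 ?exp_le_base//.
  by rewrite ler_nat !ltnS ltnW// ltnW.
rewrite sumr_const card_ord -[_ *+ m]mulr_natl.
have -> : m%:R * (K%:R * (m.+2%:R * y)) = m%:R * m.+2%:R * K%:R * y by ring.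
rewrite ler_wpM2r// ler_wpM2r// expr2 ler_wpM2r// ler_nat.
by rewrite ltnW.
Qed.

Lemma hpoly_bound K m (t : m.-tuple 'I_K.*2.+1) y : 0 <= y <= 1 ->
  `|(hpoly R t).[y]| <= m%:R * K%:R * y.
Proof.
move=> y01; have /andP[y0 y1] := y01.
rewrite horner_hpoly; apply: (le_trans (ler_norm_sum _ _ _)).
apply: (@le_trans _ _ (\sum_(j < m) K%:R * y)).
  apply: ler_sum => j _; rewrite normrM ler_pM ?lc_bound//.
  by rewrite ger0_norm ?exprn_ge0// exp_le_base.
by rewrite sumr_const card_ord -[_ *+ m]mulr_natl mulrA.
Qed.

Definition negt K m (t : m.-tuple 'I_K.*2.+1) : m.-tuple 'I_K.*2.+1 :=
  map_tuple (@rev_ord _) t.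

Lemma negtK K m : involutive (@negt K m).
Proof. by move=> t; apply: eq_from_tnth => i; rewrite !tnth_map rev_ordK. Qed.

Lemma hpoly_negt K m (t : m.-tuple 'I_K.*2.+1) : hpoly R (negt t) = - hpoly R t.
Proof.
rewrite /hpoly -sumrN; apply: eq_bigr => i _.
by rewrite tnth_map lc_rev scaleNr.
Qed.

Lemma drest_negt K m (t : m.-tuple 'I_K.*2.+1) y :
  drest (negt t) y = - drest t y.
Proof. by rewrite /drest hpoly_negt derivN !hornerN; ring. Qed.

Lemma sum_negt K m (F : m.-tuple 'I_K.*2.+1 -> R) :
  \sum_t F (negt t) = \sum_t F t.
Proof. by rewrite [RHS](reindex_inj (inv_inj (@negtK K m))). Qed.

Lemma sum_hpoly0 K m y : \sum_(t : m.-tuple 'I_K.*2.+1) (hpoly R t).[y] = 0.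
Proof.
have := sum_negt (fun t : m.-tuple 'I_K.*2.+1 => (hpoly R t).[y]).
under eq_bigr do rewrite hpoly_negt hornerN.
by rewrite sumrN => /eqP; rewrite eq_sym -subr_eq0 opprK -mulr2n mulrn_eq0/= => /eqP.
Qed.

Lemma sum_dhpoly K m (F : R -> R) y :
  \sum_(t : m.+1.-tuple 'I_K.*2.+1) F (hpoly R t)^`().[y] =
  \sum_(t : m.-tuple 'I_K.*2.+1) \sum_(i < K.*2.+1) F (lc R i + drest t y).
Proof.
rewrite sum_tuple_cons exchange_big/=; apply: eq_bigr => t _; apply: eq_bigr => i _.
by rewrite horner_dhpoly_cons.
Qed.

(** Summing over the coefficient of ['X] first gives [abssum] at [r - s] and at [r], where
    [r = drest t y]. Pairing [t] with [negt t] replaces [r] by [- r] and cancels the terms linear in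
    [r]. The upper bound on [y] makes [|r|] at most [k / 4]. *)
Lemma monic_density K m k y s : k = K%:R + 2^-1 -> s = y^-1 ^+ 2 ->
  0 < y -> y <= (4 * m.+2%:R ^+ 2)^-1 ->
  `|\sum_(t : m.+1.-tuple 'I_K.*2.+1)
      (`|(hpoly R t)^`().[y] - s| - `|(hpoly R t)^`().[y]|)
    - (2 * k) ^+ m * (s ^+ 2 - ppos2 (s - k))|
  <= (1 + 4 * m.+2%:R ^+ 4) * k * (2 * k) ^+ m.
Proof.
move=> hk hs y0 yd.
have K0 : 0 <= K%:R :> R by [].
have k0 : 0 < k by rewrite hk; lra.
have n1 : 1 <= m.+2%:R ^+ 2 :> R by rewrite expr_ge1// ler1n.
have ny : m.+2%:R ^+ 2 * y <= 4^-1.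
  have -> : (4^-1 : R) = m.+2%:R ^+ 2 * (4 * m.+2%:R ^+ 2)^-1.
    by rewrite invfM mulrCA divff ?mulr1// gt_eqF// (lt_le_trans _ n1).
  by rewrite ler_wpM2l// (le_trans _ n1).
have y01 : 0 <= y <= 1 by apply/andP; split; nra.
rewrite (sum_dhpoly K m (fun z => `|z - s| - `|z|)).
under eq_bigr => t _.
  rewrite sumrB -/(abssum K (drest t y)).
  under eq_bigr do rewrite -addrA.
  rewrite -/(abssum K (drest t y - s)).
  over.
set X := fun t => abssum K (drest t y - s) - abssum K (drest t y).
have hcard : \sum_(t : m.-tuple 'I_K.*2.+1) 1 = (2 * k) ^+ m :> R.
  by rewrite sum_cst_tuple mul1r double_half hk.
pose B := 4 * m.+2%:R ^+ 4 * k.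
have B0 : 0 <= B by rewrite !mulr_ge0 ?exprn_ge0// ltW.
have pw t : `|X t + X (negt t) - 2 * (s ^+ 2 - ppos2 (s - k))| <= 2 * k + 2 * B.
  rewrite /X drest_negt; have s0 : 0 <= s by rewrite hs sqr_ge0.
  set r := drest t y.
  have rK : `|r| <= m.+2%:R ^+ 2 * K%:R * y by exact: drest_bound.
  have rk : `|r| <= (m.+2%:R ^+ 2 * y) * k.
    apply: le_trans rK _; rewrite mulrAC ler_wpM2l ?hk; [by []| |lra].
    by rewrite mulr_ge0 ?ltW// exprn_gt0.
  apply: abssum_pair => //.
    by apply: le_trans rk _; nra.
  (* If [k * y ^+ 2 <= 4], then [r] is [O(sqrt k)]. Otherwise [s] and [|r|] are both at most
     [k / 4]. *)
  have [yk|ky] := leP (k * y ^+ 2) 4; [right|left].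
    rewrite -real_normK ?num_real//.
    apply: (@le_trans _ _ ((m.+2%:R ^+ 2 * y * k) ^+ 2)).
      by rewrite lerXn2r// nnegrE ?(le_trans _ rk).
    have -> : (m.+2%:R ^+ 2 * y * k) ^+ 2 = m.+2%:R ^+ 4 * k * (k * y ^+ 2) by ring.
    have -> : B = m.+2%:R ^+ 4 * k * 4 by rewrite /B; ring.
    by rewrite ler_wpM2l// mulr_ge0 ?exprn_ge0// ltW.
  have sk : s <= k / 4.
    rewrite hs exprVn -[k / 4]invrK lef_pV2 ?posrE ?exprn_gt0 ?invr_gt0 ?divr_gt0//.
    by rewrite invf_div ler_pdivrMr// mulrC ltW.
  have : (m.+2%:R ^+ 2 * y) * k <= 4^-1 * k by rewrite ler_wpM2r// ltW.
  by lra.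
clearbody X.
have -> : \sum_(t : m.-tuple 'I_K.*2.+1) X t - (2 * k) ^+ m * (s ^+ 2 - ppos2 (s - k)) =
  2^-1 * \sum_(t : m.-tuple 'I_K.*2.+1) (X t + X (negt t) - 2 * (s ^+ 2 - ppos2 (s - k))).
  rewrite sumrB big_split/= (sum_negt X) sum_cst_tuple -[K.*2.+1%:R ^+ m]mul1r -sum_cst_tuple hcard.
  by field.
rewrite normrM gtr0_norm ?invr_gt0//.
apply: (@le_trans _ _ (2^-1 * ((2 * k + 2 * B) * (2 * k) ^+ m))).
  rewrite ler_wpM2l ?invr_ge0// (le_trans (ler_norm_sum _ _ _))//.
  apply: (@le_trans _ _ (\sum_(t : m.-tuple 'I_K.*2.+1) (2 * k + 2 * B))).
    by apply: ler_sum => t _; exact: pw.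
  by rewrite sum_cst_tuple double_half -hk.
by rewrite le_eqVlt (_ : _ == _)//; apply/eqP; rewrite /B; field.
Qed.

(** This serves below the cut [y_0], where only the count without leading monomial contributes an
    integral. There [r ^+ 2] is [O(k)], so each [abssum] is [k ^+ 2] up to [O(k)]. *)
Lemma base_density K m k y : k = K%:R + 2^-1 -> 0 <= y ->
  m.+2%:R ^+ 2 * y <= 4^-1 -> k * m.+2%:R ^+ 2 * y ^+ 2 <= 1 ->
  `|\sum_(t : m.+1.-tuple 'I_K.*2.+1) `|(hpoly R t)^`().[y]| - (2 * k) ^+ m * k ^+ 2|
  <= (1 + m.+2%:R ^+ 2) * k * (2 * k) ^+ m.
Proof.
move=> hk y0 ny ky.
have K0 : 0 <= K%:R :> R by [].
have k0 : 0 < k by rewrite hk; lra.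
have n1 : 1 <= m.+2%:R ^+ 2 :> R by rewrite expr_ge1// ler1n.
have y01 : 0 <= y <= 1 by apply/andP; split; nra.
rewrite (sum_dhpoly K m (fun z => `|z|)).
have hcst c : \sum_(t : m.-tuple 'I_K.*2.+1) c = (2 * k) ^+ m * c.
  by rewrite sum_cst_tuple double_half hk mulrC.
rewrite -hcst -sumrB (le_trans (ler_norm_sum _ _ _))// [leRHS]mulrC -hcst.
apply: ler_sum => t _; rewrite -/(abssum K (drest t y)).
set r := drest t y.
have rK : `|r| <= m.+2%:R ^+ 2 * K%:R * y by exact: drest_bound.
have rk : `|r| <= (m.+2%:R ^+ 2 * y) * k.
  apply: le_trans rK _; rewrite mulrAC ler_wpM2l ?hk; [by []| |lra].
  by rewrite mulr_ge0 // exprn_ge0.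
have rk1 : `|r| <= k by apply: le_trans rk _; nra.
have /andP[rk2 rk3] : - k <= r <= k by rewrite -ler_norml.
have r2 : r ^+ 2 <= m.+2%:R ^+ 2 * k.
  rewrite -real_normK ?num_real//.
  apply: (@le_trans _ _ ((m.+2%:R ^+ 2 * y * k) ^+ 2)).
    by rewrite lerXn2r// nnegrE ?(le_trans _ rk).
  have -> : (m.+2%:R ^+ 2 * y * k) ^+ 2 = m.+2%:R ^+ 2 * k * (k * m.+2%:R ^+ 2 * y ^+ 2) by ring.
  by rewrite ler_piMr// mulr_ge0 ?exprn_ge0// ltW.
have := abssum_approx r hk.
have -> : ppos2 (r - k) = 0 by apply: ppos2_le0; lra.
have -> : ppos2 (- r - k) = 0 by apply: ppos2_le0; lra.
have := sqr_ge0 r; rewrite !ler_norml; move: r2; rewrite mulrDl mul1r.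
move: (r ^+ 2) (k ^+ 2) (m.+2%:R ^+ 2 * k) (abssum _ _) => *; lra.
Qed.

End LargeRootDensity.

(** * Large roots for one choice of the coefficients other than [b_0] *)

Section LargeRootCount.
Context (R : realType).
Implicit Types (a b u v w x y z r s k d : R).

Lemma is_derive_invr y : y != 0 -> is_derive y 1 (fun x => x^-1) (- (y^-1 ^+ 2)).
Proof.
move=> y0; apply: is_derive_eq; first by apply: is_deriveV.
by rewrite /GRing.scale/= mulr1 exprVn.
Qed.

Lemma continuous_inv y : y != 0 -> {for y, continuous (fun x : R => x^-1)}.
Proof. by move=> y0; apply: cvgV => //; exact: cvg_id. Qed.

Lemma continuous_invX y j : y != 0 -> {for y, continuous (fun x : R => x^-1 ^+ j)}.
Proof.
move=> y0; apply: (@continuous_comp _ _ _ (fun x : R => x^-1) (fun x => x ^+ j)).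
  exact: continuous_inv.
exact: exprn_continuous.
Qed.

(* the integral behind the term 4 / (3 sqrt Q) *)
Lemma Int_excess (n : nat) k s d : (0 < n)%N -> 0 < s -> k = s ^+ 2 -> s^-1 <= d ->
  Int (fun y => (y^-1 ^+ 2) ^+ 2 - ppos2 (y^-1 ^+ 2 - k)) (n%:R * s)^-1 d
  = 2 * k * (n%:R * s) + k ^+ 2 * (n%:R * s)^-1 - 8 / 3 * (k * s) - d^-1 ^+ 3 / 3.
Proof.
move=> n0 s0 hk sd.
have n1 : 1 <= n%:R :> R by rewrite ler1n.
have ns : 0 < n%:R * s by rewrite mulr_gt0 ?ltr0n.
set y0 := (n%:R * s)^-1; have y00 : 0 < y0 by rewrite invr_gt0.
have sV : 0 < s^-1 by rewrite invr_gt0.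
have y0s : y0 <= s^-1 by rewrite lef_pV2 ?posrE//; nra.
have neq y : y0 <= y -> y != 0 by move=> yy; rewrite gt_eqF// (lt_le_trans y00).
have neqs y : s^-1 <= y -> y != 0 by move=> yy; rewrite gt_eqF// (lt_le_trans sV).
set F := fun y => _.
have cppos : continuous (@ppos2 R).
  move=> x; apply: (@continuous_comp _ _ _ (fun w : R => Num.max w 0) (fun x => x ^+ 2)).
    by apply: continuous_max; [exact: cvg_id|exact: cvg_cst].
  exact: exprn_continuous.
have itF : itg F y0 d.
  apply: itg_cont => y /andP[yy _]; have yn := neq _ yy.
  apply: continuousB.
    apply: (@continuous_comp _ _ _ (fun x : R => x^-1 ^+ 2) (fun x => x ^+ 2)).
      exact: continuous_invX.
    exact: exprn_continuous.
  apply: (@continuous_comp _ _ _ (fun x : R => x^-1 ^+ 2 - k) (@ppos2 R)); last exact: cppos.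
  by apply: continuousB; [exact: continuous_invX|exact: cvg_cst].
(* At [y = s^-1] the inverse square equals [k]: below, the correction is active and cancels the
   fourth power; above, it vanishes. *)
rewrite (Int_split y0s sd itF).
have -> : Int F y0 s^-1 = Int (fun y => 2 * k * y^-1 ^+ 2 - k ^+ 2) y0 s^-1.
  apply: Int_eq; first exact: itgS itF.
  move=> y /andP[yy ys]; rewrite /F.
  have y1 : 0 < y by rewrite (lt_trans y00).
  have sy : s <= y^-1 by rewrite -[s]invrK lef_pV2 ?posrE ?invr_gt0// ltW.
  rewrite ppos2_ge0; first by ring.
  by rewrite hk subr_ge0 lerXn2r// nnegrE ltW// (lt_le_trans s0).
have -> : Int F s^-1 d = Int (fun y => (y^-1 ^+ 2) ^+ 2) s^-1 d.
  apply: Int_eq; first exact: itgS itF.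
  move=> y /andP[ys yd]; rewrite /F.
  have y1 : 0 < y by rewrite (lt_trans sV).
  have sy : y^-1 <= s by rewrite -[s]invrK lef_pV2 ?posrE ?invr_gt0// ltW.
  rewrite ppos2_le0 ?subr0// hk subr_le0 lerXn2r// nnegrE ltW// invr_gt0//.
have D1 y : y0 <= y <= s^-1 -> is_derive y 1 (fun y => - (2 * k) * y^-1 - k ^+ 2 * y)
    (2 * k * y^-1 ^+ 2 - k ^+ 2).
  move=> /andP[yy _]; have yn := neq _ yy; have := is_derive_invr yn => H.
  apply: is_derive_eq; rewrite /GRing.scale/=; ring.
have D2 y : s^-1 <= y <= d -> is_derive y 1 (fun y => - 3^-1 * (y^-1 ^+ 3))
    ((y^-1 ^+ 2) ^+ 2).
  move=> /andP[yy _]; have yn := neqs _ yy; have := is_derive_invr yn => H.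
  apply: is_derive_eq; rewrite /GRing.scale/=; by field.
rewrite (Int_FTC y0s D1); last first.
  move=> y /andP[yy _]; apply: continuousB; last exact: cvg_cst.
  by apply: continuousM; [exact: cvg_cst|apply: continuous_invX; exact: neq].
rewrite (Int_FTC sd D2); last first.
  move=> y /andP[yy _].
  apply: (@continuous_comp _ _ _ (fun x : R => x^-1 ^+ 2) (fun x => x ^+ 2)).
    by apply: continuous_invX; exact: neqs.
  exact: exprn_continuous.
rewrite !invrK -/y0 hk.
have s3 : s ^+ 4 * s^-1 = s ^+ 3 by rewrite exprSr mulfK// gt_eqF.
have -> : (s ^+ 2) ^+ 2 = s ^+ 4 by ring.
have -> : n%:R * s = y0^-1 by rewrite /y0 invrK.
have sn : s != 0 by rewrite gt_eqF.
have yn : y0 != 0 by rewrite gt_eqF.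
have dn : d != 0 by rewrite gt_eqF// (lt_le_trans sV).
by rewrite s3; field; rewrite yn dn.
Qed.

Lemma clamp_id k x : `|x| <= k -> clamp k x = x.
Proof. by rewrite ler_norml => /andP[h1 h2]; rewrite /clamp max_l// min_l. Qed.

Lemma clamp_ge k x : 0 <= k -> k <= x -> clamp k x = k.
Proof. by move=> k0 kx; rewrite /clamp max_l ?min_r//; lra. Qed.

Lemma dhpoly_bound1 K m (t : m.-tuple 'I_K.*2.+1) y : 0 <= y <= 1 ->
  `|(hpoly R t)^`().[y]| <= m%:R ^+ 2 * K%:R.
Proof.
move=> /andP[y0 y1]; rewrite horner_deriv_hpoly.
apply: (le_trans (ler_norm_sum _ _ _)).
apply: (@le_trans _ _ (\sum_(j < m) K%:R * m%:R)).
  apply: ler_sum => j _; rewrite normrM ler_pM ?lc_bound//.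
  rewrite normrM normr_nat ger0_norm ?exprn_ge0// -[leRHS]mulr1 ler_pM ?exprn_ge0 ?exprn_ile1//.
  by rewrite ler_nat.
by rewrite sumr_const card_ord -[_ *+ m]mulr_natl mulrCA mulrC expr2.
Qed.

(** The reversal of a monic polynomial of degree [m]. For [y != 0] it is [y] times
    [1/y + b_0 + h(y)], so [b_0] acts again as a translation. *)
Definition qpoly K m (t : m.-tuple 'I_K.*2.+1) : {poly R} := 1 + 'X * lpoly R t.

(** Between the inverses of [3 K] and of [m.+2 * s] the pole makes [f = 1/y + h] decrease from above
    [K] to its value at the cut, which accounts for [K - f(y_0)] levels. Beyond the cut [f] stays in
    the band, the clamp is inactive, and the integral of [|f'|] remains. *)
Lemma large_count K m (t : m.+1.-tuple 'I_K.*2.+1) k s : k = K%:R + 2^-1 ->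
  0 < s -> k = s ^+ 2 -> 16 * m.+2%:R ^+ 2 < k ->
  `|\sum_(i < K.*2.+1) (nroots (qpoly (cons_tuple i t)) (3 * K%:R)^-1 (4 * m.+2%:R ^+ 2)^-1)%:R
   - (K%:R - m.+2%:R * s - (hpoly R t).[(m.+2%:R * s)^-1]
      + Int (fun y => `|(hpoly R t)^`().[y] - y^-1 ^+ 2|) (m.+2%:R * s)^-1 (4 * m.+2%:R ^+ 2)^-1)|
  <= 2 * m.+3%:R + 3.
Proof.
move=> hk s0 ks kn.
have K0 : 0 <= K%:R :> R by [].
set n : R := m.+2%:R in kn *.
have n2 : 2 <= n by rewrite /n ler_nat.
have nm : m.+1%:R = n - 1 :> R by rewrite /n -[m.+2%:R]natr1 addrK.
have s4 : 4 * n < s.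
  rewrite -(ltr_pXn2r (_ : 0 < 2)%N) ?nnegrE ?ltW//; last by lra.
  by rewrite exprMn -ks; apply: le_lt_trans kn; rewrite ler_wpM2r ?sqr_ge0//; lra.
have ns : n * s < k / 4 by rewrite ks expr2; nra.
have K16 : 16 * n <= K%:R by rewrite -(lerD2r 2^-1) -hk; nra.
have ns0 : 0 < n * s by nra.
have n40 : 0 < 4 * n ^+ 2 by nra.
have K30 : 0 < 3 * K%:R :> R by nra.
set y0 := (n * s)^-1; set d := (4 * n ^+ 2)^-1; set e := (3 * K%:R)^-1.
have e0 : 0 < e by rewrite invr_gt0.
have ey : e < y0 by rewrite ltf_pV2 ?posrE//; lra.
have yd : y0 < d by rewrite ltf_pV2 ?posrE//; rewrite expr2; nra.
have y00 : 0 < y0 by rewrite (lt_trans e0).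
have d1 : d <= 1 by rewrite invf_le1//; nra.
have nd : n * d <= 8^-1.
  have -> : n * d = (4 * n)^-1 by rewrite /d; field; rewrite gt_eqF//; lra.
  by rewrite lef_pV2 ?posrE//; lra.
have neq y : e <= y -> y != 0 by move=> yy; rewrite gt_eqF// (lt_le_trans e0).
pose h := hpoly R t; pose f y := y^-1 + h.[y]; pose g y := h^`().[y] - y^-1 ^+ 2.
pose q i : {poly R} := qpoly (cons_tuple i t).
have hb y : 0 <= y <= d -> `|h.[y]| <= K%:R / 8.
  move=> /andP[yy yd']; have y1 : 0 <= y <= 1 by apply/andP; split=> //; lra.
  apply: (le_trans (hpoly_bound t y1)); rewrite nm.
  have nyd : (n - 1) * y <= 8^-1 by apply: le_trans nd; nra.
  by rewrite mulrAC mulrC ler_wpM2l.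
have df y : e <= y -> is_derive y 1 f (g y).
  move=> ey'; have yn := neq _ ey'; have H := is_derive_invr yn.
  have H2 := is_derive_horner h y.
  by apply: is_derive_eq; rewrite /g addrC.
have cg y : e <= y -> {for y, continuous g}.
  move=> ey'; apply: continuousB; first exact: continuous_horner.
  exact/continuous_invX/neq.
have q0 i : q i != 0.
  apply/eqP => /(congr1 (horner^~ 0)); rewrite /q /qpoly hornerD hornerM hornerX mul0r addr0.
  by rewrite hornerC horner0 => /eqP; rewrite oner_eq0.
have qf i y : e <= y -> root (q i) y = (f y == K%:R - i%:R).
  move=> ey'; have yn := neq _ ey'.
  rewrite rootE /q /qpoly lpoly_cons !(hornerD, hornerM, hornerX, hornerC) /f /lc -/h.
  have -> : 1 + y * (i%:R - K%:R + h.[y]) = y * (y^-1 + h.[y] - (K%:R - i%:R)).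
    by field.
  by rewrite mulf_eq0 (negbTE yn) subr_eq0.
have P1 := @piece_count R f g K q q0 e y0 ey.
have {P1} : `|\sum_i (nroots (q i) e y0)%:R - (K%:R - f y0)| <= 1.
  have -> : K%:R - f y0 = `|clamp K%:R (f y0) - clamp K%:R (f e)|.
    have hy0 : `|h.[y0]| <= K%:R / 8 by apply: hb; rewrite !ltW.
    have he : `|h.[e]| <= K%:R / 8 by apply: hb; rewrite !ltW// (lt_trans ey).
    move: hy0 he; rewrite !ler_norml => /andP[hy1 hy2] /andP[he1 he2].
    rewrite (clamp_ge (x := f e))//; last by rewrite /f /e invrK; lra.
    have fy : - K%:R <= f y0 <= K%:R.
      by rewrite /f /y0 invrK; clear -hy1 hy2 ns hk ns0 K16 n2; lra.
    by rewrite clamp_id ?ler_norml// ler0_norm; clear -fy; lra.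
  apply: P1.
  - by move=> y /andP[? _]; exact: df.
  - by move=> y /andP[? _]; exact: cg.
  (* Below the cut the pole wins: [1/y^2 > n^2 k], while [h'] is at most [(n - 1)^2 K]. *)
  - move=> y /andP[ey' yy0]; rewrite lt_eqF// /g subr_lt0.
    have y1 : 0 <= y <= 1 by clear -ey' yy0 e0 yd d1; apply/andP; split; lra.
    apply: le_lt_trans (le_trans (ler_norm _) (dhpoly_bound1 t y1)) _.
    rewrite nm; apply: (@lt_trans _ _ ((n * s) ^+ 2)).
      by rewrite exprMn -ks; nra.
    rewrite ltrXn2r// ?nnegrE ?invr_ge0 ?ltW//; try lra.
    by rewrite -[n * s]invrK ltf_pV2 ?posrE ?invr_gt0//; lra.
  - by move=> i y /andP[? _]; apply: qf; exact: ltW.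
(* Multiplying [g] by [y ^+ 2] clears the pole and gives a polynomial carrying the critical points;
   it is nonzero because its constant term is [-1]. *)
pose dd : {poly R} := 'X ^+ 2 * h^`() - 1.
have dd0 : dd != 0.
  apply/eqP => /(congr1 (horner^~ 0)); rewrite /dd hornerD hornerN hornerM hornerXn expr0n mul0r add0r.
  by rewrite hornerC horner0 => /eqP; rewrite oppr_eq0 oner_eq0.
have sdd : (size dd <= m.+3)%N.
  rewrite (leq_trans (size_polyD _ _))// geq_max size_polyN size_poly1 andbT.
  have := size_hpoly R t; rewrite -/h => sh.
  have sd : (size h^`() <= m.+1)%N by rewrite size_deriv -subn1 leq_subLR.
  by rewrite mulrC (leq_trans (size_polyMleq _ _))// size_polyXn addn3 /= ltnS ltnS.
have C1 := @coarea_poly R f g K q dd y0 d yd dd0 q0.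
have {C1} : `|\sum_i (nroots (q i) y0 d)%:R - Int (fun y => `|g y|) y0 d| <= 2 * m.+3%:R + 1.
  have -> : Int (fun y => `|g y|) y0 d = Int (vden f g K%:R) y0 d.
    apply/esym/Int_eq.
      apply: itg_vden => y /andP[yy yyd]; last exact: cg (le_trans (ltW ey) yy).
      have edf z : e <= z <= d -> is_derive z 1 f (g z) by move=> /andP[? _]; exact: df.
      by apply: (derive_cont edf); apply/andP; split=> //; exact: le_trans (ltW ey) yy.
    move=> y /andP[yy yyd]; rewrite /vden (_ : `|f y| <= K%:R) ?mulr1//.
    have := hb y; rewrite ler_norml => H.
    have /H /andP[h1 h2] : 0 <= y <= d by rewrite !ltW// (lt_trans y00).
    have yp : 0 < y by exact: lt_trans yy.
    have yv : y^-1 <= n * s by rewrite -[n * s]invrK -/y0 lef_pV2 ?posrE// ltW.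
    have yv0 : 0 < y^-1 by rewrite invr_gt0.
    by rewrite ler_norml /f; clear -h1 h2 yv yv0 ns hk K16 n2; lra.
  apply: le_trans (C1 _ _ _ _) _.
  - by move=> y /andP[yy _]; exact: df (le_trans (ltW ey) yy).
  - by move=> y /andP[yy _]; exact: cg (le_trans (ltW ey) yy).
  - move=> y /andP[yy _] gy; rewrite rootE /dd hornerD hornerN hornerM hornerXn hornerC.
    have yn : y != 0 by exact: neq (ltW (lt_trans ey yy)).
    move/eqP: gy; rewrite subr_eq0 => /eqP ->.
    by rewrite -exprMn divff// expr1n subrr.
  - by move=> i y /andP[yy _]; exact: qf (ltW (lt_trans ey yy)).
  - by rewrite lerD2r ler_wpM2l// ler_nat.
have H3 : 0 <= (\sum_i (root (q i) y0)%:R : R) <= 1.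
  under eq_bigr do rewrite qf ?ltW//.
  rewrite sumr_ge0//=.
  case: (pickP (fun i : 'I_K.*2.+1 => f y0 == K%:R - i%:R)) => [i0 /eqP fi0|fN].
    rewrite (bigD1 i0)//= fi0 eqxx big1 ?addr0// => i ii0.
    rewrite (_ : _ == _ = false)//; apply/negbTE.
    by rewrite (inj_eq (addrI _)) eqr_opp eqr_nat eq_sym.
  by rewrite big1// => i _; rewrite fN.
have -> : \sum_(i < K.*2.+1) (nroots (qpoly (cons_tuple i t)) e d)%:R =
    \sum_i (nroots (q i) e y0)%:R + \sum_i (root (q i) y0)%:R + \sum_i (nroots (q i) y0 d)%:R :> R.
  rewrite -!big_split/=; apply: eq_bigr => i _.
  by rewrite -/(q i) (nroots_split (q0 i) ey yd) !natrD.
have fy0 : f y0 = n * s + h.[y0] by rewrite /f /y0 invrK.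
move: H3; rewrite fy0 -/h; move: (Int _ _ _) (\sum_i _) (\sum_i _) (\sum_i _) => I S1 S2 S3; clear.
by rewrite !ler_norml; lra.
Qed.

End LargeRootCount.

(** * Large roots of all monic polynomials *)

Section LargeRootTotal.
Context (R : realType).
Implicit Types (a b u v w x y z r s k d : R).

Lemma nroots_monic_rev K n (t : n.-tuple 'I_K.*2.+1) a b : 0 < a -> 0 < b ->
  nroots ('X^n + lpoly R (rev_tuple t)) a b = nroots (qpoly R t) b^-1 a^-1.
Proof.
move=> a0 b0.
have mon0 : 'X^n + lpoly R (rev_tuple t) != 0.
  apply/eqP => /(congr1 (fun p : {poly R} => p`_n)).
  rewrite coef0 coefD coefXn eqxx coef_sum big1 ?addr0 => [/eqP|i _].
    by rewrite oner_eq0.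
  by rewrite coefZ coefXn gtn_eqF ?mulr0// ltn_ord.
have q0 : qpoly R t != 0.
  apply/eqP => /(congr1 (horner^~ 0)); rewrite /qpoly hornerD hornerM hornerX mul0r addr0.
  by rewrite hornerC horner0 => /eqP; rewrite oner_eq0.
apply: (nroots_bij (@invrK R)) => //.
- move=> x /andP[ax xb]; have x0 : 0 < x by apply: lt_trans ax.
  by rewrite !ltf_pV2 ?posrE// xb ax.
- move=> x /andP[ax xb]; have x0 : 0 < x by apply: lt_trans ax; rewrite invr_gt0.
  by rewrite -[a]invrK -[b]invrK !ltf_pV2 ?posrE ?invr_gt0// xb ax.
- move=> x /andP[ax _]; have x0 : x != 0 by rewrite gt_eqF// (lt_trans a0).
  suff E : ('X^n + lpoly R (rev_tuple t)).[x] = x ^+ n * (qpoly R t).[x^-1].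
    by rewrite !rootE E mulf_eq0 expf_eq0 (negbTE x0) andbF.
  rewrite /qpoly !(hornerD, hornerM, hornerX, hornerC, hornerXn) !horner_lpoly.
  rewrite mulrDr mulr1; congr (_ + _).
  case: n t {mon0 q0} => [|n] t; first by rewrite !big_ord0 !mulr0.
  rewrite (reindex_inj rev_ord_inj)/= mulrA mulr_sumr; apply: eq_bigr => i _.
  have -> : tnth (rev_tuple t) (rev_ord i) = tnth t i.
    rewrite !(tnth_nth ord0)/= nth_rev ?size_tuple ?subSS ?ltnS ?leq_subr//.
    by rewrite subnBA ?addKn// -ltnS.
  rewrite exprSr mulfK// subSS [RHS]mulrCA; congr (_ * _).
  have key j : (j <= n)%N -> x ^+ (n - j) = x ^+ n * x^-1 ^+ j.
    move=> jn; rewrite -{2}(subnK jn) exprD -mulrA -exprMn mulfV// expr1n mulr1//.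
  by rewrite key// -ltnS.
Qed.

Lemma Mcount_rev K n a b : 0 < a -> 0 < b ->
  Mcount K n a b = \sum_(t : n.-tuple 'I_K.*2.+1) (nroots (qpoly R t) b^-1 a^-1)%:R.
Proof.
move=> a0 b0.
have revI : involutive (@rev_tuple n 'I_K.*2.+1) by move=> t; apply: val_inj; exact: revK.
rewrite /Mcount (reindex_inj (inv_inj revI))/=.
by apply: eq_bigr => t _; rewrite nroots_monic_rev.
Qed.

(** In the reversed variable the monic count is compared with the count on [(0, d)] without the term
    [1/y], which later yields the integral of [phi]. The excess comes from the first stretch near
    the pole and from [Int_excess]. *)
Lemma Mcount_large m : exists C, forall K k s, k = K%:R + 2^-1 -> 0 < s -> k = s ^+ 2 ->
  4 * m.+2%:R ^+ 2 < s ->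
  `|Mcount K m.+2 (4 * m.+2%:R ^+ 2) (3 * K%:R) - Tcount K m.+2 0 (4 * m.+2%:R ^+ 2)^-1
   - (2 * k) ^+ m.+1 * (k - 4 / 3 * s)| <= C * (2 * k) ^+ m.+1.
Proof.
set n : R := m.+2%:R; set d := (4 * n ^+ 2)^-1.
pose C1 : R := 2 * m.+3%:R + 3; pose C2 : R := 2 * m.+2%:R + 1.
pose D1 : R := 1 + 4 * n ^+ 4; pose D2 : R := 1 + n ^+ 2.
exists (C1 + C2 + 2^-1 + D1 + D2 + d^-1 ^+ 3 / 3) => K k s hk s0 ks sn.
have K0 : 0 <= K%:R :> R by [].
have n2 : 2 <= n by rewrite /n ler_nat.
have s4 : 4 * n < s by rewrite -/n in sn; nra.
have kn : 16 * n ^+ 2 < k by nra.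
have k1 : 1 <= k by nra.
have n40 : 0 < 4 * n ^+ 2 by nra.
have K30 : 0 < 3 * K%:R :> R by rewrite hk in kn; nra.
have ns0 : 0 < n * s by nra.
pose y0 := (n * s)^-1; have y00 : 0 < y0 by rewrite invr_gt0.
have d0 : 0 < d by rewrite invr_gt0.
have y0d : y0 < d by rewrite ltf_pV2 ?posrE//; rewrite expr2; nra.
have d1 : d <= 1 by rewrite invf_le1//; nra.
have n2d : n ^+ 2 * d = 4^-1 by rewrite /d; field; rewrite gt_eqF//; lra.
rewrite Mcount_rev//.
pose h (t : m.+1.-tuple 'I_K.*2.+1) := hpoly R t.
pose P := \sum_(t : m.+1.-tuple 'I_K.*2.+1) (K%:R - n * s - (h t).[y0]
  + Int (fun y => `|(h t)^`().[y] - y^-1 ^+ 2|) y0 d).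
have H1 : `|\sum_(t : m.+2.-tuple 'I_K.*2.+1) (nroots (qpoly R t) (3 * K%:R)^-1 d)%:R - P|
    <= C1 * (2 * k) ^+ m.+1.
  rewrite sum_tuple_cons exchange_big/= /P -sumrB hk -double_half -sum_cst_tuple.
  apply: (le_trans (ler_norm_sum _ _ _)); apply: ler_sum => t _.
  exact: large_count hk s0 ks kn.
pose T := \sum_(t : m.+1.-tuple 'I_K.*2.+1) Int (fun y => `|(h t)^`().[y]|) 0 d.
have cdh t y : {for y, continuous (fun y => `|(h t)^`().[y]|)}.
  by apply: continuous_comp; [exact: continuous_horner|exact: norm_continuous].
(* On [(0, d)] the values of [h] stay in [[-K, K]], so the clamp is inactive here too. *)
have H2 : `|Tcount K m.+2 0 d - T| <= C2 * (2 * k) ^+ m.+1.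
  have := Tcount_coarea K m.+1 d0; rewrite double_half -hk.
  rewrite (_ : \sum_t _ = T)//; apply: eq_bigr => t _; apply: Int_eq.
    exact: itg_vden_poly.
  move=> y /andP[yy yd]; rewrite /vden (_ : `|_| <= K%:R) ?mulr1//.
  have y1 : 0 <= y <= 1 by clear -yy yd d1; apply/andP; split; lra.
  apply: (le_trans (hpoly_bound t y1)); rewrite mulrAC ler_piMl//.
  have : m.+1%:R <= n :> R by rewrite /n ler_nat.
  have m0 : 0 <= m.+1%:R :> R by [].
  by move: (m.+1%:R : R) m0 => M; nra.
have cg t y : y0 <= y -> {for y, continuous (fun y => `|(h t)^`().[y] - y^-1 ^+ 2|)}.
  move=> yy; apply: continuous_comp; last exact: norm_continuous.
  apply: continuousB; first exact: continuous_horner.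
  by apply: continuous_invX; rewrite gt_eqF// (lt_le_trans y00).
have itA t : itg (fun y => `|(h t)^`().[y] - y^-1 ^+ 2|) y0 d.
  by apply: itg_cont => y /andP[yy _]; exact: cg.
have itB a b t : itg (fun y => `|(h t)^`().[y]|) a b by apply: itg_cont => y _; exact: cdh.
pose D y := \sum_(t : m.+1.-tuple 'I_K.*2.+1)
  (`|(h t)^`().[y] - y^-1 ^+ 2| - `|(h t)^`().[y]|).
pose E y := \sum_(t : m.+1.-tuple 'I_K.*2.+1) `|(h t)^`().[y]|.
(* The values [(h t).[y0]] sum to 0 over all [t], since negating the coefficients changes their
   sign. *)
have PT : P - T = (2 * k) ^+ m.+1 * (K%:R - n * s) + Int D y0 d - Int E 0 y0.
  rewrite /P /T /D /E !Int_sum; do ?by [move=> t; exact: itB|move=> t; apply: itgB; [exact: itA|exact: itB]].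
  rewrite -sumrB.
  have -> : (2 * k) ^+ m.+1 * (K%:R - n * s) =
      \sum_(t : m.+1.-tuple 'I_K.*2.+1) (K%:R - n * s - (h t).[y0]).
    by rewrite sumrB sum_hpoly0 subr0 sum_cst_tuple double_half -hk mulrC.
  rewrite -big_split/= -sumrB; apply: eq_bigr => t _.
  rewrite IntB; [|exact: itA|exact: itB].
  rewrite (Int_split (ltW y00) (ltW y0d) (itB 0 d t)); ring.
pose F y := (y^-1 ^+ 2) ^+ 2 - ppos2 (y^-1 ^+ 2 - k).
have sd : s^-1 <= d by rewrite lef_pV2 ?posrE// ltW.
have cppos : continuous (@ppos2 R).
  move=> x; apply: (@continuous_comp _ _ _ (fun w : R => Num.max w 0) (fun x => x ^+ 2)).
    by apply: continuous_max; [exact: cvg_id|exact: cvg_cst].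
  exact: exprn_continuous.
have itF : itg F y0 d.
  apply: itg_cont => y /andP[yy _].
  have yn : y != 0 by rewrite gt_eqF// (lt_le_trans y00).
  apply: continuousB.
    apply: (@continuous_comp _ _ _ (fun x : R => x^-1 ^+ 2) (fun x => x ^+ 2)).
      exact: continuous_invX.
    exact: exprn_continuous.
  apply: (@continuous_comp _ _ _ (fun x : R => x^-1 ^+ 2 - k) (@ppos2 R)); last exact: cppos.
  by apply: continuousB; [exact: continuous_invX|exact: cvg_cst].
have itD : itg D y0 d.
  by apply: itg_sum => t; apply: itgB; [exact: itA|exact: itB].
have itE : itg E 0 y0 by apply: itg_sum => t; exact: itB.
have k20 : 0 <= (2 * k) ^+ m by rewrite exprn_ge0//; clear -k1; lra.
have HD : `|Int D y0 d - (2 * k) ^+ m * Int F y0 d| <= D1 * k * (2 * k) ^+ m * (d - y0).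
  rewrite -IntZ// -IntB//; last exact: IntN_scale.
  apply: Int_bound; [exact: ltW|apply: itgB => //; exact: IntN_scale|].
  move=> y /andP[yy yd]; apply: monic_density => //.
  exact: lt_le_trans yy.
have HE : `|Int E 0 y0 - (2 * k) ^+ m * (k ^+ 2 * y0)| <= D2 * k * (2 * k) ^+ m * (y0 - 0).
  have -> : (2 * k) ^+ m * (k ^+ 2 * y0) = Int (fun=> (2 * k) ^+ m * k ^+ 2) 0 y0.
    by rewrite Int_cst ?ltW// subr0 mulrA.
  rewrite -IntB//; last exact: itg_cst.
  apply: Int_bound; [exact: ltW|apply: itgB => //; exact: itg_cst|].
  move=> y /andP[yy yy0]; apply: base_density => //.
    by rewrite -n2d ler_wpM2l ?sqr_ge0//; clear -yy0 y0d; lra.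
  have : y ^+ 2 <= y0 ^+ 2 by rewrite lerXn2r// nnegrE// ltW.
  have -> : y0 ^+ 2 = (k * n ^+ 2)^-1 by rewrite /y0 ks exprVn exprMn mulrC.
  move=> yy2; have kn0 : 0 < k * n ^+ 2 by rewrite mulr_gt0 ?exprn_gt0//; clear -k1; lra.
  by rewrite mulrC -ler_pdivlMr// mul1r.
have HF := @Int_excess R m.+2 k s d isT s0 ks sd.
rewrite -/n -/y0 -/F in HF.
have k2S : (2 * k) ^+ m.+1 = 2 * k * (2 * k) ^+ m by rewrite exprS.
rewrite -/d; set U := \sum_t _ in H1 *; set Tc := Tcount _ _ _ _ in H2 *.
rewrite HF in HD.
set Y := (2 * k) ^+ m in k20 k2S HD HE *.
have nsy : n * s * y0 = 1 by rewrite /y0 mulfV// gt_eqF.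
have Kk : K%:R = k - 2^-1 by rewrite hk addrK.
(* The terms [2 k n s] and [k^2 y0] from [Int_excess] cancel against the stretch near the pole and
   against the integral of [E]. Replacing [K] by [k - 1/2] leaves [Y * k]. *)
have main : U - Tc - (2 * k) ^+ m.+1 * (k - 4 / 3 * s) =
   (U - P) - (Tc - T) + (Int D y0 d - Y * (2 * k * (n * s) + k ^+ 2 * y0 - 8 / 3 * (k * s) - d^-1 ^+ 3 / 3))
   - (Int E 0 y0 - Y * (k ^+ 2 * y0)) - Y * k - Y * (d^-1 ^+ 3 / 3).
  have -> : U - Tc = (U - P) - (Tc - T) + (P - T) by ring.
  rewrite PT k2S Kk; clear; clearbody n d y0 Y.
  by move: (Int D _ _) (Int E _ _) (U - P) (Tc - T) (d^-1) => iD iE e1 e2 e; field.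
rewrite main k2S.
have k0 : 0 <= k by exact: le_trans ler01 k1.
have Yk : 0 <= Y * k by rewrite mulr_ge0.
have e3 : 0 <= d^-1 ^+ 3 / 3 by rewrite divr_ge0// exprn_ge0// invr_ge0 ltW.
have D10 : 0 <= D1 by rewrite addr_ge0// mulr_ge0// exprn_ge0//; lra.
have D20 : 0 <= D2 by rewrite addr_ge0// exprn_ge0//; lra.
have b1 : D1 * k * Y * (d - y0) <= D1 * (Y * k) by
  rewrite [leRHS](_ : _ = D1 * k * Y * 1); [apply: ler_wpM2l; [rewrite -mulrA mulr_ge0// mulrC|clear -d1 y00; lra]|clear; ring].
have b2 : D2 * k * Y * (y0 - 0) <= D2 * (Y * k) by
  rewrite [leRHS](_ : _ = D2 * k * Y * 1); [apply: ler_wpM2l; [rewrite -mulrA mulr_ge0// mulrC|clear -d1 y0d; lra]|clear; ring].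
have b3 : Y * (d^-1 ^+ 3 / 3) <= d^-1 ^+ 3 / 3 * (Y * k).
  by rewrite mulrC ler_wpM2l// ler_peMr.
have -> : (C1 + C2 + 2^-1 + D1 + D2 + d^-1 ^+ 3 / 3) * (2 * k * Y) =
  C1 * (2 * k * Y) + C2 * (2 * k * Y) + Y * k + 2 * (D1 * (Y * k)) + 2 * (D2 * (Y * k))
  + 2 * (d^-1 ^+ 3 / 3 * (Y * k)).
  by clear; clearbody C1 C2 D1 D2 n d Y; move: (d^-1) => e; field.
have p1 : 0 <= D1 * (Y * k) by rewrite mulr_ge0.
have p2 : 0 <= D2 * (Y * k) by rewrite mulr_ge0.
have p3 : 0 <= d^-1 ^+ 3 / 3 * (Y * k) by rewrite mulr_ge0.
have p4 : 0 <= Y * (d^-1 ^+ 3 / 3) by rewrite mulr_ge0.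
rewrite k2S in H1 H2.
move: H1 H2 HD HE b1 b2 b3 p1 p2 p3 p4 Yk; rewrite !ler_norml.
move: (U - P) (Tc - T) (Int D y0 d - _) (Int E 0 y0 - _) (C1 * _) (C2 * _) (D1 * (Y * k))
 (D2 * (Y * k)) (d^-1 ^+ 3 / 3 * (Y * k)) (Y * (d^-1 ^+ 3 / 3)) (Y * k)
 (D1 * k * Y * (d - y0)) (D2 * k * Y * (y0 - 0)) => *.
lra.
Qed.

End LargeRootTotal.

(** * Reducible polynomials and algebraic integers *)

Section FactorHeight.

Lemma coefXsubM (F : comNzRingType) (a : F) (g : {poly F}) i :
  (('X - a%:P) * g)`_i = (if i is j.+1 then g`_j else 0) - a * g`_i.
Proof. by rewrite mulrBl coefB coefXM coefCM; case: i. Qed.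

(** The maximum of 1 and [|a|], written as a test because it is used in [algC], which is not totally
    ordered. Its product over the roots of a monic polynomial is the Mahler measure. *)
Definition wgt (F : numDomainType) (a : F) : F := if `|a| <= 1 then 1 else `|a|.

Lemma wgt_ge1 (F : numDomainType) (a : F) : 1 <= wgt a.
Proof.
rewrite /wgt; case: ifPn => // a1.
by have /orP[|] := real_leVge (normr_real a) (@real1 F) => // /(negP a1).
Qed.

Lemma wgt_ge (F : numDomainType) (a : F) : `|a| <= wgt a.
Proof. by rewrite /wgt; case: ifP. Qed.

(** Let [c] be the coefficients of the product, so that [g_j = c_{j+1} + a g_{j+1}]. If [|a| <= 1],
    this is iterated from the top coefficient down; otherwise it is solved for [a g_{j+1}] and
    iterated from the bottom up. Each step adds at most [h]. *)
Lemma peel_root (F : numFieldType) (a h : F) (g : {poly F}) N : (size g <= N)%N ->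
  (forall i, `|(('X - a%:P) * g)`_i| <= h) -> forall i, wgt a * `|g`_i| <= N%:R * h.
Proof.
move=> gN hb i.
have h0 : 0 <= h by apply: le_trans (hb 0).
have [iN|iN] := leqP N i.
  by rewrite nth_default ?(leq_trans gN)// normr0 mulr0 mulr_ge0.
rewrite /wgt; case: ifPn => a1.
  rewrite mul1r; suff H k j : (j + k = N)%N -> `|g`_j| <= k%:R * h.
    apply: (le_trans (H (N - i)%N i _)); first by rewrite subnKC// ltnW.
    by rewrite ler_wpM2r// ler_nat leq_subr.
  elim: k j => [|k IH] j jk.
    by rewrite nth_default ?normr0 ?mul0r// (leq_trans gN)// -jk addn0.
  have := hb j.+1; rewrite coefXsubM => hj.
  have -> : g`_j = (g`_j - a * g`_j.+1) + a * g`_j.+1 by rewrite subrK.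
  apply: (le_trans (ler_normD _ _)); rewrite -natr1 mulrDl mul1r addrC.
  apply: lerD => //; apply: (le_trans _ (IH j.+1 _)); last by rewrite addSnnS.
  by rewrite normrM ler_piMl.
have a1' : 1 <= `|a| by have := wgt_ge1 a; rewrite /wgt (negbTE a1).
suff H j : `|a| * `|g`_j| <= j.+1%:R * h.
  by apply: (le_trans (H i)); rewrite ler_wpM2r// ler_nat.
rewrite -normrM; elim: j => [|j IH].
  by have := hb 0; rewrite coefXsubM sub0r normrN mul1r.
have -> : a * g`_j.+1 = g`_j - (g`_j - a * g`_j.+1) by rewrite opprB addrCA subrr addr0.
apply: (le_trans (ler_normB _ _)); rewrite -[j.+2%:R]natr1 mulrDl mul1r.
apply: lerD; last by have := hb j.+1; rewrite coefXsubM.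
by apply: le_trans IH; rewrite normrM ler_peMl.
Qed.

Lemma peel_roots (F : numFieldType) (s : seq F) (h : F) (g : {poly F}) N :
  (size s + size g <= N)%N ->
  (forall i, `|((\prod_(a <- s) ('X - a%:P)) * g)`_i| <= h) ->
  forall i, (\prod_(a <- s) wgt a) * `|g`_i| <= N%:R ^+ size s * h.
Proof.
elim: s h => [|a s IH] h sN hb i.
  by have := hb i; rewrite !big_nil !mul1r.
have w1 := wgt_ge1 a; have w0 : 0 < wgt a by apply: lt_le_trans w1.
rewrite big_cons exprSr -mulrA mulrC -ler_pdivlMr//.
suff : (\prod_(j <- s) wgt j) * `|g`_i| <= N%:R ^+ size s * (N%:R * h / wgt a) by rewrite !mulrA.
apply: IH; first by apply: leq_trans sN; rewrite leq_add2r.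
move=> j; rewrite ler_pdivlMr// mulrC; apply: peel_root.
  apply: leq_trans (size_polyMleq _ _) _; rewrite size_prod_XsubC.
  by move: sN => /=; rewrite addSn => /ltnW; exact: leq_trans.
by move=> l; have := hb l; rewrite big_cons mulrA.
Qed.

(** All roots of [f] are peeled off over [algC]. The product of their weights is at least 1 and at
    least [|f(0)|], the absolute product of the roots; this gives both bounds. *)
Lemma factor_height (f g : {poly int}) (h : int) N : f \is monic ->
  (size f + size g <= N.+1)%N -> (forall i, `|(f * g)`_i| <= h) ->
  forall i, `|f`_0| * `|g`_i| <= N%:R ^+ (size f).-1 * h /\
            `|g`_i| <= N%:R ^+ (size f).-1 * h.
Proof.
move=> fm sN hb i.
pose c : {rmorphism int -> algC} := intr.
have [s fs] := closed_field_poly_normal (map_poly c f).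
have lf : lead_coef (map_poly c f) = 1.
  by rewrite lead_coef_map_inj ?(monicP fm) ?rmorph1//; exact: intr_inj.
rewrite lf scale1r in fs.
have ssz : (size f).-1 = size s.
  have := size_map_inj_poly (@intr_inj algC) (rmorph0 _) f.
  by rewrite -/c fs size_prod_XsubC => <-.
have f00 : (size f > 0)%N by rewrite size_poly_gt0 monic_neq0.
have sgN : (size s + size (map_poly c g) <= N)%N.
  rewrite -ssz (size_map_inj_poly (@intr_inj algC) (rmorph0 _)).
  by move: f00 sN; case: (size f).
have hc j : `|((\prod_(a <- s) ('X - a%:P)) * map_poly c g)`_j| <= h%:~R.
  by rewrite -fs -rmorphM/= coef_map/= -intr_norm ler_int.
have H := peel_roots sgN hc i.
have W1 : 1 <= \prod_(a <- s) wgt a.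
  by elim/big_rec: _ => // a x _ x1; rewrite mulr_ege1// wgt_ge1.
have f0W : `|(f`_0)%:~R| <= \prod_(a <- s) wgt a :> algC.
  have -> : (f`_0)%:~R = (map_poly c f)`_0 by rewrite coef_map.
  rewrite fs -horner_coef0 horner_prod normr_prod.
  elim: (s) => [|a s' IH]; first by rewrite !big_nil.
  rewrite !big_cons ler_pM//; first by rewrite -normr_prod.
  by rewrite !hornerE normrN wgt_ge.
rewrite coef_map/= -/c -ssz in H.
rewrite -!(ler_int algC) !rmorphM/= !rmorphXn/= !intr_norm !natz.
rewrite -!pmulrn; split; apply: (le_trans _ H).
  by rewrite ler_wpM2r.
by rewrite ler_peMl.
Qed.

End FactorHeight.

(** * Reducible monic polynomials of degree at least three are few *)

Section ReducibleCount.

Definition lz K (i : 'I_K.*2.+1) : int := i%:Z - K%:Z.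

Definition enc K (x : int) : 'I_K.*2.+1 := inord `|(x + K%:Z)%R|%N.

Lemma lz_enc K x : `|x| <= K%:Z -> lz (enc K x) = x.
Proof. by move=> xK; rewrite /lz /enc inordK; lia. Qed.

Lemma enc_lz K i : enc K (lz i) = i.
Proof. by rewrite /enc /lz subrK; apply: inord_val. Qed.

Lemma lz_bound K (i : 'I_K.*2.+1) : `|lz i| <= K%:Z.
Proof. by rewrite /lz; have := ltn_ord i; lia. Qed.

Definition mpol K n (t : n.-tuple 'I_K.*2.+1) : {poly int} :=
  'X^n + \sum_(i < n) lz (tnth t i) *: 'X^i.

Lemma coef_mpol K n (t : n.-tuple 'I_K.*2.+1) (i : 'I_n) : (mpol t)`_i = lz (tnth t i).
Proof.
rewrite coefD coefXn ltn_eqF// add0r coef_sum (bigD1 i)//= big1 ?addr0.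
  by rewrite coefZ coefXn eqxx mulr1.
by move=> j ji; rewrite coefZ coefXn eq_sym (inj_eq val_inj) (negbTE ji) mulr0.
Qed.

Lemma size_msum (R : nzRingType) n (c : 'I_n -> R) : (size (\sum_(i < n) c i *: 'X^i)%R <= n)%N.
Proof.
apply: (leq_trans (size_sum _ _ _)); apply/bigmax_leqP => i _.
by rewrite (leq_trans (size_scale_leq _ _))// size_polyXn.
Qed.

Lemma size_mpol K n (t : n.-tuple 'I_K.*2.+1) : size (mpol t) = n.+1.
Proof. by rewrite size_polyDl size_polyXn// ltnS size_msum. Qed.

Lemma mpol_monic K n (t : n.-tuple 'I_K.*2.+1) : mpol t \is monic.
Proof.
rewrite monicE lead_coefDl ?lead_coefXn// size_polyXn ltnS; exact: size_msum.
Qed.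

Lemma mpol_coef_le K n (t : n.-tuple 'I_K.*2.+1) i : (0 < K)%N -> `|(mpol t)`_i| <= K%:Z.
Proof.
move=> K0; have [ni|] := ltnP n i; first by rewrite nth_default ?size_mpol.
rewrite leq_eqVlt => /predU1P[->|ni].
  have := mpol_monic t; rewrite monicE lead_coefE size_mpol => /eqP ->.
  by rewrite normr1; lia.
by rewrite (coef_mpol t (Ordinal ni)) lz_bound.
Qed.

Lemma mpol_inj K n : injective (@mpol K n).
Proof.
move=> t u tu; apply: eq_from_tnth => i.
by rewrite -(enc_lz (tnth t i)) -coef_mpol tu coef_mpol enc_lz.
Qed.

Lemma mpol_surj K n (p : {poly int}) : p \is monic -> size p = n.+1 ->
  (forall i, `|p`_i| <= K%:Z) -> exists t : n.-tuple 'I_K.*2.+1, p = mpol t.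
Proof.
move=> pm sp pK; exists (mktuple (fun i => enc K p`_i)).
apply/polyP => i; have [ni|] := ltnP n i.
  by rewrite !nth_default ?size_mpol ?sp.
rewrite leq_eqVlt => /predU1P[->|ni].
  have := mpol_monic (mktuple (fun i : 'I_n => enc K p`_i)).
  move: pm; rewrite !monicE !lead_coefE size_mpol sp => /eqP -> /eqP /= -> //.
by rewrite (coef_mpol _ (Ordinal ni)) tnth_mktuple lz_enc.
Qed.

Definition reducible (p : {poly int}) := exists f g : {poly int},
  [/\ f \is monic, g \is monic, (1 < size f)%N, (1 < size g)%N & p = f * g].

Definition wt (a : int) : nat := maxn 1 `|a|%N.

(** There are at most [2 q + 1] such integers with [q = M %/ w], and [w <= M.+1] absorbs the
    [+ 1]. *)
Lemma card_lz_le M w : (0 < w)%N -> (w <= M.+1)%N ->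
  (w * #|[pred j : 'I_M.*2.+1 | (w * `|lz j| <= M)%N]| <= 3 * M.+1)%N.
Proof.
move=> w0 wM; set P := [pred j | _].
have wq : (w * (M %/ w) <= M)%N by rewrite mulnC leq_divM.
have Pq : (#|P| <= (M %/ w).*2.+1)%N.
  rewrite -[X in (_ <= X)%N]card_ord.
  apply: (@leq_card_in _ _ (fun j : 'I_M.*2.+1 => inord (j + M %/ w - M) : 'I_(M %/ w).*2.+1)).
  have aux (j : 'I_M.*2.+1) : j \in P -> (M <= j + M %/ w)%N /\ (j + M %/ w - M < (M %/ w).*2.+1)%N.
    by rewrite inE /lz mulnC -leq_divRL//; move: (M %/ w)%N => q; lia.
  move=> i j /aux[i1 i2] /aux[j1 j2] /(congr1 val); rewrite /= !inordK// => ij.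
  by apply: val_inj => /=; lia.
move: (M %/ w)%N wq Pq => q wq Pq; apply: (leq_trans (leq_mul (leqnn w) Pq)).
by rewrite mulnS -muln2; lia.
Qed.

Lemma card_bigcup_le (I T : finType) (P : pred I) (F : I -> {set T}) :
  (#|(\bigcup_(i | P i) F i)%SET| <= \sum_(i | P i) #|F i|)%N.
Proof.
elim/big_rec2: _ => [|i m B _ BM]; first by rewrite cards0.
by rewrite (leq_trans (leq_card_setU _ _))// leq_add2l.
Qed.

Lemma sum_lz_le M (F : nat -> rat) : (forall i, 0 <= F i) ->
  \sum_(i < M.*2.+1) F `|lz i|%N <= 2 * \sum_(i < M.+1) F i.
Proof.
move=> F0; rewrite -(big_mkord xpredT (fun i => F `|i%:Z - M%:Z|%N)).
rewrite (@big_cat_nat _ _ _ M)//=; last by lia.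
rewrite mulr_natl mulr2n; apply: lerD.
  rewrite big_nat_rev/= add0n -(big_mkord xpredT) big_nat_recl// -[leLHS]add0r.
  apply: lerD => //; rewrite le_eqVlt; apply/orP; left; apply/eqP.
  by apply: eq_big_nat => i iM; congr F; lia.
rewrite -{1}[M]add0n big_addn (_ : (_ - _)%N = M.+1); last by lia.
rewrite big_mkord; rewrite le_eqVlt; apply/orP; left; apply/eqP.
by apply: eq_bigr => i _; congr F; lia.
Qed.

(** The subtracted term carries the induction, through [1/(M+1)^2 <= 1/M - 1/(M+1)]. The indices 0
    and 1 contribute 1 each. *)
Lemma sum_inv_sqr M : \sum_(i < M.+1) (maxn 1 i)%:R^-1 ^+ 2 <= 3 - (maxn 1 M)%:R^-1 :> rat.
Proof.
elim: M => [|M IH]; first by rewrite big_ord1 (_ : maxn 1 0 = 1%N)//; lra.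
case: M IH => [|M] IH.
  by rewrite big_ord_recr big_ord1/= (_ : maxn 1 0 = 1%N)// (_ : maxn 1 1 = 1%N)//; lra.
rewrite big_ord_recr/=; apply: (le_trans (lerD IH (lexx _))); rewrite -/(maxn 1 M.+1) -/(maxn 1 M.+2).
rewrite !(maxn_idPr _)//; set x : rat := M.+1%:R.
have x0 : 0 < x by rewrite ltr0n.
have -> : M.+2%:R = x + 1 by rewrite natr1.
rewrite -subr_ge0 (_ : _ - _ = (x * (x + 1) ^+ 2)^-1).
  by rewrite invr_ge0 mulr_ge0 ?exprn_ge0//; lra.
by field; rewrite !gt_eqF//; lra.
Qed.

(** Here [a] is the constant term of [f], and the power counts the coefficients of [g], each with at
    most [3 M.+1 / wt a] choices. An exponent of at least 2 makes the sum over [a] converge; this is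
    where [deg g >= 2] enters. *)
Lemma sum_card_pow_le M e :
  (\sum_(a < M.*2.+1) #|[pred j : 'I_M.*2.+1 | (wt (lz a) * `|lz j| <= M)%N]| ^ e.+2
   <= 6 * (3 * M.+1) ^ e.+2)%N.
Proof.
rewrite -(ler_nat rat) natr_sum natrM.
set c := ((3 * M.+1) ^ e.+2)%:R : rat.
have c0 : 0 <= c by [].
apply: (@le_trans _ _ (\sum_(a < M.*2.+1) c * (wt (lz a))%:R^-1 ^+ 2)).
  apply: ler_sum => a _; set p := #|_|.
  have w1 : (0 < wt (lz a))%N by rewrite /wt; lia.
  have pw : (wt (lz a) * p <= 3 * M.+1)%N.
    by apply: card_lz_le; rewrite // /wt; have := lz_bound a; lia.
  have w0 : 0 < (wt (lz a))%:R :> rat by rewrite ltr0n.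
  rewrite exprVn ler_pdivlMr ?exprn_gt0// -natrX -natrM ler_nat.
  have p3 : (p <= 3 * M.+1)%N by apply: leq_trans pw; rewrite leq_pmull.
  rewrite -addn2 !expnD -mulnA -expnMn mulnC [(p * _)%N]mulnC mulnC.
  by apply: leq_mul; [case: (e) => // e'; rewrite leq_exp2r|rewrite leq_exp2r].
rewrite -mulr_sumr mulrC ler_wpM2r//.
apply: (le_trans (@sum_lz_le M (fun i => (maxn 1 i)%:R^-1 ^+ 2) _)).
  by move=> i; rewrite sqr_ge0.
have := sum_inv_sqr M; have : 0 <= (maxn 1 M)%:R^-1 :> rat by rewrite invr_ge0.
by move: (_^-1) (\sum_(i < _) _) => x y; lra.
Qed.

Lemma reducible_wlog (p : {poly int}) : (3 < size p)%N -> reducible p -> exists f g : {poly int},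
  [/\ f \is monic, g \is monic, (1 < size f)%N, (2 < size g)%N & p = f * g].
Proof.
move=> sp [f [g [fm gm f1 g1 pE]]].
have [g2|g2] := ltnP 2 (size g); first by exists f, g.
exists g, f; split=> //; last by rewrite mulrC.
by move: sp; rewrite pE size_monicM ?monic_neq0//; lia.
Qed.

(** A reducible tuple is decoded from the constant term [a] of [f], its [d] other coefficients
    bounded by [M], and the coefficients of [g] bounded by [M / wt a]. The exponents [d] and
    [(e d).+2] add up to [n - 1], and the sum over [a] costs no further power of [K]. *)
Lemma reducible_count n : (3 <= n)%N -> exists C : nat, forall K, (0 < K)%N ->
  (#|[set t : n.-tuple 'I_K.*2.+1 | `[< reducible (mpol t) >]]%SET| <= C * K ^ n.-1)%N.
Proof.
(* [B] dominates the constant of [factor_height] for total degree [n]. Below, [f] has size [d.+2]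
   and [g] has size [(e d).+3], leading coefficients included. *)
move=> n3; pose B := (n.+1 ^ n)%N.
exists (n.-2 * (6 * (3 * B.+1) ^ n.-1))%N => K K0.
pose M := (B * K)%N; pose e d := (n - 3 - d)%N.
pose P (a : 'I_M.*2.+1) := [pred j : 'I_M.*2.+1 | (wt (lz a) * `|lz j| <= M)%N].
pose dec d a (f : d.-tuple 'I_M.*2.+1) (g : {ffun 'I_(e d).+2 -> 'I_M.*2.+1}) : n.-tuple 'I_K.*2.+1 :=
  mktuple (fun i => enc K (mpol (cons_tuple a f) * mpol (mktuple g))`_i).
have B0 : (0 < B)%N by rewrite expn_gt0.
have cov : [set t : n.-tuple 'I_K.*2.+1 | `[< reducible (mpol t) >]]%SET \subset
    (\bigcup_(d < n.-2) \bigcup_(a : 'I_M.*2.+1) \bigcup_(f : d.-tuple 'I_M.*2.+1)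
      (dec d a f @: [set g | g \in ffun_on (P a)]))%SET.
  apply/fintype.subsetP => t; rewrite inE => /asboolP red.
  have [|f [g [fm gm f1 g2 tE]]] := reducible_wlog _ red; first by rewrite size_mpol.
  have fg : (size f + size g = n.+2)%N.
    have := size_monicM fm (monic_neq0 gm); rewrite -tE size_mpol; lia.
  have tK i : `|(f * g)`_i| <= K%:Z by rewrite -tE mpol_coef_le.
  have BM s : (s <= n)%N -> n.+1%:R ^+ s * K%:Z <= M%:Z.
    by move=> sn; rewrite -natrX -(natz K) -natrM -(natz M) ler_nat leq_mul2r leq_pexp2l// orbT.
  have gM i : `|f`_0| * `|g`_i| <= M%:Z /\ `|g`_i| <= M%:Z.
    have [] := factor_height fm _ tK i (N := n.+1); first by rewrite fg.
    move=> h1 h2; split; apply: le_trans (BM (size f).-1 _); rewrite //; lia.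
  have fM i : `|f`_i| <= M%:Z.
    rewrite mulrC addnC in tK fg.
    have [] := factor_height gm _ tK i (N := n.+1); first by rewrite fg.
    move=> h1 h2; apply: le_trans (BM (size g).-1 _); rewrite //; lia.
  pose d := (size f).-2.
  have sf : size f = d.+2 by rewrite /d; lia.
  have sg : size g = (e d).+3 by rewrite /e /d; lia.
  have [tf ftf] := mpol_surj fm sf fM.
  have [tg gtg] := mpol_surj gm sg (fun i => (gM i).2).
  have dn : (d < n.-2)%N by rewrite /d; lia.
  apply/bigcupP; exists (Ordinal dn) => //; apply/bigcupP; exists (thead tf) => //.
  apply/bigcupP; exists (behead_tuple tf) => //.
  apply/imsetP; exists [ffun i => tnth tg i]; rewrite ?inE.
    apply/ffun_onP => i; rewrite inE ffunE -coef_mpol -gtg /wt.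
    have := gM i; have -> : f`_0 = lz (thead tf) by rewrite ftf (coef_mpol _ ord0).
    rewrite -!abszE -PoszM !lez_nat => -[h1 h2].
    by rewrite maxnMl mul1n geq_max h2 h1.
  apply: eq_from_tnth => i; rewrite tnth_mktuple.
  have -> : cons_tuple (thead tf) (behead_tuple tf) = tf by rewrite [RHS]tuple_eta; apply: val_inj.
  have -> : mktuple [ffun i => tnth tg i] = tg.
    by apply: eq_from_tnth => j; rewrite tnth_mktuple ffunE.
  by rewrite -ftf -gtg -tE coef_mpol enc_lz.
apply: (leq_trans (subset_leq_card cov)).
apply: (leq_trans (card_bigcup_le _ _)).
apply: (@leq_trans (\sum_(d < n.-2) 6 * (3 * B.+1) ^ n.-1 * K ^ n.-1)); last first.
  by rewrite sum_nat_const card_ord mulnA.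
apply: leq_sum => d _.
apply: (leq_trans (card_bigcup_le _ _)).
apply: (@leq_trans (\sum_(a < M.*2.+1) M.*2.+1 ^ d * #|P a| ^ (e d).+2)).
  apply: leq_sum => a _; apply: (leq_trans (card_bigcup_le _ _)).
  rewrite -[X in (_ <= X ^ _ * _)%N]card_ord -card_tuple -sum_nat_const.
  apply: leq_sum => f _; apply: (leq_trans (leq_imset_card _ _)).
  by rewrite cardsE card_ffun_on card_ord.
rewrite -big_distrr/=; apply: (leq_trans (leq_mul (leqnn _) (sum_card_pow_le M (e d)))).
have de : n.-1 = (d + (e d).+2)%N by rewrite /e; have := ltn_ord d; lia.
rewrite mulnCA -mulnA leq_mul2l/= -expnMn [X in (_ <= _ ^ X)%N]de expnD.
have M3 : (3 * M.+1 <= 3 * B.+1 * K)%N by rewrite /M; nia.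
have M2 : (M.*2.+1 <= 3 * B.+1 * K)%N by apply: leq_trans M3; lia.
by apply: leq_mul; [case: (nat_of_ord d) => // d'; rewrite leq_exp2r|rewrite leq_exp2r].
Qed.

End ReducibleCount.

(** * Algebraic integers as roots of irreducible monic polynomials *)

Section OmegaSum.
Context (R : realType).
Implicit Types (x a Q : R).

Lemma map_mpol K n (t : n.-tuple 'I_K.*2.+1) :
  map_poly intr (mpol t) = 'X^n + lpoly R t.
Proof.
rewrite rmorphD/= map_polyXn rmorph_sum/=; congr (_ + _); apply: eq_bigr => i _.
by rewrite map_polyZ/= map_polyXn /lz rmorphB/=.
Qed.

Lemma posz_unit (u v : int) : u * v = 1 -> 0 < u -> u = 1.
Proof.
move=> uv u0; have : (u %| 1)%Z by apply/dvdzP; exists v; rewrite mulrC.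
by rewrite dvdz1 => /eqP; lia.
Qed.

(** Gauss's lemma. A nonzero [q] of smaller size vanishing at [a] is replaced by its
    pseudo-remainder until it divides [p]. Its primitive part then divides [p] over the integers,
    and comparing leading coefficients makes both factors monic. *)
Lemma is_minpoly_monic (p : {poly int}) a : p \is monic -> (1 < size p)%N ->
  root (map_poly intr p) a -> (is_minpoly p a <-> ~ reducible p).
Proof.
move=> pm p1 pa; split.
  move=> [p0 _ pmin _ _] [f [g [fm gm f1 g1 pE]]].
  have sp : (size p).+1 = (size f + size g)%N.
    by rewrite pE size_monicM ?monic_neq0// prednK// addn_gt0; lia.
  move: pa; rewrite pE rmorphM/= rootM => /orP[] h.
    by have := pmin _ (monic_neq0 fm) h; lia.
  by have := pmin _ (monic_neq0 gm) h; lia.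
move=> nred; split=> //; first exact: monic_neq0.
- move=> q; have [k] := ubnP (size q); elim: k q => // k IH q qk q0 qa.
  rewrite leqNgt; apply/negP => qp.
  have ra : root (map_poly intr (p %% q)) a.
    have := Pdiv.Idomain.divp_eq p q => /(congr1 (map_poly (intr : int -> R))).
    rewrite map_polyZ/= rmorphD/= rmorphM/= => /(congr1 (horner^~ a)).
    rewrite hornerZ hornerD hornerM (rootP pa) (rootP qa) !mulr0 add0r => h.
    by rewrite rootE -h.
  have [r0|r0] := eqVneq (p %% q) 0; last first.
    have rq : (size (p %% q)%R < size q)%N by rewrite ltn_modp.
    have := leq_ltn_trans (IH _ (leq_trans rq (ltnSE qk)) r0 ra) rq.
    by rewrite ltnNge (ltnW qp).
  have /dvdpP_int[r pE] : q %| p by rewrite /dvdp r0.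
  have lz : lead_coef (zprimitive q) * lead_coef r = 1 by rewrite -lead_coefM -pE (monicP pm).
  have lq : 0 < lead_coef (zprimitive q) by rewrite -sgz_gt0 sgz_lead_primitive q0.
  have zm : zprimitive q \is monic by rewrite monicE; apply/eqP; exact: posz_unit lz lq.
  have rm : r \is monic by rewrite monicE; move: lz; rewrite (monicP zm) mul1r => ->.
  have q1 : (1 < size q)%N.
    rewrite ltnNge; apply/negP => /size1_polyC qc; move: qa q0; rewrite qc map_polyC/= rootC.
    by rewrite intr_eq0 polyC_eq0 => ->.
  apply: nred; exists (zprimitive q), r; split=> //; first by rewrite size_zprimitive.
  by move: qp; rewrite pE size_monicM ?monic_neq0// size_zprimitive; lia.
- exact: zcontents_monic.
- by rewrite (monicP pm).
Qed.

Lemma is_minpoly_unique (p q : {poly int}) a : p \is monic -> q \is monic ->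
  size p = size q -> is_minpoly p a -> root (map_poly intr q) a -> p = q.
Proof.
move=> pm qm pq [_ pa pmin _ _] qa; apply/eqP; rewrite -subr_eq0; apply/negPn/negP => d0.
have : (size p <= size (p - q)%R)%N
  by apply: pmin => //; rewrite rmorphB/= rootE !hornerE (rootP pa) (rootP qa) subr0.
have p0 : (0 < size p)%N by rewrite size_poly_gt0 monic_neq0.
apply/negP; rewrite -ltnNge -(prednK p0) ltnS; apply/leq_sizeP => j pj.
rewrite coefB; move: pj; rewrite leq_eqVlt => /predU1P[<-|pj].
  by move: pm qm; rewrite !monicE !lead_coefE -pq => /eqP -> /eqP ->; rewrite subrr.
by rewrite !nth_default ?subrr// -?pq -(prednK p0).
Qed.

Lemma poly_height_le (p : {poly int}) K :
  (poly_height p <= K)%N <-> forall i, `|p`_i| <= K%:Z.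
Proof.
rewrite /poly_height; split=> [/bigmax_leqP H i|H].
  have [pi|ip] := leqP (size p) i; first by rewrite nth_default.
  by have := H (Ordinal ip) isT => /=; lia.
by apply/bigmax_leqP => i _; have := H i; lia.
Qed.

(** Cauchy's bound. If [|x| >= K + 1], the lower terms are at most [|x| - 1] times the geometric
    sum, that is [|x|^n - 1], and cannot balance the leading one. *)
Lemma monic_root_bound K n (t : n.-tuple 'I_K.*2.+1) x :
  root ('X^n + lpoly R t) x -> `|x| < K%:R + 1.
Proof.
move=> /rootP; rewrite hornerD hornerXn horner_lpoly => /eqP.
rewrite addr_eq0 => /eqP xn; rewrite ltNge; apply/negP => Kx.
have := congr1 Num.norm xn; rewrite normrN normrX => xnE.
have : `|x| ^+ n <= K%:R * \sum_(i < n) `|x| ^+ i.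
  rewrite xnE mulr_sumr; apply: (le_trans (ler_norm_sum _ _ _)); apply: ler_sum => i _.
  by rewrite normrM normrX ler_wpM2r ?exprn_ge0// lc_bound.
apply/negP; rewrite -ltNge.
apply: (@le_lt_trans _ _ ((`|x| - 1) * \sum_(i < n) `|x| ^+ i)).
  by rewrite ler_wpM2r//; [apply: sumr_ge0 => i _; rewrite exprn_ge0|lra].
by rewrite -subrX1; lra.
Qed.

Lemma uniq_flatten_map (I T : eqType) (s : seq I) (F : I -> seq T) : uniq s ->
  (forall i, uniq (F i)) -> (forall i j (x : T), i \in s -> j \in s -> x \in F i -> x \in F j -> i = j) ->
  uniq (flatten [seq F i | i <- s]).
Proof.
move=> us uF; elim: s us => //= i s IH /andP[is_ us] disj.
rewrite cat_uniq uF IH ?andbT//=; last first.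
  by move=> j k x js ks; apply: disj; rewrite inE ?js ?ks orbT.
apply/hasPn => x /flatten_mapP[j js xj]; apply/negP => xi.
have ij : i = j by apply: (disj i j x) => //; rewrite inE ?eqxx ?js ?orbT.
by rewrite ij js in is_.
Qed.

Lemma monic_lpoly_neq0 K n (t : n.-tuple 'I_K.*2.+1) : 'X^n + lpoly R t != 0.
Proof.
rewrite -map_mpol map_poly_eq0_id0 ?monic_neq0 ?mpol_monic//.
by rewrite (monicP (mpol_monic t)) oner_eq0.
Qed.

(** Distinct irreducible monic polynomials of the same degree share no root, so counting polynomial
    by polynomial counts each number once. Cauchy's bound puts all roots within [3 K] of 0. *)
Lemma Omega_sum n K Q : (0 < n)%N -> (0 < K)%N -> K%:R <= Q < K.+1%:R ->
  Omega n Q = (\sum_(t : n.-tuple 'I_K.*2.+1 | ~~ `[< reducible (mpol t) >])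
    nroots ('X^n + lpoly R t) (- (3 * K%:R)) (3 * K%:R))%N.
Proof.
move=> n0 K0 /andP[KQ QK].
pose F (t : n.-tuple 'I_K.*2.+1) := roots ('X^n + lpoly R t) (- (3 * K%:R)) (3 * K%:R).
pose s := [seq t <- enum {: n.-tuple 'I_K.*2.+1} | ~~ `[< reducible (mpol t) >]].
pose L := flatten [seq F t | t <- s].
have K1 : 1 <= K%:R :> R by rewrite ler1n.
have FP t x : (x \in F t) = root ('X^n + lpoly R t) x.
  apply/idP/idP => [|rx]; first by rewrite in_roots => /and3P[].
  rewrite in_roots rx monic_lpoly_neq0 andbT/= in_itv/= -ltr_norml.
  by apply: lt_le_trans (monic_root_bound rx) _; lra.
have minP t x : t \in s -> x \in F t -> is_minpoly (mpol t) x.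
  rewrite mem_filter FP -map_mpol => /andP[/asboolPn nr _] rx.
  by apply/is_minpoly_monic => //; rewrite ?mpol_monic// size_mpol.
have uL : uniq L.
  apply: uniq_flatten_map; first by rewrite filter_uniq ?enum_uniq.
    by move=> t; exact: uniq_roots.
  move=> t u x ts us xt xu; apply: mpol_inj; apply: (is_minpoly_unique (a := x)).
  - exact: mpol_monic.
  - exact: mpol_monic.
  - by rewrite !size_mpol.
  - exact: minP.
  - by rewrite map_mpol -FP.
have -> : Omega n Q = size L.
  rewrite -(undup_id uL) -card_fseq /Omega; congr (#|` _|).
  apply/esym; rewrite -[RHS](_ : fset_set [set` [fset x in L]%fset] = _); last first.
    congr fset_set; apply/seteqP; split=> x /=.
      rewrite inE => /flatten_mapP[t ts xt]; exists (mpol t); first exact: minP.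
      split; [exact: mpol_monic|exact: size_mpol|].
      apply: le_trans KQ; rewrite ler_nat; apply/poly_height_le => i.
      exact: mpol_coef_le.
    move=> [p pmin [pm sp hp]].
    have pK : (poly_height p <= K)%N by rewrite -ltnS -(ltr_nat R); exact: le_lt_trans QK.
    have [t pt] := mpol_surj pm sp ((poly_height_le p K).1 pK).
    have px : root (map_poly intr p) x by case: pmin.
    rewrite inE; apply/flatten_mapP; exists t; last by rewrite FP -map_mpol -pt.
    rewrite mem_filter mem_enum inE andbT; apply/asboolPn; rewrite -pt.
    by apply/(is_minpoly_monic pm _ px) => //; rewrite sp.
  apply/fsetP => x; rewrite in_fset_set; last exact: finite_fset.
  by apply/idP/idP => [xL|/set_mem//]; exact: mem_set.
rewrite /L size_flatten /shape -map_comp sumnE big_map big_filter big_enum_cond/=.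
by apply: eq_bigl.
Qed.

End OmegaSum.

(** * From irreducible to all monic polynomials, and to positive roots *)

Section OmegaMcount.
Context (R : realType).
Implicit Types (x a b Q : R).

(** The coefficients of [(-1)^n p(-x)], which is monic again; hence the parity of [n + i] rather
    than of [i]. *)
Definition flip_par K n (t : n.-tuple 'I_K.*2.+1) : n.-tuple 'I_K.*2.+1 :=
  [tuple if odd (n + i) then rev_ord (tnth t i) else tnth t i | i < n].

Lemma flip_parK K n : involutive (@flip_par K n).
Proof.
move=> t; apply: eq_from_tnth => i; rewrite !tnth_mktuple.
by case: (odd _); rewrite ?rev_ordK.
Qed.

Lemma horner_flip_par K n (t : n.-tuple 'I_K.*2.+1) x :
  ('X^n + lpoly R (flip_par t)).[- x] = (-1) ^+ n * ('X^n + lpoly R t).[x].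
Proof.
rewrite !hornerD !hornerXn !horner_lpoly [(- x) ^+ n]exprNn mulrDr; congr (_ + _).
rewrite mulr_sumr; apply: eq_bigr => i _; rewrite tnth_mktuple [(- x) ^+ i]exprNn.
rewrite -(signr_odd _ i) -(signr_odd _ n) oddD.
by case: (odd n); case: (odd i); rewrite ?expr0 ?expr1 ?lc_rev; ring.
Qed.

Lemma Mcount_opp K n a b : Mcount K n (- b) (- a) = Mcount K n a b.
Proof.
rewrite /Mcount (reindex_inj (inv_inj (@flip_parK K n)))/=.
apply: eq_bigr => t _; congr (_%:R).
apply/esym/(nroots_bij (@opprK R)); rewrite ?monic_lpoly_neq0//.
- by move=> x; rewrite !ltrN2 andbC.
- by move=> x; rewrite ltrNl ltrNr andbC.
- by move=> x _; rewrite !rootE horner_flip_par mulf_eq0 signr_eq0.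
Qed.

(** The cut points [- a], 0 and [a] are left out. They will be integers, where an irreducible
    polynomial of degree at least 2 cannot vanish. *)
Definition nroots4 (p : {poly R}) a b : nat :=
  (nroots p (- b) (- a) + nroots p (- a) 0%R + nroots p 0%R a + nroots p a b)%N.

Lemma nroots4E (p : {poly R}) a b : p != 0 -> 0 < a -> a < b ->
  nroots p (- b) b = (nroots4 p a b + root p (- a) + root p (0 : R)%R + root p a)%N.
Proof.
move=> p0 a0 ab; have b0 : 0 < b by apply: lt_trans ab.
rewrite (@nroots_split _ p (- b) 0 b)// ?oppr_lt0//.
rewrite (@nroots_split _ p (- b) (- a) 0)// ?ltrN2 ?oppr_lt0//.
by rewrite (@nroots_split _ p 0 a b)// /nroots4; lia.
Qed.

Lemma nroots_lt_size (p : {poly R}) a b : p != 0 -> (nroots p a b < size p)%N.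
Proof.
move=> p0; apply: max_poly_roots => //; last exact: uniq_roots.
by apply/allP => x; rewrite in_roots => /and3P[].
Qed.

Lemma int_root_reducible K n (t : n.-tuple 'I_K.*2.+1) (c : int) : (1 < n)%N ->
  root ('X^n + lpoly R t) c%:~R -> reducible (mpol t).
Proof.
move=> n1; rewrite -map_mpol => rc.
have : root (mpol t) c.
  by move: rc; rewrite /root horner_map intr_eq0.
move=> /factor_theorem[q qE].
have tm := mpol_monic t.
have qm : q \is monic by rewrite monicE -(monicP tm) qE lead_coefM lead_coefXsubC mulr1.
exists q, ('X - c%:P); split; rewrite ?monicXsubC ?size_XsubC//.
have := size_mpol t; rewrite qE size_Mmonic ?monicXsubC ?monic_neq0//.
by rewrite size_XsubC; lia.
Qed.

Lemma size_monic_lpoly K n (t : n.-tuple 'I_K.*2.+1) : size ('X^n + lpoly R t) = n.+1.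
Proof.
by rewrite size_polyDl size_polyXn// ltnS; exact: size_msum.
Qed.

Lemma Omega_Mcount m : exists C : R, forall K Q, (0 < K)%N -> K%:R <= Q < K.+1%:R ->
  4 * m.+3%:R ^+ 2 < 3 * K%:R :> R ->
  `|(Omega m.+3 Q)%:R - 2 * (Mcount K m.+3 0 (4 * m.+3%:R ^+ 2)
     + Mcount K m.+3 (4 * m.+3%:R ^+ 2) (3 * K%:R))| <= C * K%:R ^+ m.+2.
Proof.
set A : R := 4 * m.+3%:R ^+ 2.
have A0 : 0 < A by rewrite mulr_gt0 ?exprn_gt0.
have [c Hc] := @reducible_count m.+3 isT.
exists (m.+3 * c)%:R => K Q K0 KQ AK.
pose r (t : m.+3.-tuple 'I_K.*2.+1) := `[< reducible (mpol t) >].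
pose S (t : m.+3.-tuple 'I_K.*2.+1) := nroots4 ('X^(m.+3) + lpoly R t) A (3 * K%:R).
have -> : Omega m.+3 Q = (\sum_(t | ~~ r t) S t)%N.
  rewrite (Omega_sum _ K0 KQ)//; apply: eq_bigr => t /asboolPn nr.
  have nri (z : int) : root ('X^(m.+3) + lpoly R t) z%:~R = false.
    by apply/negP => h; apply: nr; exact: int_root_reducible h.
  rewrite (nroots4E _ A0 AK) ?monic_lpoly_neq0// -/(S t).
  have -> : A = (4 * m.+3 ^ 2)%N%:~R by rewrite -pmulrn natrM natrX.
  by rewrite -rmorphN/= (nri 0) !nri !addn0.
have -> : 2 * (Mcount K m.+3 0 A + Mcount K m.+3 A (3 * K%:R)) = (\sum_t S t)%N%:R.
  rewrite /S /nroots4 natr_sum.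
  under eq_bigr do rewrite !natrD.
  rewrite !big_split/= -!/(Mcount _ _ _ _) Mcount_opp.
  have -> : Mcount K m.+3 (- A) 0 = Mcount K m.+3 0 A by have := Mcount_opp K m.+3 0 A; rewrite oppr0.
  by ring.
(* What is left is the contribution of the reducible polynomials, each with at most [m.+3] roots. *)
rewrite [X in _ - X%:R](bigID (fun t => ~~ r t))/= natrD opprD addrA subrr sub0r normrN.
rewrite normr_nat -natrX -natrM ler_nat -mulnA.
apply: leq_trans (leq_mul (leqnn m.+3) (Hc K K0)).
rewrite mulnC -sum1dep_card big_distrl/=.
apply: (@leq_trans (\sum_(t | ~~ ~~ r t) m.+3)).
  apply: leq_sum => t _; have := nroots4E (monic_lpoly_neq0 R t) A0 AK.
  have := nroots_lt_size (- (3 * K%:R)) (3 * K%:R) (monic_lpoly_neq0 R t).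
  rewrite size_monic_lpoly => h1 h2; apply: leq_trans (_ : (_ <= _)%N) (ltnSE h1).
  rewrite h2 /S; move: (nroots4 _ _ _) => N.
  by rewrite -2!addnA leq_addr.
by rewrite leq_eqVlt; apply/orP; left; apply/eqP; apply: eq_big => t; rewrite ?negbK ?mul1n//.
Qed.

End OmegaMcount.

(** * Degree at least three *)

Section LargeDegree.
Context (R : realType).
Implicit Types (x y a b Q C k s w e I u : R).

(** Up to the error, the roots in [(0, A)] give the integral of [phi] over [(0, A)], and those
    beyond [A] give the one over [(0, A^-1)] plus the excess. Doubling for the sign, [phi_total]
    reassembles the integral over the line. *)
Lemma Omega_asymptotics m : exists C K1, forall K Q k s, K1 <= K%:R :> R ->
  K%:R <= Q < K.+1%:R -> k = K%:R + 2^-1 -> 0 < s -> k = s ^+ 2 ->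
  `|(Omega m.+3 Q)%:R
    - (K%:R ^+ m.+3 * (\int[lebesgue_measure]_(t in [set: R]) phi m.+2 t)
       + (2 * k) ^+ m.+2 * (2 * k - 8 / 3 * s))| <= C * K%:R ^+ m.+2.
Proof.
set A : R := 4 * m.+3%:R ^+ 2; set I := \int[_]_(_ in _) _.
have n3 : 3 <= m.+3%:R :> R by rewrite ler_nat.
have A1 : 36 <= A by rewrite /A; nra.
have A0 : 0 < A by lra.
have V0 : 0 < A^-1 by rewrite invr_gt0.
have [C1 H1] := Omega_Mcount R m.
have [C2 H2] := Mcount_small (m.+1) A0.
have [C3 H3] := @Mcount_large R m.+1.
have [C4 H4] := Tcount_phi m.+2 A0.
have [C5 H5] := Tcount_phi m.+2 V0.
exists (C1 + 2 * (C2 + `|C3| * 3 ^+ m.+2 + C4 + C5)), (A ^+ 2) => K Q k s K1 KQ hk s0 ks.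
have Kp : 0 < K%:R :> R by nra.
have K0 : (0 < K)%N by rewrite -(ltr0n R).
have AK : A < 3 * K%:R by nra.
have As : A < s by nra.
have {}H1 := H1 K Q K0 KQ AK.
have {}H2 := H2 K K0.
have {}H3 := H3 K k s hk s0 ks As.
have TI a b C : a < b -> `|Tcount K m.+3 a b / K%:R ^+ m.+3 - Int (@phi R m.+2) a b| <= C / K%:R ->
    `|Tcount K m.+3 a b - K%:R ^+ m.+3 * Int (@phi R m.+2) a b| <= C * K%:R ^+ m.+2.
  move=> _ h.
  have -> : Tcount K m.+3 a b - K%:R ^+ m.+3 * Int (@phi R m.+2) a b =
     K%:R ^+ m.+3 * (Tcount K m.+3 a b / K%:R ^+ m.+3 - Int (@phi R m.+2) a b).
    by rewrite mulrBr mulrCA divff ?mulr1// expf_neq0// gt_eqF.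
  rewrite normrM ger0_norm ?exprn_ge0// (le_trans (ler_wpM2l _ h)) ?exprn_ge0//.
  rewrite le_eqVlt; apply/orP; left; apply/eqP; rewrite [K%:R ^+ m.+3]exprS.
  by move: (K%:R ^+ m.+2) => W; field; rewrite gt_eqF.
have {}H4 := TI _ _ _ A0 (H4 K K0).
have {}H5 := TI _ _ _ V0 (H5 K K0).
have {}H3 : `|Mcount K m.+3 A (3 * K%:R) - Tcount K m.+3 0 A^-1
   - (2 * k) ^+ m.+2 * (k - 4 / 3 * s)| <= `|C3| * 3 ^+ m.+2 * K%:R ^+ m.+2.
  apply: (le_trans H3); apply: (@le_trans _ _ (`|C3| * (2 * k) ^+ m.+2)).
    by rewrite ler_wpM2r ?ler_norm// exprn_ge0//; lra.
  rewrite -mulrA -exprMn ler_wpM2l// lerXn2r// ?nnegrE; nra.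
have IE : I = 2 * (Int (@phi R m.+2) 0 A + Int (@phi R m.+2) 0 A^-1) by exact: phi_total.
rewrite IE.
set M1 := Mcount K m.+3 0 A in H1 H2 *; set M2 := Mcount K m.+3 A _ in H1 H3 *.
set T1 := Tcount K m.+3 0 A in H2 H4 *; set T2 := Tcount K m.+3 0 A^-1 in H3 H5 *.
set I1 := Int _ 0 A in H4 *; set I2 := Int _ 0 A^-1 in H5 *.
set Y := (2 * k) ^+ m.+2 in H3 *; set W := K%:R ^+ m.+2 in H1 H2 H3 H4 H5 *.
set V := K%:R ^+ m.+3 in H4 H5 *; set O := (Omega _ _)%:R in H1 *.
have -> : O - (V * (2 * (I1 + I2)) + Y * (2 * k - 8 / 3 * s)) =
  (O - 2 * (M1 + M2)) + 2 * ((M1 - T1) + (M2 - T2 - Y * (k - 4 / 3 * s))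
    + (T1 - V * I1) + (T2 - V * I2)).
  by clear; clearbody V O Y; move: M1 M2 T1 T2 I1 I2 => M1 M2 T1 T2 I1 I2; field.
have -> : (C1 + 2 * (C2 + `|C3| * 3 ^+ m.+2 + C4 + C5)) * W =
  C1 * W + 2 * (C2 * W + `|C3| * 3 ^+ m.+2 * W + C4 * W + C5 * W) by ring.
move: H1 H2 H3 H4 H5; rewrite !ler_norml.
move: (O - _) (M1 - _) (M2 - _ - _) (T1 - _) (T2 - _) (C1 * W) (C2 * W)
  (`|C3| * 3 ^+ m.+2 * W) (C4 * W) (C5 * W) => *; lra.
Qed.

Lemma pow_near1 y j : (0 <= y <= 2) -> `|y ^+ j - 1| <= (2 ^+ j - 1) * `|y - 1|.
Proof.
move=> /andP[y0 y2]; elim: j => [|j IH]; first by rewrite !expr0 !subrr normr0 mul0r.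
have -> : y ^+ j.+1 - 1 = y * (y ^+ j - 1) + (y - 1) by rewrite exprS; ring.
apply: (le_trans (ler_normD _ _)); rewrite normrM (ger0_norm y0).
have : y * `|y ^+ j - 1| <= 2 * ((2 ^+ j - 1) * `|y - 1|) by apply: ler_pM.
by rewrite exprS; lra.
Qed.

(** [w] and [y] stand for [K / Q] and [sqrt (k / Q)], both within [1/Q] of 1, and [e] for the
    counting error. The identity isolates the cost of replacing [K] and [k] by [Q]. *)
Lemma remainder_split m y w e I u Q : u != 0 -> Q = u ^+ 2 ->
  (e + ((w * Q) ^+ m.+3 * I + (2 * (y ^+ 2 * Q)) ^+ m.+2 * (2 * (y ^+ 2 * Q) - 8 / 3 * (y * u))))
    / (2 * Q) ^+ m.+3 - (2 ^- m.+3 * I + 1 - 4 / (3 * u)) =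
  e / (2 * Q) ^+ m.+3 + 2 ^- m.+3 * I * (w ^+ m.+3 - 1) + (y ^+ m.+3.*2 - 1)
  - 4 / 3 / u * (y ^+ m.+2.*2.+1 - 1).
Proof.
move=> u0 Qu.
have -> : y ^+ m.+3.*2 = y ^+ 2 * (y ^+ 2) ^+ m.+2 by rewrite -mul2n exprM exprS.
have -> : y ^+ m.+2.*2.+1 = y * (y ^+ 2) ^+ m.+2 by rewrite -mul2n exprS exprM.
have S3 x : x ^+ m.+3 = x * x ^+ m.+2 by rewrite exprS.
rewrite !S3 !exprMn Qu.
have T0 : 2 ^+ m.+2 != 0 :> R by rewrite expf_neq0.
have U0 : (u ^+ 2) ^+ m.+2 != 0 by rewrite !expf_neq0.
move: (2 ^+ m.+2) ((u ^+ 2) ^+ m.+2) T0 U0 ((y ^+ 2) ^+ m.+2) (w ^+ m.+2) => T U T0 U0 Y W.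
by field; rewrite U0 T0 u0.
Qed.

Lemma remainder_split_le m y w e I u Q C x : 1 <= Q -> 1 <= u ->
  `|w - 1| <= Q^-1 -> `|y - 1| <= Q^-1 -> 0 <= x <= Q -> `|e| <= C * x ^+ m.+2 ->
  `|e / (2 * Q) ^+ m.+3 + 2 ^- m.+3 * I * (w ^+ m.+3 - 1) + (y ^+ m.+3.*2 - 1)
    - 4 / 3 / u * (y ^+ m.+2.*2.+1 - 1)|
  <= (`|C| + `|I| + 2 ^+ m.+3.*2 + 4 / 3 * 2 ^+ (m.+2.*2.+1)) / Q.
Proof.
move=> Q1 u1 w1 y1 /andP[x0 xQ] HO.
have Q0 : 0 < Q by lra.
have QV : 0 < Q^-1 by rewrite invr_gt0.
have QV1 : Q^-1 <= 1 by rewrite invf_le1.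
have y2 : 0 <= y <= 2 by move: y1; rewrite ler_norml => /andP[a b]; apply/andP; split; lra.
have w2 : 0 <= w <= 2 by move: w1; rewrite ler_norml => /andP[a b]; apply/andP; split; lra.
have p2 j : 1 <= 2 ^+ j :> R by rewrite exprn_ege1//; lra.
have pw z j : 0 <= z <= 2 -> `|z - 1| <= Q^-1 -> `|z ^+ j - 1| <= 2 ^+ j / Q.
  move=> z2 z1; apply: (le_trans (pow_near1 _ z2)).
  by have := p2 j; move: (2 ^+ j) => T T1; apply: ler_pM => //; lra.
have B1 : `|e / (2 * Q) ^+ m.+3| <= `|C| / Q.
  have Q20 : 0 < (2 * Q) ^+ m.+3 by rewrite exprn_gt0//; lra.
  rewrite normrM normfV (gtr0_norm Q20) ler_pdivrMr//; apply: (le_trans HO).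
  apply: (@le_trans _ _ (`|C| * Q ^+ m.+2)).
    apply: (@le_trans _ _ (`|C| * x ^+ m.+2)); first by rewrite ler_wpM2r ?ler_norm// exprn_ge0.
    by rewrite ler_wpM2l// lerXn2r// nnegrE//; lra.
  have -> : `|C| / Q * (2 * Q) ^+ m.+3 = 2 ^+ m.+3 * (`|C| * Q ^+ m.+2).
    rewrite exprMn [Q ^+ m.+3]exprS; move: (2 ^+ _) (Q ^+ m.+2) => T W.
    by field; rewrite gt_eqF.
  by rewrite ler_peMl ?p2// mulr_ge0// exprn_ge0//; lra.
have B2 : `|2 ^- m.+3 * I * (w ^+ m.+3 - 1)| <= `|I| / Q.
  rewrite !normrM normfV normrX normr_nat.
  have := pw _ m.+3 w2 w1; have := p2 m.+3; set T := 2 ^+ _ => T1 h.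
  by rewrite mulrAC mulrC ler_wpM2l// ler_pdivrMl//; lra.
have B4 : `|4 / 3 / u * (y ^+ m.+2.*2.+1 - 1)| <= 4 / 3 * 2 ^+ m.+2.*2.+1 / Q.
  have uV1 : u^-1 <= 1 by rewrite invf_le1//; lra.
  have u0V : 0 < u^-1 by rewrite invr_gt0; lra.
  rewrite normrM -[leRHS]mulrA; apply: ler_pM => //; last exact: pw.
  by rewrite ger0_norm; [|rewrite divr_ge0//]; lra.
rewrite [leRHS]mulrDl.
apply: (le_trans (ler_normB _ _)); apply: lerD => //.
rewrite [leRHS]mulrDl; apply: (le_trans (ler_normD _ _)); apply: lerD; last exact: pw.
by rewrite [leRHS]mulrDl; apply: (le_trans (ler_normD _ _)); apply: lerD.
Qed.

Lemma floor_ratio K Q x : 0 < Q -> K%:R <= Q < K.+1%:R -> 0 <= x <= 1 -> `|(K%:R + x) / Q - 1| <= Q^-1.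
Proof.
move=> Q0 /andP[KQ QK] /andP[x0 x1].
have QV : 0 <= Q^-1 by rewrite invr_ge0 ltW.
have -> : (K%:R + x) / Q - 1 = (K%:R + x - Q) / Q by rewrite [RHS]mulrBl divff// gt_eqF.
rewrite normrM (ger0_norm QV) ler_piMl// ler_norml.
by move: QK; rewrite -natr1; lra.
Qed.

Definition remainder n Q : R := (Omega n Q)%:R / (2 * Q) ^+ n
  - (2 ^- n * (\int[lebesgue_measure]_(t in [set: R]) phi n.-1 t) + 1 - 4 / (3 * Num.sqrt Q)).

Lemma remainder_large m : exists C : R, \forall Q \near +oo_R, `|remainder m.+3 Q| <= C / Q.
Proof.
have [C [K1 H]] := Omega_asymptotics m.
rewrite /remainder /=; set I := \int[_]_(_ in _) _ in H *.
exists (`|C| + `|I| + 2 ^+ m.+3.*2 + 4 / 3 * 2 ^+ (m.+2.*2.+1)).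
near=> Q.
have Q1 : 1 <= Q by near: Q; exact: nbhs_pinfty_ge.
have QK1 : K1 + 1 <= Q by near: Q; apply: nbhs_pinfty_ge; exact: num_real.
pose K := Num.truncn Q.
have /andP[KQ QK] : K%:R <= Q < K.+1%:R by apply: truncn_itv; lra.
have KQ' : K1 <= K%:R by move: QK; rewrite -natr1; lra.
pose k : R := K%:R + 2^-1; pose s := Num.sqrt k.
have k0 : 0 < k by rewrite /k; have : 0 <= K%:R :> R by []; lra.
have s0 : 0 < s by rewrite sqrtr_gt0.
have ks : k = s ^+ 2 by rewrite sqr_sqrtr// ltW.
have := H K Q k s KQ' _ erefl s0 ks; rewrite KQ QK => /(_ isT) HO.
pose u := Num.sqrt Q; have u0 : 0 < u by rewrite sqrtr_gt0; lra.
have Qu : Q = u ^+ 2 by rewrite sqr_sqrtr//; lra.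
pose y := s / u; pose w := K%:R / Q.
have y0 : 0 < y by rewrite divr_gt0.
have Q0 : Q != 0 by rewrite gt_eqF//; lra.
have yk : y ^+ 2 = k / Q by rewrite /y expr_div_n -ks -Qu.
have Qk : `|k / Q - 1| <= Q^-1 by apply: floor_ratio; rewrite ?KQ//; lra.
have w1 : `|w - 1| <= Q^-1 by rewrite /w -[K%:R]addr0 floor_ratio ?KQ//; lra.
have y1 : `|y - 1| <= Q^-1.
  apply: le_trans Qk; rewrite -yk (_ : y ^+ 2 - 1 = (y - 1) * (y + 1)); last by ring.
  by rewrite normrM ler_peMr// ger0_norm; lra.
set E := (Omega _ _)%:R - _ in HO.
have EQ : (Omega m.+3 Q)%:R / (2 * Q) ^+ m.+3 - (2 ^- m.+3 * I + 1 - 4 / (3 * u)) =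
  E / (2 * Q) ^+ m.+3 + 2 ^- m.+3 * I * (w ^+ m.+3 - 1) + (y ^+ m.+3.*2 - 1)
  - 4 / 3 / u * (y ^+ m.+2.*2.+1 - 1).
  rewrite -(remainder_split m y w E I (lt0r_neq0 u0) Qu) yk /w /y.
  by rewrite !divfK ?(lt0r_neq0 u0)// /E subrK.
rewrite EQ; apply: (@remainder_split_le _ _ _ _ _ _ _ _ K%:R) => //; last by rewrite KQ andbT.
by rewrite -sqrtr1 ler_wsqrtr.
Unshelve. all: by end_near.
Qed.

End LargeDegree.

(** * Degree two *)

Section EulerGamma.
Context (R : realType).
Implicit Types (x y : R).

Lemma ln_le_sub1 x : 0 < x -> ln x <= x - 1.
Proof. by move=> x0; rewrite -[in ln x](subrK 1 x) addrC le_ln1Dx//; lra. Qed.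

Lemma ln_ge_sub1 x : 0 < x -> 1 - x^-1 <= ln x.
Proof.
move=> x0; have := @ln_le_sub1 x^-1; rewrite invr_gt0 lnV// => /(_ x0); lra.
Qed.

Let a (k : nat) : R := series harmonic k - ln k%:R.

(** This is [1/(k+1) <= ln ((k+1)/k) <= 1/k]. The decrements telescope, giving both the convergence
    and the rate [1/k]. *)
Lemma gamma_step k : (0 < k)%N -> a k - (k%:R^-1 - k.+1%:R^-1) <= a k.+1 <= a k.
Proof.
move=> k0; have kp : 0 < k%:R :> R by rewrite ltr0n.
have kS : k.+1%:R = k%:R + 1 :> R by rewrite natr1.
have q0 : 0 < k.+1%:R / k%:R :> R by rewrite divr_gt0.
have -> : a k.+1 = a k + k.+1%:R^-1 - ln (k.+1%:R / k%:R).
  rewrite /a ln_div// ?posrE ?ltr0n//.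
  have -> : series harmonic k.+1 = series harmonic k + k.+1%:R^-1 :> R.
    by rewrite /series/= big_nat_recr.
  by move: (k.+1%:R^-1) (series harmonic k) (ln _) (ln _) => x y z w; ring.
have := ln_le_sub1 q0; have := ln_ge_sub1 q0.
have -> : k.+1%:R / k%:R - 1 = k%:R^-1 :> R by rewrite kS; field; rewrite gt_eqF.
have -> : 1 - (k.+1%:R / k%:R)^-1 = k.+1%:R^-1 :> R.
  by rewrite kS; field; rewrite !gt_eqF//; lra.
move: (a k) (k%:R^-1) (k.+1%:R^-1) (ln _) => w x y z h1 h2.
by apply/andP; split; lra.
Qed.

Lemma gamma_mono k l : (0 < k)%N -> (k <= l)%N ->
  a k - (k%:R^-1 - l%:R^-1) <= a l <= a k.
Proof.
move=> k0; elim: l => [|l IH]; first by rewrite leqn0 => /eqP k0'; rewrite k0' in k0.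
rewrite leq_eqVlt => /predU1P[->|kl]; first by rewrite subrr subr0 lexx.
have l0 : (0 < l)%N by apply: leq_trans k0 _.
have := gamma_step l0; have := IH kl.
move: (a l.+1) (a l) (a k) (k%:R^-1) (l%:R^-1) (l.+1%:R^-1) => x y z w v u.
move=> /andP[h1 h2] /andP[h3 h4].
by apply/andP; split; lra.
Qed.

Lemma gamma_cvg : cvgn a.
Proof.
apply: (@near_nonincreasing_is_cvgn _ _ 0).
  by exists 1%N => // k /= k0 l kl; have /andP[] := gamma_mono k0 kl.
near=> k; have k0 : (0 < k)%N by near: k; exact: nbhs_infty_gt.
have /andP[h _] := gamma_mono (isT : (0 < 1)%N) k0.
apply: le_trans h; rewrite /a ln1 subr0 /series/= big_nat1 /harmonic/=.
have : 0 <= k%:R^-1 :> R by rewrite invr_ge0.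
rewrite invr1; lra.
Unshelve. all: by end_near.
Qed.

Lemma gamma_bound k : (0 < k)%N ->
  `|series harmonic k - ln k%:R - euler_gamma R| <= k%:R^-1.
Proof.
move=> k0; rewrite -/(a k) /euler_gamma.
have h1 : limn a <= a k.
  apply: limr_le; first exact: gamma_cvg.
  by exists k => // l /= kl; have /andP[] := gamma_mono k0 kl.
have h2 : a k - k%:R^-1 <= limn a.
  apply: limr_ge; first exact: gamma_cvg.
  exists k => // l /= kl; have /andP[h _] := gamma_mono k0 kl.
  by apply: le_trans h; rewrite lerB// gerBl invr_ge0.
rewrite -/a ler_norml; move: h1 h2; rewrite -/a => h1 h2.
have : 0 <= k%:R^-1 :> R by rewrite invr_ge0.
by move=> k1; apply/andP; split; lra.
Qed.

End EulerGamma.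

(** * Dirichlet's divisor problem *)

Section DivisorSum.

(** The number of pairs of positive integers with product at most [N], that is the summatory
    function of the number of divisors. *)
Definition divsum N : nat := (\sum_(i < N) N %/ i.+1)%N.

Lemma sum_ltn n q : (\sum_(j < n) (j < q))%N = minn n q.
Proof.
elim: n => [|n IH]; first by rewrite big_ord0 min0n.
by rewrite big_ord_recr/= IH; case: ltnP; lia.
Qed.

Lemma divn_sum N i : (\sum_(j < N) (i.+1 * j.+1 <= N))%N = (N %/ i.+1)%N.
Proof.
under eq_bigr do rewrite mulnC -leq_divRL//.
by rewrite sum_ltn (minn_idPr _)// leq_div.
Qed.

(** A pair with product at most [N] has a coordinate at most [u]. The [u ^ 2] pairs with both
    coordinates at most [u] all qualify and are counted twice on the right. *)
Lemma divsum_hyperbola N u : (u ^ 2 <= N < u.+1 ^ 2)%N ->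
  (divsum N + u ^ 2 = (\sum_(i < u) N %/ i.+1).*2)%N.
Proof.
move=> /andP[uN Nu].
have uN' : (u <= N)%N by nia.
pose S := (\sum_(i < N) \sum_(j < N) (i < u) * (i.+1 * j.+1 <= N))%N.
have SE : S = (\sum_(i < u) N %/ i.+1)%N.
  rewrite /S (big_ord_widen_cond N xpredT (fun i => N %/ i.+1)%N uN') [RHS]big_mkcond/=.
  apply: eq_bigr => i _; rewrite -big_distrr/= divn_sum.
  by case: (i < u)%N; rewrite ?mul1n ?mul0n.
have SE' : S = (\sum_(i < N) \sum_(j < N) (j < u) * (i.+1 * j.+1 <= N))%N.
  by rewrite /S exchange_big/=; apply: eq_bigr => i _; apply: eq_bigr => j _; rewrite [(j.+1 * _)%N]mulnC.
have -> : (u ^ 2 = \sum_(i < N) \sum_(j < N) (i < u) * (j < u))%N.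
  under eq_bigr do rewrite -big_distrr/= sum_ltn.
  by rewrite -big_distrl/= sum_ltn (minn_idPr _).
rewrite -SE -addnn {2}SE' /divsum.
under eq_bigr do rewrite -divn_sum.
rewrite -!big_split/=; apply: eq_bigr => i _; rewrite -!big_split/=; apply: eq_bigr => j _.
case: (ltnP i u) => iu; case: (ltnP j u) => ju; rewrite ?mul1n ?mul0n ?addn0 ?add0n ?addnn//.
  have -> : (i.+1 * j.+1 <= N)%N by nia.
  by [].
suff -> : (i.+1 * j.+1 <= N)%N = false by [].
by apply/negbTE; rewrite -ltnNge; nia.
Qed.

End DivisorSum.

Section DivisorAsymptotics.
Context (R : realType).
Implicit Types (x y s : R).

(** With [u] the integer part of [s], the hyperbola identity gives [2 N H_u - u^2] up to [O(s)].
    Replacing [H_u] by [ln u] plus Euler's constant, [ln u] by [ln N / 2] and [u^2] by [N] costs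
    [O(s)] each time. *)
Lemma divsum_asymptotics : exists C : R, forall N s, (0 < N)%N -> 0 < s -> N%:R = s ^+ 2 ->
  `|(divsum N)%:R - (N%:R * ln N%:R + (2 * euler_gamma R - 1) * N%:R)| <= C * s.
Proof.
exists 20 => N s N0 s0 Ns.
have s1 : 1 <= s.
  have : 1 <= N%:R :> R by rewrite ler1n.
  nra.
pose u := Num.truncn s.
have /andP[us su] : u%:R <= s < u.+1%:R by apply: truncn_itv; lra.
have u0 : (0 < u)%N by rewrite lt0n; apply/eqP => u0; rewrite u0 in su; lra.
have up : 1 <= u%:R :> R by rewrite ler1n.
have hyp : (u ^ 2 <= N < u.+1 ^ 2)%N.
  rewrite -(ler_nat R) -(ltr_nat R) !natrX Ns; apply/andP; split.
    by rewrite lerXn2r// nnegrE; lra.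
  by rewrite ltr_pXn2r// nnegrE; lra.
have := divsum_hyperbola hyp => /(congr1 (fun n => n%:R : R)).
rewrite natrD natrX -muln2 natrM => hyp'.
have gb := gamma_bound R u0; set g := euler_gamma R in gb *.
have HB : `|(\sum_(i < u) N %/ i.+1)%N%:R - N%:R * series harmonic u| <= u%:R :> R.
  rewrite natr_sum /series/= big_mkord mulr_sumr -sumrB.
  apply: (le_trans (ler_norm_sum _ _ _)).
  rewrite -[leRHS](_ : \sum_(i < u) 1 = _); last by rewrite sumr_const card_ord.
  apply: ler_sum => i _; rewrite /harmonic/=.
  have ip : 0 < i.+1%:R :> R by [].
  rewrite -[_ / _]/(N%:R / i.+1%:R).
  have e1 : (N %/ i.+1)%:R <= N%:R / i.+1%:R :> R.
    by rewrite ler_pdivlMr// -natrM ler_nat leq_divM.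
  have e2 : N%:R / i.+1%:R < (N %/ i.+1)%:R + 1 :> R.
    by rewrite natr1 ltr_pdivrMr// -natrM ltr_nat; exact: ltn_ceil.
  move: (_ / _) e1 e2 => x e1 e2; rewrite ler_norml; apply/andP; split; lra.
have lnN : ln N%:R = 2 * ln s by rewrite Ns lnXn// mulr_natl.
have lnu : `|ln u%:R - ln s| <= 2 / s.
  have q0 : 0 < u%:R / s by rewrite divr_gt0//; lra.
  rewrite -ln_div ?posrE//; last lra.
  have h1 := ln_le_sub1 q0; have h2 := ln_ge_sub1 q0.
  have su2 : s < 2 * u%:R by move: su; rewrite -natr1; lra.
  have h3 : u%:R / s <= 1 by rewrite ler_pdivrMr; lra.
  have h4 : (u%:R / s)^-1 - 1 <= 2 / s.
    rewrite invf_div ler_pdivlMr// mulrBl mul1r mulrAC lerBlDr ler_pdivrMr; last lra.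
    by move: su; rewrite -natr1; nra.
  have h5 : 0 < 2 / s by rewrite divr_gt0.
  by rewrite ler_norml; apply/andP; split; lra.
set P : R := (\sum_(i < u) _)%N%:R in HB hyp'; set H := series harmonic u in HB gb.
have -> : (divsum N)%:R - (N%:R * ln N%:R + (2 * g - 1) * N%:R) =
  2 * (P - N%:R * H) + 2 * (s ^+ 2 * (H - ln u%:R - g)) + 2 * (s ^+ 2 * (ln u%:R - ln s))
  + (s ^+ 2 - u%:R ^+ 2).
  have -> : (divsum N)%:R = P * 2 - u%:R ^+ 2 by rewrite -hyp' addrK.
  by rewrite lnN Ns; ring.
have b2 : `|s ^+ 2 * (H - ln u%:R - g)| <= 2 * s.
  rewrite normrM (ger0_norm (sqr_ge0 s)).
  apply: (@le_trans _ _ (s ^+ 2 * u%:R^-1)); first by rewrite ler_wpM2l ?sqr_ge0.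
  by rewrite ler_pdivrMr; [move: su; rewrite -natr1; nra|lra].
have b3 : `|s ^+ 2 * (ln u%:R - ln s)| <= 2 * s.
  rewrite normrM (ger0_norm (sqr_ge0 s)).
  apply: (@le_trans _ _ (s ^+ 2 * (2 / s))); first by rewrite ler_wpM2l ?sqr_ge0.
  by rewrite le_eqVlt; apply/orP; left; apply/eqP; field; rewrite gt_eqF.
have b4 : `|s ^+ 2 - u%:R ^+ 2| <= 2 * s.
  by move: su; rewrite -natr1 ler_norml => su; apply/andP; split; nra.
move: HB b2 b3 b4; rewrite !ler_norml.
move: (P - _) (s ^+ 2 * _) (s ^+ 2 * _) (s ^+ 2 - _) => *; lra.
Qed.

End DivisorAsymptotics.

(** * Exact counts of quadratic polynomials *)

Section QuadraticCounts.

Lemma sum_leqn n q : (\sum_(j < n) (q <= j))%N = (n - q)%N.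
Proof.
elim: n => [|n IH]; first by rewrite big_ord0.
by rewrite big_ord_recr/= IH; case: leqP; lia.
Qed.

Lemma sum_eqn_le n q : (\sum_(j < n) (j == q :> nat) <= 1)%N.
Proof.
suff -> : (\sum_(j < n) (j == q :> nat) = (q < n))%N by case: ltnP.
elim: n => [|n IH]; first by rewrite big_ord0.
by rewrite big_ord_recr/= IH; case: ltngtP; lia.
Qed.

Lemma sum_lz K (F : nat -> nat) :
  (\sum_(i < K.*2.+1) F `|lz i| = F 0 + (\sum_(j < K) F j.+1).*2)%N.
Proof.
rewrite -(big_mkord xpredT (fun i => F `|i%:Z - K%:Z|%N)).
rewrite (@big_cat_nat _ _ _ K)//=; last by lia.
rewrite -{3}[K]add0n big_addn (_ : (_ - _)%N = K.+1); last by lia.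
rewrite [in X in (_ + X)%N]big_mkord big_ord_recl/= add0n subrr -addnn.
rewrite addnCA; congr (_ + _)%N.
congr (_ + _)%N.
  rewrite big_nat_rev/= add0n big_mkord; apply: eq_bigr => i _; congr F.
  by have := ltn_ord i; lia.
by apply: eq_bigr => i _; congr F; rewrite /bump leq0n; lia.
Qed.

Lemma sum_pairs (T : finType) (P : rel T) :
  (\sum_i \sum_j P i j)%N = #|[set p : T * T | P p.1 p.2]%SET|.
Proof. by rewrite pair_big -sum1dep_card [RHS]big_mkcond. Qed.

Definition quad K (i j : 'I_K.*2.+1) : 2.-tuple 'I_K.*2.+1 := [tuple i; j].

Definition disc K (i j : 'I_K.*2.+1) : int := lz j ^+ 2 - 4 * lz i.

Lemma mpol_quad K (i j : 'I_K.*2.+1) :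
  mpol (quad i j) = 'X^2 + ((lz i)%:P + lz j *: 'X).
Proof.
by rewrite /mpol 2!big_ord_recl big_ord0 addr0 !(tnth_nth i)/= expr0 expr1 alg_polyC.
Qed.

Lemma monic_linear (f : {poly int}) : f \is monic -> size f = 2%N -> f = 'X + (f`_0)%:P.
Proof.
move=> fm sf; apply/polyP => -[|[|k]]; rewrite coefD coefX coefC ?add0r ?addr0//=.
  by move: fm; rewrite monicE lead_coefE sf => /eqP.
by rewrite nth_default ?sf// addr0.
Qed.

Lemma reducible_quadP K (i j : 'I_K.*2.+1) : reducible (mpol (quad i j)) <->
  exists r s : int, lz i = r * s /\ lz j = - (r + s).
Proof.
split.
  move=> [f [g [fm gm f1 g1 E]]].
  have := size_mpol (quad i j); rewrite E size_monicM ?monic_neq0// => sfg.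
  have sf : size f = 2%N by lia.
  have sg : size g = 2%N by lia.
  exists (- f`_0), (- g`_0); move: E.
  rewrite (monic_linear fm sf) (monic_linear gm sg) !coefD !coefX !coefC !add0r/=.
  move: (f`_0) (g`_0) => r s; rewrite mpol_quad => /polyP E.
  have E0 := E 0; have E1 := E 1%N; move: E0 E1.
  have -> : ('X + r%:P) * ('X + s%:P) = 'X^2 + ((r * s)%:P + (r + s) *: 'X) :> {poly int}.
    by rewrite scalerDl -!mul_polyC polyCM; ring.
  rewrite !coefD !coefXn !coefC !coefZ !coefX/= !mulr0 !mulr1 !addr0 !add0r => -> ->.
  by split; ring.
move=> [r [s [ci cj]]]; exists ('X - r%:P), ('X - s%:P).
rewrite !monicXsubC !size_XsubC; split=> //.
rewrite mpol_quad ci cj scaleNr scalerDl -!mul_polyC polyCM; ring.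
Qed.

(** Discriminant 0 is included: the polynomial is then the square of an integral linear one, hence
    reducible, and gives nothing to [Omega]. *)
Definition parabola K := (\sum_(i < K.*2.+1) \sum_(j < K.*2.+1) (disc i j <= 0)%R)%N.

Definition splitting K :=
  (\sum_(i < K.*2.+1) \sum_(j < K.*2.+1) ((0 < disc i j)%R && `[< reducible (mpol (quad i j)) >]))%N.

Lemma factor_le (r s k : int) : `|r * s| <= k -> `|r + s| <= k -> `|r| <= k.
Proof.
have [->|s0] := eqVneq s 0; first by rewrite addr0.
move=> rs _; apply: le_trans rs; rewrite normrM ler_peMr//.
by move: s0; lia.
Qed.

Definition root_pair K (i j : 'I_K.*2.+1) : bool :=
  [&& i != j, `|lz i * lz j| <= K%:Z & `|lz i + lz j| <= K%:Z].

(** By Vieta a split polynomial with positive discriminant is an unordered pair of distinct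
    integers; the factor 2 is for its two orders. The bounds on the coefficients become those on
    product and sum in [root_pair], and they force both roots into [[-K, K]] by [factor_le]. *)
Lemma splitting_pairs K : (splitting K).*2 = (\sum_(i < K.*2.+1) \sum_(j < K.*2.+1) root_pair i j)%N.
Proof.
pose Q (i j : 'I_K.*2.+1) := (`|lz i * lz j| <= K%:Z) && (`|lz i + lz j| <= K%:Z).
pose f (p : 'I_K.*2.+1 * 'I_K.*2.+1) := (enc K (lz p.1 * lz p.2), enc K (- (lz p.1 + lz p.2))).
have SL : splitting K = (\sum_(i < K.*2.+1) \sum_(j < K.*2.+1) ((i < j) && Q i j))%N.
  rewrite /splitting !sum_pairs.
  rewrite -[RHS](@card_in_imset _ _ f); last first.
    move=> [i j] [i' j']; rewrite !inE/= => /andP[ij /andP[q1 q2]] /andP[ij' /andP[q1' q2']].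
    rewrite /f/= => -[/(congr1 (@lz K)) e1 /(congr1 (@lz K)) e2].
    rewrite !lz_enc ?normrN// in e1 e2.
    suff [h1 h2] : lz i = lz i' /\ lz j = lz j' by rewrite -(enc_lz i) -(enc_lz j) h1 h2 !enc_lz.
    have {}ij : lz i < lz j by rewrite /lz; lia.
    have {}ij' : lz i' < lz j' by rewrite /lz; lia.
    move: (lz i) (lz j) (lz i') (lz j') ij ij' e1 e2 => a b c d ab cd e1 e2.
    have : (a - c) * (a - d) = 0.
      have -> : d = a + b - c by lia.
      have -> : b = c + d - a by lia.
      by move: e1; lia.
    by move/eqP; rewrite mulf_eq0 => /orP[]; lia.
  apply: eq_card => -[i j]; rewrite inE/=; apply/idP/imsetP.
    move=> /andP[D0 /asboolP/reducible_quadP[r [s [ri sj]]]].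
    wlog rs : r s ri sj / r < s.
      move=> H; have [rs|sr|rs] := ltgtP r s; first exact: (H r s).
        by apply: (H s r) => //; [rewrite mulrC|rewrite addrC].
      by move: D0; rewrite /disc ri sj rs; lia.
    have iK := lz_bound i; have jK := lz_bound j; rewrite ri in iK; rewrite sj normrN in jK.
    have rK : `|r| <= K%:Z by apply: factor_le iK jK.
    have sK : `|s| <= K%:Z by apply: (factor_le (s := r)); rewrite 1?mulrC 1?addrC.
    exists (enc K r, enc K s).
      rewrite inE/= /Q !lz_enc// iK jK !andbT.
      by have := lz_enc rK; have := lz_enc sK; rewrite /lz; lia.
    by rewrite /f/= !lz_enc// -ri -sj !enc_lz.
  move=> [[r s]]; rewrite inE/= => /andP[rs /andP[q1 q2]] -[-> ->].
  apply/andP; split.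
    rewrite /disc !lz_enc ?normrN//; have : lz r < lz s by rewrite /lz; lia.
    by move: (lz r) (lz s) => a b ab; nia.
  by apply/asboolP/reducible_quadP; exists (lz r), (lz s); rewrite !lz_enc ?normrN.
rewrite -addnn {2}SL exchange_big/= SL -big_split/=; apply: eq_bigr => i _.
rewrite -big_split/=; apply: eq_bigr => j _.
rewrite /root_pair -/(Q i j) (_ : Q j i = Q i j); last by rewrite /Q mulrC addrC.
rewrite (_ : (i != j) = (i < j)%N || (j < i)%N); last by rewrite -neq_ltn.
by case: (Q i j); rewrite ?andbF//!andbT; case: ltngtP.
Qed.

(** For linear coefficient [b] the constant term runs from the ceiling of [b^2 / 4], written
    [(b^2 + 3) %/ 4], up to [K]; truncated subtraction returns 0 when there is none. The rows [b]
    and [- b] are grouped. *)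
Lemma parabola_sum K : parabola K =
  (K.+1 + (\sum_(j < K) (K.+1 - (j.+1 * j.+1 + 3) %/ 4)).*2)%N.
Proof.
rewrite /parabola exchange_big/=.
rewrite -[RHS](_ : (\sum_(j < K.*2.+1) (fun j => K.+1 - (j * j + 3) %/ 4) `|lz j| = _)%N); last first.
  by rewrite (sum_lz K (fun m => K.+1 - (m * m + 3) %/ 4)%N).
apply: eq_bigr => j _ /=; set n := (`|lz j| * `|lz j|)%N.
have -> : (K.+1 - (n + 3) %/ 4 = K.*2.+1 - (K + (n + 3) %/ 4))%N by lia.
rewrite -sum_leqn; apply: eq_bigr => i _; congr nat_of_bool; rewrite /disc.
have -> : lz j ^+ 2 = n%:Z by rewrite PoszM abszE -expr2 real_normK ?num_real.
by rewrite /lz; move: n => n; apply/idP/idP; lia.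
Qed.

Lemma sum_lz_eq_le K m : (0 < m)%N -> (\sum_(i < K.*2.+1) (`|lz i|%N == m) <= 2)%N.
Proof.
move=> m0; rewrite (sum_lz K (fun k => k == m)%N) eq_sym (gtn_eqF m0) add0n.
rewrite -[2%N]/(1.*2) leq_double; apply: leq_trans (sum_eqn_le K m.-1).
by apply: leq_sum => j _; case: eqP => // <-; rewrite eqxx.
Qed.

(** The pairs with [|r s| <= K] number [4 K + 4 divsum K + 1]: the two axes and four quadrants.
    [root_pair] rejects those with [r = s], at most [2 u + 1], and those with [|r + s| > K]. The
    latter force one of [|r|], [|s|] to be 1 and the other to be [K], a bounded number of pairs. *)
Lemma splitting_bound K u : (0 < K)%N -> (K < u.+1 ^ 2)%N ->
  ((splitting K).*2 <= 4 * K + 4 * divsum K + 1 /\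
   4 * K + 4 * divsum K <= (splitting K).*2 + u.*2 + 10)%N.
Proof.
move=> K0 Ku; rewrite splitting_pairs.
have T : (\sum_(i < K.*2.+1) \sum_(j < K.*2.+1) (`|lz i| * `|lz j| <= K) = 4 * K + 4 * divsum K + 1)%N.
  under eq_bigr do rewrite (sum_lz K (fun m => `|lz _| * m <= K)%N).
  rewrite (sum_lz K (fun m => (m * 0 <= K)%N + (\sum_(j < K) (m * j.+1 <= K)%N).*2)%N).
  rewrite muln0 leq0n.
  under [in X in (_ + X)%N]eq_bigr do rewrite muln0 leq0n divn_sum.
  rewrite big_split/= !sum_nat_const !card_ord !muln1.
  have -> : (\sum_(i < K) (K %/ i.+1).*2 = (divsum K).*2)%N.
    by rewrite -muln2 big_distrl/=; apply: eq_bigr => i _; rewrite muln2.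
  by lia.
split.
  rewrite -T; apply: leq_sum => i _; apply: leq_sum => j _.
  case: (leqP (`|lz i| * `|lz j|)%N K) => h; first exact: leq_b1.
  rewrite /root_pair.
  suff -> : (`|lz i * lz j| <= K%:Z) = false by rewrite andbF.
  by apply/negbTE; rewrite -ltNge normrM; lia.
apply: (@leq_trans (\sum_(i < K.*2.+1) \sum_(j < K.*2.+1)
  (root_pair i j
   + ((i == j) * (`|lz i| * `|lz i| <= K)
   + ((`|lz i|%N == 1) * (`|lz j|%N == K) + (`|lz i|%N == K) * (`|lz j|%N == 1)))))).
  apply: (@leq_trans (4 * K + 4 * divsum K + 1)); first by rewrite leq_addr.
  rewrite -T; apply: leq_sum => i _; apply: leq_sum => j _.
  have iK := lz_bound i; have jK := lz_bound j.
  case: (leqP (`|lz i| * `|lz j|)%N K) => // h; rewrite /root_pair; case: (eqVneq i j) h => [->|ij] h /=.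
    by rewrite h.
  case: (leP `|lz i * lz j| K%:Z) => h1; last by move: h h1; rewrite normrM; lia.
  case: (leP `|lz i + lz j| K%:Z) => //= h2.
  suff : ((`|lz i|%N == 1) && (`|lz j|%N == K)) || ((`|lz i|%N == K) && (`|lz j|%N == 1)).
    by rewrite mul0n !add0n !mulnb => /orP[->|->]; rewrite ?addn1 ?add1n.
  have : (K < `|lz i| + `|lz j|)%N by move: h2; lia.
  have : (`|lz i| <= K)%N by lia.
  have : (`|lz j| <= K)%N by lia.
  move: (`|lz i|%N) (`|lz j|%N) h => a b h bK aK ab.
  have [a1|a1] := eqVneq a 1%N; first by rewrite /= (_ : b = K) ?eqxx//; lia.
  have [b1|b1] := eqVneq b 1%N; first by rewrite andbT /=; apply/eqP; lia.
  by exfalso; nia.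
under eq_bigr do rewrite !big_split/=.
rewrite !big_split/= -!addnA leq_add2l.
have h1 : (\sum_(i < K.*2.+1) \sum_(j < K.*2.+1) (i == j) * (`|lz i| * `|lz i| <= K) <= u.*2.+1)%N.
  rewrite (eq_bigr (fun i : 'I_K.*2.+1 => (`|lz i| * `|lz i| <= K)%N : nat)); last first.
    by move=> i _; rewrite (bigD1 i)//= eqxx mul1n big1 ?addn0// => j /negbTE; rewrite eq_sym => ->.
  rewrite (sum_lz K (fun m => m * m <= K)%N) leq0n -[u.*2.+1]add1n leq_add2l leq_double.
  apply: (@leq_trans (\sum_(j < K) (j < u))); last by rewrite sum_ltn geq_minr.
  apply: leq_sum => j _; case: (leqP (j.+1 * j.+1)%N K) => // jK; case: (ltnP j u) => // uj; exfalso.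
  by move: jK; rewrite leqNgt => /negP; apply; nia.
have h2 m k : (0 < m)%N -> (0 < k)%N -> (\sum_(i < K.*2.+1) \sum_(j < K.*2.+1)
    (`|lz i|%N == m) * (`|lz j|%N == k) <= 4)%N.
  move=> m0 k0; under eq_bigr do rewrite -big_distrr/=.
  by rewrite -big_distrl/= -[4%N]/(2 * 2)%N leq_mul ?sum_lz_eq_le.
apply: (leq_trans (leq_add h1 (leq_add (h2 1%N K isT K0) (h2 K 1%N K0 isT)))).
by rewrite -!addnn; lia.
Qed.

End QuadraticCounts.

Section Quadratic.
Context (R : realType).
Implicit Types (x y s : R).

Lemma sum_quad K (F : 2.-tuple 'I_K.*2.+1 -> nat) :
  (\sum_t F t = \sum_(i < K.*2.+1) \sum_(j < K.*2.+1) F (quad i j))%N.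
Proof.
rewrite [LHS]sum_tuple_cons; apply: eq_bigr => i _.
rewrite [LHS]sum_tuple_cons; apply: eq_bigr => j _.
rewrite (big_pred1 [tuple])/=; last by move=> t; apply/esym/eqP; exact: tuple0.
by congr F; exact: val_inj.
Qed.

Lemma horner_quad K (i j : 'I_K.*2.+1) x :
  ('X^2 + lpoly R (quad i j)).[x] = x ^+ 2 + lc R j * x + lc R i.
Proof.
rewrite hornerD hornerXn horner_lpoly 2!big_ord_recl big_ord0 !(tnth_nth i)/=.
by rewrite expr0 expr1 mulr1; ring.
Qed.

Lemma discE K (i j : 'I_K.*2.+1) : (disc i j)%:~R = lc R j ^+ 2 - 4 * lc R i.
Proof. by rewrite /disc /lz rmorphB/= rmorphXn/= rmorphM/= !rmorphB/=. Qed.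

Lemma disc0_reducible K (i j : 'I_K.*2.+1) : disc i j = 0 -> reducible (mpol (quad i j)).
Proof.
move=> D0; apply/reducible_quadP.
have : exists q : int, lz j = 2 * q.
  exists (lz j %/ 2)%Z; have := divz_eq (lz j) 2; have : (lz j %% 2)%Z = 0 \/ (lz j %% 2)%Z = 1 by lia.
  move: D0; rewrite /disc; move: (lz j %/ 2)%Z (lz j %% 2)%Z => q r D0 [->|->] e; first by lia.
  by move: D0; rewrite e; lia.
move=> [q jq]; exists (- q), (- q); move: D0; rewrite /disc jq => D0.
by split; lia.
Qed.

Lemma nroots_quad K (i j : 'I_K.*2.+1) : (0 < K)%N -> ~ reducible (mpol (quad i j)) ->
  (nroots ('X^2 + lpoly R (quad i j)) (- (3 * K%:R)) (3 * K%:R) + (disc i j <= 0)%R.*2 = 2)%N.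
Proof.
move=> K0 nred; set p := 'X^2 + _; set b := 3 * K%:R.
have pE y : p.[y] = y ^+ 2 + lc R j * y + lc R i by exact: horner_quad.
have pD y : 4 * p.[y] = (2 * y + lc R j) ^+ 2 - (disc i j)%:~R by rewrite pE discE; ring.
have [D0|D0] := leP (disc i j) 0.
  rewrite /nroots; case E: (roots p (- b) b) => [//|y l].
  have : y \in roots p (- b) b by rewrite E inE eqxx.
  rewrite in_roots => /and3P[/rootP py _ _].
  have := pD y; rewrite py mulr0 => e.
  have D1 : 0 <= disc i j by rewrite -(ler0z R); have := sqr_ge0 (2 * y + lc R j); lra.
  by case: nred; apply: disc0_reducible; lia.
have Dp : 0 < (disc i j)%:~R :> R by rewrite ltr0z.
pose d : R := Num.sqrt (disc i j)%:~R; have d0 : 0 < d by rewrite sqrtr_gt0.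
have dd : d ^+ 2 = (disc i j)%:~R by rewrite sqr_sqrtr// ltW.
clearbody d; rewrite addn0 /nroots -[RHS]/(size [:: (- lc R j - d) / 2; (- lc R j + d) / 2]).
have K1 : 1 <= K%:R :> R by rewrite ler1n.
apply: perm_size; apply: uniq_perm; first exact: uniq_roots.
  by rewrite /= inE andbT lt_eqF// ltr_pM2r ?invr_gt0//; lra.
move=> y; rewrite !inE.
have -> : (y \in roots p (- b) b) = root p y.
  apply/idP/idP => [|rx]; first by rewrite in_roots => /and3P[].
  rewrite in_roots rx monic_lpoly_neq0 andbT/= in_itv/= -ltr_norml.
  by apply: lt_le_trans (monic_root_bound rx) _; rewrite /b; lra.
have -> : root p y = (4 * p.[y] == 0) by rewrite rootE mulf_eq0 pnatr_eq0.
rewrite pD -dd subr_sqr mulf_eq0 orbC; congr (_ || _); apply/eqP/eqP => h; lra.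
Qed.

Lemma sum_double (I : finType) (F : I -> nat) : ((\sum_i F i).*2 = \sum_i (F i).*2)%N.
Proof. by rewrite -muln2 big_distrl/=; apply: eq_bigr => i _; exact: muln2. Qed.

(** Each polynomial accounts for 2: an irreducible one with positive discriminant has two real
    roots, and any other is counted once by either [parabola] or [splitting] and gives no root. *)
Lemma Omega_quadratic K : (0 < K)%N ->
  (Omega 2 (K%:R : R) + (parabola K).*2 + (splitting K).*2 = (K.*2.+1 ^ 2).*2)%N.
Proof.
move=> K0.
have KQ : K%:R <= (K%:R : R) < K.+1%:R by rewrite lexx ltr_nat ltnS leqnn.
rewrite (Omega_sum _ K0 KQ)// big_mkcond/= [X in (X + _ + _)%N]sum_quad.
have -> : ((K.*2.+1 ^ 2).*2 = \sum_(i < K.*2.+1) \sum_(j < K.*2.+1) 2)%N.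
  by rewrite !sum_nat_const !card_ord; move: K.*2.+1 => M; rewrite -muln2 expnS expn1 mulnA.
rewrite /parabola /splitting !sum_double -!big_split/=; apply: eq_bigr => i _.
rewrite !sum_double -!big_split/=.
apply: eq_bigr => j _.
case: asboolP => red /=.
  by rewrite andbT add0n; case: (leP (disc i j) 0).
by rewrite andbF addn0; exact: nroots_quad.
Qed.

(** The value is read off from the counts: for [h = b x] the clamp is inactive on [(0, 1)], so the
    count is [abssum K 0] up to [O(K)], and this is [K^2] up to [O(K)]. *)
Lemma Int_phi1 : Int (@phi R 1) 0 1 = 1.
Proof.
have [C HC] := Tcount_phi 1 (@ltr01 R).
apply: (@eq_of_dist _ _ _ (C + 20)) => K K0.
have K1 : 1 <= K%:R :> R by rewrite ler1n.
have {}HC := HC K K0; have HT := Tcount_coarea K 1 (@ltr01 R).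
have hk : K%:R + 2^-1 = K%:R + 2^-1 :> R by [].
have HA := @abssum_approx R K 0 _ hk.
rewrite oppr0 add0r ppos2_le0 ?addr0 ?subr0 ?expr0n ?addr0 in HA; last lra.
have E : \sum_(t : 1.-tuple 'I_K.*2.+1) Int (vden (horner (hpoly R t)) (horner (hpoly R t)^`()) K%:R) 0 1
    = abssum K (0 : R).
  rewrite sum_tuple_cons /abssum; apply: eq_bigr => i _.
  rewrite (big_pred1 [tuple])/=; last by move=> t; apply/esym/eqP; exact: tuple0.
  have hE x : (hpoly R (cons_tuple i [tuple])).[x] = lc R i * x.
    by rewrite horner_hpoly big_ord_recl big_ord0 (tnth_nth ord0)/= expr1 addr0.
  have dE x : (hpoly R (cons_tuple i [tuple]))^`().[x] = lc R i.
    by rewrite horner_deriv_hpoly big_ord_recl big_ord0 (tnth_nth ord0)/= expr0 !mulr1 addr0.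
  rewrite -[RHS]mulr1 -[X in _ = _ * X](subr0 1) -Int_cst//.
  apply: Int_eq; first exact: itg_vden_poly.
  move=> x /andP[x0 x1]; rewrite /vden hE dE addr0 (_ : `|_| <= K%:R) ?mulr1//.
  rewrite normrM (ger0_norm (ltW x0)); apply: le_trans (lc_bound R i).
  by rewrite ler_piMr// ltW.
rewrite E expr1 double_half in HT.
have Kp : 0 < K%:R :> R by lra.
have K2 : 0 < K%:R ^+ 2 :> R by rewrite exprn_gt0.
move: HC HT HA; set T := Tcount _ _ _ _; set I := Int _ _ _; set S := abssum _ _.
move=> HC HT HA.
have TI : `|T / K%:R ^+ 2 - 1| <= 20 / K%:R.
  have -> : T / K%:R ^+ 2 - 1 = (T - K%:R ^+ 2) / K%:R ^+ 2.
    by rewrite mulrBl divff// gt_eqF.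
  rewrite normrM normfV (gtr0_norm K2) ler_pdivrMr//.
  have -> : 20 / K%:R * K%:R ^+ 2 = 20 * K%:R :> R by rewrite [K%:R ^+ 2]expr2 mulrA divfK ?gt_eqF.
  by move: HT HA; rewrite !ler_norml => /andP[a b] /andP[c d]; apply/andP; split; lra.
rewrite mulrDl; apply: (le_trans (ler_distD (T / K%:R ^+ 2) _ _)).
by rewrite lerD// distrC.
Qed.

Lemma phi1_total : \int[lebesgue_measure]_(t in [set: R]) phi 1 t = 4.
Proof. by rewrite (@phi_total R 1 1)// invr1 Int_phi1; lra. Qed.

Lemma sum_squares (N : R) B : \sum_(j < B) (N - j.+1%:R ^+ 2 / 4)
  = B%:R * N - B%:R * (B%:R + 1) * (2 * B%:R + 1) / 24.
Proof.
elim: B => [|B IH]; first by rewrite big_ord0; field.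
by rewrite big_ord_recr/= IH -natr1; field.
Qed.

(** The summand [N - j^2 / 4] vanishes at [j = 2 s], so stopping at the integer part [B] of [2 s]
    costs only [O(s)], and so do the roundings. The terms of order [s^2] cancel against the row of
    linear coefficient 0. *)
Lemma parabola_asymptotics N s : (4 <= N)%N -> 0 < s -> N%:R = s ^+ 2 ->
  `|(parabola N)%:R - 8 / 3 * s ^+ 3| <= 20 * s.
Proof.
move=> N4 s0 Ns; have N4' : 4 <= N%:R :> R by rewrite ler_nat.
have s2 : 2 <= s by nra.
pose B := Num.truncn (2 * s).
have /andP[Bs sB] : B%:R <= 2 * s < B.+1%:R by apply: truncn_itv; lra.
have B2 : (B * B <= 4 * N)%N.
  rewrite -(ler_nat R) !natrM Ns; have : 0 <= B%:R :> R by []; nra.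
have B3 : (4 * N < B.+1 * B.+1)%N.
  by rewrite -(ltr_nat R) !natrM Ns; nra.
have BN : (B <= N)%N by nia.
rewrite parabola_sum.
pose g j := (N.+1 - (j.+1 * j.+1 + 3) %/ 4)%N.
have -> : (\sum_(j < N) (N.+1 - (j.+1 * j.+1 + 3) %/ 4) = \sum_(j < B) g j)%N.
  rewrite (big_ord_widen_cond N xpredT g BN) [RHS]big_mkcond/=; apply: eq_bigr => j _.
  case: ltnP => // Bj.
  have hj : (B.+1 * B.+1 <= j.+1 * j.+1)%N by apply: leq_mul; rewrite ltnS.
  by move: (j.+1 * j.+1)%N (leq_trans B3 hj) => n h; lia.
have gE (j : 'I_B) : `|(g j)%:R - (N%:R - j.+1%:R ^+ 2 / 4)| <= 1 :> R.
  have jB : (j.+1 * j.+1 <= 4 * N)%N by apply: leq_trans B2; rewrite leq_mul.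
  rewrite -natrX expnS expn1 /g; move: (j.+1 * j.+1)%N jB => n nN.
  have q1 : ((n + 3) %/ 4 <= N.+1)%N by lia.
  rewrite natrB// -natr1.
  have q2 : n%:R <= 4 * ((n + 3) %/ 4)%:R :> R by rewrite -natrM ler_nat; lia.
  have q3 : 4 * ((n + 3) %/ 4)%:R <= n%:R + 3 :> R by rewrite -natrM -natrD ler_nat; lia.
  move: q2 q3; move: (_ %/ _)%:R n%:R => a b q2 q3.
  by rewrite ler_norml; apply/andP; split; lra.
rewrite natrD -muln2 natrM natr_sum -natr1.
have H : `|\sum_(j < B) (g j)%:R - (B%:R * N%:R - B%:R * (B%:R + 1) * (2 * B%:R + 1) / 24)| <= B%:R :> R.
  rewrite -sum_squares -sumrB (le_trans (ler_norm_sum _ _ _))//.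
  apply: (@le_trans _ _ (\sum_(j < B) 1)); first by apply: ler_sum => j _; exact: gE.
  by rewrite sumr_const card_ord.
move: H sB Bs; rewrite -natr1; set S := \sum_(j < B) _; set b : R := B%:R.
move=> H sB Bs; pose th := 2 * s - b.
have bE : b = 2 * s - th by rewrite /th; ring.
have th0 : 0 <= th by rewrite /th; lra.
have th1 : th <= 1 by rewrite /th; lra.
have -> : N%:R + 1 + S * 2 - 8 / 3 * s ^+ 3 =
  2 * (S - (b * N%:R - b * (b + 1) * (2 * b + 1) / 24))
  + (- (s * th ^+ 2) + th ^+ 3 / 6 + s * th - th ^+ 2 / 4 - s / 6 + th / 12 + 1).
  by rewrite Ns bE; clearbody S th; field.
have t2 : 0 <= th ^+ 2 <= 1 by rewrite sqr_ge0/=; nra.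
have t3 : 0 <= th ^+ 3 <= 1 by rewrite exprn_ge0//= exprn_ile1.
have st : 0 <= s * th <= s by apply/andP; split; nra.
have st2 : 0 <= s * th ^+ 2 <= s by case/andP: t2 => *; apply/andP; split; nra.
move: H t2 t3 st st2; rewrite !ler_norml.
move: (S - _) (s * th ^+ 2) (s * th) (th ^+ 3) (th ^+ 2) => ? ? ? ? ?.
move=> /andP[? ?] /andP[? ?] /andP[? ?] /andP[? ?] /andP[? ?]; apply/andP; split; lra.
Qed.

(** In [2 (2 N + 1)^2] minus twice [parabola] and twice [splitting], the parabola gives the term in
    [1 / sqrt N] and the divisor sum the logarithm. The coefficient of [N] is
    [8 - 4 - 4 (2 gamma - 1) = 8 (1 - gamma)]. *)
Lemma remainder_quadratic : exists C : R, \forall N \near \oo,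
  `|remainder 2 N%:R - (- (ln N%:R / N%:R) + 2 * (1 - euler_gamma R) / N%:R)|
    <= C / (N%:R * Num.sqrt N%:R).
Proof.
have [C HC] := divsum_asymptotics R.
exists ((60 + 4 * C) / 4); exists 4%N => // N /= N4.
have N0 : (0 < N)%N by lia.
have N4' : 4 <= N%:R :> R by rewrite ler_nat.
pose s : R := Num.sqrt N%:R; have s0 : 0 < s by rewrite sqrtr_gt0 ltr0n.
have Ns : N%:R = s ^+ 2 by rewrite sqr_sqrtr.
have s2 : 2 <= s by nra.
have P := parabola_asymptotics N4 s0 Ns; have {}HC := HC N s N0 s0 Ns.
pose u := Num.truncn s.
have /andP[us su] : u%:R <= s < u.+1%:R by apply: truncn_itv; lra.
have Nu : (N < u.+1 ^ 2)%N by rewrite -(ltr_nat R) natrX Ns ltr_pXn2r// nnegrE; lra.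
have [S1 S2] := splitting_bound N0 Nu.
have {}S1 : 2 * (splitting N)%:R <= 4 * N%:R + 4 * (divsum N)%:R + 1 :> R.
  by move: S1; rewrite -(ler_nat R) -mul2n [(_ + 1)%:R]natrD [(4 * _ + _)%:R]natrD !natrM.
have {}S2 : 4 * N%:R + 4 * (divsum N)%:R <= 2 * (splitting N)%:R + 2 * u%:R + 10 :> R.
  by move: S2; rewrite -(ler_nat R) -!mul2n [(_ + 10)%:R]natrD [(2 * _ + _)%:R]natrD
    [(4 * _ + _)%:R]natrD !natrM.
have OE : (Omega 2 (N%:R : R))%:R + (parabola N)%:R * 2 + (splitting N)%:R * 2
    = 2 * (2 * N%:R + 1) ^+ 2 :> R.
  transitivity ((N.*2.+1 ^ 2).*2%:R : R); last by rewrite -muln2 natrM natrX double_half; field.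
  by rewrite -(Omega_quadratic N0) 2!natrD -!muln2 2!natrM.
rewrite /remainder /= phi1_total -/s.
set g := euler_gamma R in HC *; set l := ln N%:R in HC *.
set O := (Omega 2 _)%:R in OE *.
have N0' : N%:R != 0 :> R by rewrite gt_eqF//; lra.
have -> : O / (2 * N%:R) ^+ 2 - (2 ^- 2 * 4 + 1 - 4 / (3 * s)) - (- (l / N%:R) + 2 * (1 - g) / N%:R)
  = (O - (8 * N%:R ^+ 2 - 16 / 3 * s ^+ 3 - 4 * N%:R * l + 8 * (1 - g) * N%:R)) / (4 * N%:R ^+ 2).
  by rewrite Ns; clearbody O l g s; field; rewrite gt_eqF.
have s2N : 0 < 4 * N%:R ^+ 2 :> R by rewrite mulr_gt0 ?exprn_gt0//; lra.
rewrite normrM normfV (gtr0_norm s2N) ler_pdivrMr//.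
have -> : (60 + 4 * C) / 4 / (N%:R * s) * (4 * N%:R ^+ 2) = (60 + 4 * C) * s.
  by rewrite Ns; clearbody s; field; rewrite gt_eqF.
have -> : O = 2 * (2 * N%:R + 1) ^+ 2 - 2 * (parabola N)%:R - 2 * (splitting N)%:R.
  by clear -OE; lra.
move: P HC S1 S2; set p := (parabola N)%:R; set q := (splitting N)%:R; set dv := (divsum N)%:R.
move=> P HC S1 S2.
have -> : 2 * (2 * N%:R + 1) ^+ 2 - 2 * p - 2 * q
   - (8 * N%:R ^+ 2 - 16 / 3 * s ^+ 3 - 4 * N%:R * l + 8 * (1 - g) * N%:R) =
  - 2 * (p - 8 / 3 * s ^+ 3) - 4 * (dv - (N%:R * l + (2 * g - 1) * N%:R))
  - (2 * q - 4 * N%:R - 4 * dv) + 2.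
  by clearbody p q dv l g; field.
have -> : (60 + 4 * C) * s = 60 * s + 4 * (C * s) by ring.
move: P HC; rewrite !ler_norml => /andP[P1 P2] /andP[D1 D2].
move: (p - _) (dv - (_ + _)) (C * s) P1 P2 D1 D2 => a b c P1 P2 D1 D2.
by apply/andP; split; lra.
Qed.

End Quadratic.

(** The remainder is defined by the first equation, so only its size is at stake. For [n = 2] the
    expansion runs along integers: the count depends only on [K = floor(Q)], and [2 (K / Q)^2] may
    differ from 2 by order [1/Q], which exceeds the error term. *)
Theorem theorem3 (R : realType) (n : nat) (hn : (2 <= n)%N) :
  exists r : R -> R,
    [/\ forall Q : R, 0 < Q ->
          (Omega n Q)%:R / (2 * Q) ^+ n =
            2 ^- n * (\int[lebesgue_measure]_(t in [set: R]) phi n.-1 t)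
            + 1 - 4 / (3 * Num.sqrt Q) + r Q,
        (3 <= n)%N ->
          exists C : R, \forall Q \near +oo_R, `|r Q| <= C / Q
      & n = 2%N ->
          exists C : R, \forall N \near \oo,
            `|r N%:R - (- (ln N%:R / N%:R) + 2 * (1 - euler_gamma R) / N%:R)|
              <= C / (N%:R * Num.sqrt N%:R)].
Proof.
case: n hn => [|[|[|m]]]// _; [exists (@remainder R 2)|exists (@remainder R m.+3)]; split=> //.
- by move=> Q _; rewrite /remainder addrC subrK.
- by move=> _; exact: remainder_quadratic.
- by move=> Q _; rewrite /remainder addrC subrK.
- by move=> _; exact: remainder_large.
Qed.
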